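(* Let $\theta$ be an exceptional domestic automorphism of a thick irreducible spherical building $\Delta$. (a) If $\theta$ is an oppomorphism and $\Delta$ is simply laced, then $\theta$ is strongly exceptional domestic. (b) If $\theta$ is not an oppomorphism, then $\theta$ is not strongly exceptional domestic.
   Context: A spherical building $\Delta$ of type $(W,S)$ (with $(W,S)$ a finite Coxeter system with longest element $w_0$) is regarded as a simplicial complex with type map $\tau:\Delta\to 2^S$ and Weyl distance $\delta$ on chambers. Write $J^{w_0}=w_0^{-1}Jw_0$ for $J\subseteq S$. Chambers $C,D$ are opposite if $\delta(C,D)=w_0$; simplices $\alpha,\beta$ are opposite if $\tau(\beta)=\tau(\alpha)^{w_0}$ and some chamber containing $\alpha$ is opposite some chamber containing $\beta$. An automorphism $\theta$ is any simplicial complex automorphism (types may be permuted); $\pi_\theta$ is the permutation of $S$ with $\delta(C,D)=s\iff\delta(C^\theta,D^\theta)=s^{\pi_\theta}$. $\theta$ is an oppomorphism if $s^{\pi_\theta}=w_0^{-1}sw_0$ for all $s\in S$. $\mathrm{Opp}(\theta)$ is the set of simplices $\sigma$ opposite $\sigma^\theta$, and $\mathrm{Typ}(\theta)$ is the union of all $J\subseteq S$ such that $\mathrm{Opp}(\theta)$ contains a simplex of type $J$. A nontrivial automorphism $\theta$ is domestic if $\mathrm{Opp}(\theta)$ contains no chamber; exceptional domestic if it is domestic and $\mathrm{Typ}(\theta)=S$; strongly exceptional domestic if it is domestic and for every proper subset $J\subsetneq S$ with $J^{\pi_\theta w_0}=J$ there is a simplex of type $J$ in $\mathrm{Opp}(\theta)$.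 $\Delta$ is simply laced if its Coxeter graph has only simple bonds. *)

(* Defs.v *)
From HB Require Import structures.
From mathcomp Require Import all_boot all_fingroup.
From mathcomp Require Import boolp classical_sets.

Set Implicit Arguments.
Unset Strict Implicit.
Unset Printing Implicit Defensive.

Local Open Scope group_scope.

(* A finite Coxeter system (W, S): W is the full group on [gT], with the
   presentation < S | (s t)^m(s,t) = 1 >, where m(s,t) is the order of s t
   (in particular s^2 = 1).  The presentation is stated by its universal
   property among all, possibly infinite, groups. *)
Record coxeter_system (gT : finGroupType) := CoxeterSystem {
  gens : {set gT};
  gens_generate : <<gens>> = [set: gT];
  gens_involution : forall s, s \in gens -> #[s] = 2;
  gens_presentation : forall (G : groupType) (f : gT -> G),
    (forall s t, s \in gens -> t \in gens -> (f s * f t) ^+ #[s * t] = 1) ->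
    exists phi : gT -> G,
      (forall x y, phi (x * y) = phi x * phi y) /\
      (forall s, s \in gens -> phi s = f s)
}.

Section Coxeter.

Variables (gT : finGroupType) (cox : coxeter_system gT).
Local Notation S := (gens cox).

Lemma ex_word (w : gT) : exists n, w \in S ^+ n.
Proof.
have: w \in <<S>> by rewrite gens_generate inE.
case/gen_prodgP=> n [c Sc ->]; exists n.
rewrite -[n in S ^+ n]card_ord -prodg_const.
by apply/prodsgP; exists c.
Qed.

(* [S ^+ n] is the set of products of exactly n elements of S. *)
Definition cox_length (w : gT) : nat := ex_minn (ex_word w).

Definition longest : gT := [arg max_(w > 1) cox_length w].

(* Edges of the Coxeter graph: m(s,t) >= 3 *)
Definition coxeter_edge : rel gT :=
  [rel s t | [&& s \in S, t \in S & (2 < #[s * t])%N]].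

Definition irreducible : Prop :=
  S != finset.set0 /\ {in S &, forall s t, connect coxeter_edge s t}.

Definition simply_laced : Prop :=
  forall s t, coxeter_edge s t -> #[s * t] = 3.

End Coxeter.

(* Buildings of type (W, S) as sets of chambers with a Weyl distance. *)
Record building (gT : finGroupType) (cox : coxeter_system gT) := Building {
  chamber : Type;
  wdist : chamber -> chamber -> gT;
  chamber_inhabited : inhabited chamber;
  wdist1 : forall C D, wdist C D = 1 <-> C = D;
  wdist_step : forall C D C' s, s \in gens cox -> wdist C' C = s ->
    wdist C' D = s * wdist C D \/ wdist C' D = wdist C D;
  wdist_up : forall C D C' s, s \in gens cox -> wdist C' C = s ->
    cox_length cox (s * wdist C D) = (cox_length cox (wdist C D)).+1 ->
    wdist C' D = s * wdist C D;
  wdist_ex : forall C D s, s \in gens cox ->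
    exists C', wdist C' C = s /\ wdist C' D = s * wdist C D
}.

Section Building.

Variables (gT : finGroupType) (cox : coxeter_system gT) (Delta : building cox).
Local Notation S := (gens cox).
Local Notation w0 := (longest cox).

(* Each panel has at least three chambers: C and two others. *)
Definition thick : Prop :=
  forall (C : chamber Delta) s, s \in S ->
    exists D E, [/\ wdist C D = s, wdist C E = s & D <> E].

Definition residue (J : {set gT}) (C : chamber Delta) : set (chamber Delta) :=
  fun D => wdist C D \in <<J>>.

(* The simplicial complex of the building: a simplex of type J is identified
   with the set of chambers containing it, which is a residue of type S \ J;
   faces correspond to larger residues.  The empty simplex is the whole
   building (type set0), and a chamber C is the simplex [set C] of type S. *)
Record simplex := Simplex {
  chambers_of : set (chamber Delta);
  stype : {set gT};
  stype_sub : stype \subset S;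
  chambers_ofP : exists C, chambers_of = residue (S :\: stype) C
}.

Definition face (a b : simplex) : Prop :=
  subset (chambers_of b) (chambers_of a).

Lemma chamber_simplex_proof C : exists C', residue (S :\: S) C = residue (S :\: S) C'.
Proof. by exists C. Qed.

Definition chamber_simplex (C : chamber Delta) : simplex :=
  Simplex (subxx S) (chamber_simplex_proof C).

(* Automorphisms of the simplicial complex, as automorphisms of its face
   poset; no condition on types. *)
Record automorphism := Automorphism {
  aut_fun :> simplex -> simplex;
  aut_bij : bijective aut_fun;
  aut_face : forall a b, face (aut_fun a) (aut_fun b) <-> face a b
}.

Definition opposite (a b : simplex) : Prop :=
  stype b = stype a :^ w0 /\
  exists C D, [/\ chambers_of a C, chambers_of b D & wdist C D = w0].

Definition induces_type_perm (theta : automorphism) (p : {perm gT}) : Prop :=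
  perm_on S p /\
  forall C D C' D', theta (chamber_simplex C) = chamber_simplex C' ->
    theta (chamber_simplex D) = chamber_simplex D' ->
    forall s, s \in S -> (wdist C D = s <-> wdist C' D' = p s).

(* pi_theta, extended by the identity outside S; the default value 1 is never
   used, as the permutation exists and is unique. *)
Definition type_perm (theta : automorphism) : {perm gT} :=
  xget 1 (induces_type_perm theta).

Definition oppomorphism (theta : automorphism) : Prop :=
  forall s, s \in S -> type_perm theta s = s ^ w0.

Definition Opp (theta : automorphism) (a : simplex) : Prop :=
  opposite a (theta a).

Definition Opp_has_type (theta : automorphism) (J : {set gT}) : Prop :=
  exists a, Opp theta a /\ stype a = J.

Definition Typ (theta : automorphism) : {set gT} :=
  (\bigcup_(J : {set gT} | (J \subset S) && `[< Opp_has_type theta J >]) J)%SET.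

Definition domestic (theta : automorphism) : Prop :=
  (exists a, theta a <> a) /\ forall C, ~ Opp theta (chamber_simplex C).

Definition exceptional_domestic (theta : automorphism) : Prop :=
  domestic theta /\ Typ theta = S.

Definition strongly_exceptional_domestic (theta : automorphism) : Prop :=
  domestic theta /\
  forall J : {set gT}, J \proper S -> (type_perm theta @: J)%SET :^ w0 = J ->
    Opp_has_type theta J.

End Building.

(* Main.v *)
From HB Require Import structures.
Require Import Defs.
From mathcomp Require Import all_boot order ssralg ssrnum ssrint all_fingroup cyclic.
From mathcomp Require Import zify boolp.
From mathcomp Require classical_sets.

Set Implicit Arguments.
Unset Strict Implicit.
Unset Printing Implicit Defensive.

Local Open Scope group_scope.

(** The action of theta on chambers has for each chamber C a displacement, the element
    d(C, theta C) w_0 of W, which is 1 when C is opposite its image. A simplex of type J opposite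
    its image exists exactly when J is stable under the twist s |-> w_0 p(s) w_0, where p is the
    type permutation, and some displacement lies in the standard parabolic subgroup W_(S - J)
    (Opp_has_typeP). So the theorem is about the parabolic subgroups that contain displacements.
    The tool is the codistance d(X, theta Y) w_0: in a panel it takes a longer value at one
    chamber and a shorter one at all others. In a thick building, displacements can therefore be
    shortened unless each of their descents is two-sided and central up to the twist
    (displ_minimal).

    Part (b). Let K be a nontrivial orbit of the twist. As Typ theta = S and theta is domestic, K
    is not S; were theta strongly exceptional, some displacement would be in W_K. A minimal one is
    not 1, hence is the longest element of W_K, and the twist acts on K as conjugation by this
    involution: K is an edge {t, twist t} (twist_orbit). The graph being connected, an edge
    joins K to some c outside, and c, its twist and K make a triangle or a square. A finite
    Coxeter group has no cycle in its graph: the words that run around the cycle are all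
    reduced, because neither a braid nor a commutation applies to them (walk_rdesc).

    Part (a). Now the twist is the identity, and a displacement in W_{s} for every s is wanted
    (displ_generators); a proper subset J of S omits some s. Along a path a_0, ..., a_(n-1) of
    type A, the residues of type a_1, ..., a_(n-1) are the points of a projective space, and the
    pairs (X, Y) with codistance in the parabolic subgroup omitting a_0 are those at which a
    sesquilinear form b would not vanish; only the incidence properties of such a form are used.
    If b(X, X) is nonzero for some point, the dimension being at least three, there are two
    perpendicular such points (perp_no_line), and on the line through them displacements commute
    with a_0, hence avoid a_1 too (frame_displ, cone). By induction, a displacement avoiding an end
    of the path leads to displacements in W_{a_i} for all i (path_displ).

    The graph is a path, or a path with one more node k, where one arm of the path has at most two
    nodes (classification): the orbit of 0 in the shifted root lattice, being finite, contains a
    strictly superharmonic function on the graph, which is impossible if the graph contains an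
    affine diagram (no_subharmonic). As Typ theta = S, some displacement avoids any given node.
    For a path this is enough. Otherwise a displacement avoids k, and it remains to find one that
    also avoids an end of the path. If an arm has two nodes, the alternating product of nodes that
    a minimal displacement has become is slid across the branching node (fork_arm2_displ). If an
    arm has one node, the diagram is of type D, and a displacement that avoids a_0 gives a point of
    the polar space not perpendicular to its image; alternating forms on the maximal subspaces
    are excluded by comparing neighbouring ones (fork_displ). *)

(** * Lengths, inversions and the exchange condition *)

Section CoxeterTheory.

Variables (gT : finGroupType) (cox : coxeter_system gT).
Local Notation S := (gens cox).
Local Notation len := (cox_length cox).
(* The product through one fixed inheritance path, so that equal products are
   syntactically equal. *)
Local Notation "x * y" := (@mul gT x y) : group_scope.

Implicit Types (s t x y w : gT) (J K : {set gT}).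

(* The group laws for this form of the product, which rewriting then preserves. *)
Lemma mulA x y z : x * (y * z) = x * y * z. Proof. exact: mulgA. Qed.
Lemma invM x y : (x * y)^-1 = y^-1 * x^-1. Proof. exact: invMg. Qed.
Lemma conjE x y : x ^ y = y^-1 * (x * y). Proof. exact: conjgE. Qed.

Definition word_prod (ws : seq gT) : gT := \prod_(a <- ws) a.

Definition is_word (J : {set gT}) (ws : seq gT) : bool := all (mem J) ws.

Lemma word_prod_cons a ws : word_prod (a :: ws) = a * word_prod ws.
Proof. by rewrite /word_prod big_cons. Qed.

Lemma word_prod_nil : word_prod [::] = 1.
Proof. by rewrite /word_prod big_nil. Qed.

Lemma word_prod_cat ws1 ws2 :
  word_prod (ws1 ++ ws2) = word_prod ws1 * word_prod ws2.
Proof. by rewrite /word_prod big_cat. Qed.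

Lemma word_prod_rcons ws a : word_prod (rcons ws a) = word_prod ws * a.
Proof. by rewrite -cats1 word_prod_cat word_prod_cons word_prod_nil mulg1. Qed.

Lemma expgset_wordP J n w :
  reflect (exists ws, [/\ is_word J ws, size ws = n & word_prod ws = w])
          (w \in J ^+ n).
Proof.
apply: (iffP idP); elim: n w => [|n IH] w.
- by rewrite expg0 => /set1P->; exists [::]; rewrite word_prod_nil.
- rewrite expgS => /mulsgP[a b Ja /IH[ws [Jws sz <-]] ->].
  by exists (a :: ws); rewrite /= Ja Jws sz word_prod_cons.
- by case=> -[|a ws] [] //= _ _ <-; rewrite expg0 word_prod_nil set11.
- case=> -[|a ws] [//= /andP[Ja Jws] [sz] <-].
  rewrite expgS word_prod_cons mem_mulg //; apply: IH; by exists ws.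
Qed.

Lemma gen_wordP J w :
  reflect (exists ws, is_word J ws /\ word_prod ws = w) (w \in <<J>>).
Proof.
apply: (iffP idP) => [/gen_prodgP[n [c Jc ->]]|[ws [Jws <-]]].
  suff /expgset_wordP[ws [Jws _ <-]] : \prod_(i < n) c i \in J ^+ n by exists ws.
  by rewrite -[n in J ^+ n]card_ord -prodg_const; apply/prodsgP; exists c.
elim: ws Jws => [|a ws IH] /=; first by rewrite word_prod_nil group1.
by case/andP=> Ja Jws; rewrite word_prod_cons groupM ?IH // mem_gen.
Qed.

Lemma gens_word w : exists2 ws, is_word S ws & word_prod ws = w.
Proof.
by have /gen_wordP[ws []]: w \in <<S>>; [rewrite gens_generate inE | exists ws].
Qed.

Lemma len_word w :
  exists ws, [/\ is_word S ws, size ws = len w & word_prod ws = w].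
Proof. by apply/expgset_wordP; rewrite /cox_length; case: ex_minnP. Qed.

Lemma len_leq ws : is_word S ws -> len (word_prod ws) <= size ws.
Proof.
move=> Sws; rewrite /cox_length; case: ex_minnP => m _; apply.
by apply/expgset_wordP; exists ws.
Qed.

Lemma gensV s : s \in S -> s^-1 = s.
Proof.
by move=> /gens_involution os; apply/eqP; rewrite eq_invg_mul -[s * s]/(s ^+ 2) -os expg_order.
Qed.

Lemma gensK s : s \in S -> s * s = 1.
Proof. by move=> Ss; rewrite -{2}(gensV Ss) mulgV. Qed.

Lemma gens_neq1 s : s \in S -> s != 1.
Proof. by move=> /gens_involution os; rewrite -order_eq1 os. Qed.

Lemma gen_set0_1 w : w \in << (set0 : {set gT}) >> -> w = 1.
Proof. by rewrite gen0 => /set1P. Qed.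

(** The group acts on pairs of an element and a sign; only reflections matter
    as first components.  Applied to a word, the sign records the parity of the
    number of times that x occurs among the reflections crossed by the word, so
    that this parity depends on the product of the word only. *)
Definition sign_conj s (p : gT * bool) : gT * bool :=
  (p.1 ^ s, p.2 (+) (p.1 == s)).

Lemma sign_conj_inj s : injective (sign_conj s).
Proof.
move=> [x e] [y f] [/conjg_inj <-] /=.
by move/addIb->.
Qed.

Definition sign_perm s : {perm gT * bool} := perm (@sign_conj_inj s).

Lemma sign_permE s p : sign_perm s p = sign_conj s p.
Proof. by rewrite permE. Qed.

(** In the word (s t)^m every reflection of the dihedral group occurs an even number of
    times, so that all signs cancel. *)
Lemma sign_perm_order s t (m := #[s * t]) : s \in S -> t \in S ->
  (mul (sign_perm s) (sign_perm t)) ^+ m = 1.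
Proof.
move=> Ss St; pose r := s * t.
have rs k : r ^+ k * s = s * r ^- k.
  have rs1 : r ^ s = r^-1.
    by rewrite /r conjE invM (gensV Ss) (gensV St) !mulgA gensK // mul1g.
  by rewrite -expVgn -rs1 -conjXg conjE (gensV Ss) !mulgA gensK // mul1g.
pose par x n := \big[addb/false]_(0 <= j < n) (x == r ^+ j * s).
(* the reflections met by (s t)^k are (s t)^j s for j < 2k *)
have key k x e :
    ((mul (sign_perm s) (sign_perm t)) ^+ k) (x, e) = (x ^ (r ^+ k), e (+) par x k.*2).
  elim: k => [|k IH].
    by rewrite !expg0 perm1 conjg1 /par big_geq // addbF.
  rewrite expgSr permM IH permM !permE /sign_conj /=.
  have E1 : (x ^ r ^+ k == s) = (x == r ^+ k.*2 * s).
    rewrite -addnn expgD -mulA. rewrite rs mulgA.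
    rewrite (canF_eq (conjgK (r ^+ k))) conjE invgK mulgA //.
  have E2 : ((x ^ r ^+ k) ^ s == t) = (x == r ^+ k.*2.+1 * s).
    have E : r ^+ k.*2.+1 * s = r ^+ k * (s * t * s) * r ^- k.
      by rewrite -addnn -addSn expgD -(mulA (r ^+ k.+1)) rs expgSr !mulA.
    rewrite (canF_eq (conjgK s)) (canF_eq (conjgK (r ^+ k))) E.
    by rewrite !conjE !invgK (gensV Ss) !mulA.
  rewrite E1 E2 -!conjgM (mulgA (r ^+ k)) -/r -mulA -/r -expgSr.
  by rewrite /par doubleS !big_nat_recr //= !addbA.
apply/permP=> -[x e]; rewrite key perm1 /m expg_order conjg1.
suff -> : par x #[s * t].*2 = false by rewrite addbF.
rewrite /par -addnn (big_cat_nat _ (leq_addr _ _)) //=.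
rewrite -{2}(add0n #[s * t]) big_addn addnK.
rewrite [X in _ (+) X](eq_bigr (fun j => x == r ^+ j * s)) ?addbb // => j _.
by rewrite addnC expgD /r expg_order mul1g.
Qed.

Lemma ex_sign_hom : exists phi : gT -> {perm gT * bool},
  (forall x y, phi (x * y) = mul (phi x) (phi y)) /\
  (forall s, s \in S -> phi s = sign_perm s).
Proof. by apply: (gens_presentation (G := {perm gT * bool})) => s t Ss St; apply: sign_perm_order. Qed.

Definition sign_hom := projT1 (cid ex_sign_hom).

Lemma sign_homM x y : sign_hom (x * y) = mul (sign_hom x) (sign_hom y).
Proof. by rewrite /sign_hom; case: cid => phi []. Qed.

Lemma sign_hom_gen s : s \in S -> sign_hom s = sign_perm s.
Proof. by move=> Ss; rewrite /sign_hom; case: cid => phi [/= _ ->]. Qed.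

Lemma sign_hom1 : sign_hom 1 = 1.
Proof. by apply: (mulIg (sign_hom 1)); rewrite -sign_homM !mul1g. Qed.

(** For a reflection x: does its wall separate 1 from w? As a parity, this satisfies the
    cocycle law inversionM, whatever words are chosen. *)
Definition inversion w x : bool := (sign_hom w (x, false)).2.

Lemma sign_homE w x e : sign_hom w (x, e) = (x ^ w, e (+) inversion w x).
Proof.
rewrite /inversion; have [ws Sws <-] := gens_word w.
elim: ws x e Sws => [|a ws IH] x e /=.
  by rewrite word_prod_nil sign_hom1 !perm1 conjg1 addbF.
case/andP=> Sa Sws; rewrite word_prod_cons sign_homM !permM (sign_hom_gen Sa) !sign_permE.
by rewrite /sign_conj /= [LHS]IH // [in RHS]IH //= conjgM addbA.
Qed.

Lemma inversionM w1 w2 x :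
  inversion (w1 * w2) x = inversion w1 x (+) inversion w2 (x ^ w1).
Proof. by rewrite {1}/inversion sign_homM permM sign_homE sign_homE. Qed.

Lemma inversion1 x : inversion 1 x = false.
Proof. by rewrite /inversion sign_hom1 perm1. Qed.

Lemma inversion_gen s x : s \in S -> inversion s x = (x == s).
Proof. by move=> Ss; rewrite /inversion sign_hom_gen // sign_permE. Qed.

(** Deletion: a left inversion of the product of a word is one of the reflections of the
    word, so that multiplying by it erases a letter. *)
Lemma inversion_delete ws x : is_word S ws -> inversion (word_prod ws) x ->
  exists us a vs, ws = us ++ a :: vs /\ x * word_prod ws = word_prod (us ++ vs).
Proof.
elim: ws x => [|a ws IH] x /=; first by rewrite word_prod_nil inversion1.
case/andP=> Sa Sws; rewrite word_prod_cons inversionM inversion_gen //.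
case: eqP => [-> _ | _ /= /(IH _ Sws)[us [b [vs [-> E]]]]].
  by exists [::], a, ws; rewrite mulgA gensK // mul1g.
exists (a :: us), b, vs; split=> //=.
by rewrite [RHS]word_prod_cons -E conjE gensV // !mulgA gensK // mul1g.
Qed.

Lemma size_delete (us vs : seq gT) a : size (us ++ a :: vs) = (size (us ++ vs)).+1.
Proof. by rewrite !size_cat addnS. Qed.

Lemma is_word_delete J us vs a :
  is_word J (us ++ a :: vs) -> is_word J (us ++ vs).
Proof. by rewrite /is_word !all_cat /= => /and3P[-> _ ->]. Qed.

Lemma inversion_lt w x : inversion w x -> len (x * w) < len w.
Proof.
have [ws [Sws <- <-]] := len_word w => /(inversion_delete Sws)[us [a [vs [E ->]]]].
by move: Sws; rewrite E size_delete ltnS => /is_word_delete/len_leq.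
Qed.

Lemma invgen_mul s w : s \in S -> inversion (s * w) s = ~~ inversion w s.
Proof. by move=> Ss; rewrite inversionM inversion_gen // eqxx conjE (gensV Ss) gensK // mulg1. Qed.

(** Descents are defined as inversions: the cocycle law then computes them. *)
Definition ldesc w s : bool := inversion w s.

Definition rdesc w s : bool := inversion w^-1 s.

Lemma ldescP w s : s \in S -> ldesc w s = (len (s * w) < len w).
Proof.
move=> Ss; rewrite /ldesc; case: (boolP (inversion w s)) => [/inversion_lt ->//|].
rewrite -invgen_mul // => /inversion_lt; rewrite mulgA gensK // mul1g.
by case: ltngtP.
Qed.

Lemma len1 : len 1 = 0.
Proof. by apply/eqP; rewrite -leqn0 -word_prod_nil len_leq. Qed.

Lemma len_eq0 w : (len w == 0) = (w == 1).
Proof.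
apply/idP/eqP=> [/eqP lw|->]; last by rewrite len1.
have [ws [_ sz <-]] := len_word w.
by move: sz; rewrite lw => /size0nil->; rewrite word_prod_nil.
Qed.

Lemma lenV w : len w^-1 = len w.
Proof.
have leV x : len x^-1 <= len x.
  have [ws [Sws <- <-]] := len_word x.
  have -> : (word_prod ws)^-1 = word_prod (rev ws).
    elim: ws Sws => [|a ws IH] /=; first by rewrite word_prod_nil invg1.
    case/andP=> Sa Sws.
    by rewrite word_prod_cons invM IH // rev_cons word_prod_rcons gensV.
  by rewrite -size_rev len_leq // /is_word all_rev.
by apply/eqP; rewrite eqn_leq leV -{1}(invgK w) leV.
Qed.

Lemma len_mul_leq x y : len (x * y) <= len x + len y.
Proof.
have [ws [Sws <- E1]] := len_word x; have [vs [Svs <- E2]] := len_word y.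
rewrite -E1 -E2.
by rewrite -size_cat -word_prod_cat len_leq // /is_word all_cat; apply/andP.
Qed.

Lemma len_gen s : s \in S -> len s = 1%N.
Proof.
move=> Ss; apply/eqP; rewrite eqn_leq lt0n len_eq0 gens_neq1 // andbT.
by have := @len_leq [:: s]; rewrite /= Ss word_prod_cons word_prod_nil mulg1; apply.
Qed.

Lemma len_ldesc w s : s \in S -> len (s * w) = if ldesc w s then (len w).-1 else (len w).+1.
Proof.
move=> Ss; have le1 x : len (s * x) <= (len x).+1.
  by rewrite (leq_trans (len_mul_leq _ _)) // len_gen.
have := le1 w; have := le1 (s * w); have := ldescP w Ss.
have := ldescP (s * w) Ss; rewrite /ldesc invgen_mul // mulA gensK // mul1g.
by case: inversion => /=; lia.
Qed.

Lemma ldescE w s : ldesc w s = inversion w s. Proof. by []. Qed.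

Lemma rdescE w s : rdesc w s = ldesc w^-1 s. Proof. by []. Qed.

Lemma len_rdesc w s : s \in S -> len (w * s) = if rdesc w s then (len w).-1 else (len w).+1.
Proof. by move=> Ss; rewrite -lenV invM (gensV Ss) len_ldesc // lenV. Qed.

Lemma rdescP w s : s \in S -> rdesc w s = (len (w * s) < len w).
Proof. by move=> Ss; rewrite rdescE ldescP // -lenV invM invgK (gensV Ss) lenV. Qed.

Lemma ldesc_len_gt0 w s : s \in S -> ldesc w s -> 0 < len w.
Proof. by move=> Ss; rewrite ldescP //; apply: leq_ltn_trans. Qed.

Lemma lenS_ldesc w s : s \in S -> ldesc w s -> len w = (len (s * w)).+1.
Proof. by move=> Ss dw; rewrite len_ldesc // dw prednK // (ldesc_len_gt0 Ss dw). Qed.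

Lemma lenS_rdesc w s : s \in S -> rdesc w s -> len w = (len (w * s)).+1.
Proof.
by move=> Ss; rewrite rdescE => /(lenS_ldesc Ss); rewrite lenV => ->; rewrite -lenV invM invgK gensV.
Qed.

Lemma ldesc_mul s w : s \in S -> ldesc (s * w) s = ~~ ldesc w s.
Proof. exact: invgen_mul. Qed.

Lemma rdesc_mul s w : s \in S -> rdesc (w * s) s = ~~ rdesc w s.
Proof. by move=> Ss; rewrite /rdesc invM (gensV Ss) invgen_mul. Qed.

(** The cocycle law at a generator: multiplying by t changes the status of one
    reflection only. *)
Lemma ldesc_mulr w s t : t \in S -> ldesc (w * t) s = ldesc w s (+) (s ^ w == t :> gT).
Proof. by move=> St; rewrite /ldesc inversionM (inversion_gen _ St). Qed.

Lemma rdesc_mull w s t : t \in S ->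
  rdesc (t * w) s = rdesc w s (+) (t ^ w == s :> gT).
Proof.
move=> St; rewrite /rdesc invM (gensV St) inversionM (inversion_gen _ St).
by congr addb; apply/eqP/eqP => <-; rewrite ?conjgK ?conjgKV.
Qed.

Lemma ldesc_ex w : w != 1 -> exists2 s, s \in S & ldesc w s.
Proof.
have [[|a ws] [Sws sz E]] := len_word w; first by rewrite -E word_prod_nil eqxx.
move=> _; case/andP: Sws => Sa Sws; exists a => //; rewrite ldescP // -E word_prod_cons.
rewrite mulgA gensK // mul1g -word_prod_cons E -sz; exact: len_leq.
Qed.

Lemma rdesc_ex w : w != 1 -> exists2 s, s \in S & rdesc w s.
Proof. by rewrite -invg_eq1 => /ldesc_ex. Qed.

End CoxeterTheory.

(** * Standard parabolic subgroups *)

Section Parabolic.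

Variables (gT : finGroupType) (cox : coxeter_system gT).
Local Notation S := (gens cox).
Local Notation len := (cox_length cox).
Local Notation "x * y" := (@mul gT x y) : group_scope.
Local Notation ldesc := (ldesc cox).
Local Notation rdesc := (rdesc cox).
Local Notation inversion := (inversion cox).
Local Notation w0 := (longest cox).

Implicit Types (a b g r s t x y z v w : gT) (A B J K : {set gT}).

Lemma gen_indl J (P : gT -> Prop) : P 1 ->
  (forall s x, s \in J -> x \in <<J>> -> P x -> P (s * x)) ->
  forall w, w \in <<J>> -> P w.
Proof.
move=> P1 PM w /gen_wordP[ws [Jws <-]]; elim: ws Jws => [|a ws IH] /=.
  by rewrite word_prod_nil.
case/andP=> Ja Jws; rewrite word_prod_cons; apply: PM => //; last exact: IH.
by apply/gen_wordP; exists ws.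
Qed.

Lemma gen_indr J (P : gT -> Prop) : P 1 ->
  (forall s x, s \in J -> x \in <<J>> -> P x -> P (x * s)) ->
  forall w, w \in <<J>> -> P w.
Proof.
move=> P1 PM w /gen_wordP[ws [Jws <-]]; elim/last_ind: ws Jws => [|ws a IH] /=.
  by rewrite word_prod_nil.
rewrite /is_word all_rcons => /andP[Ja Jws].
rewrite word_prod_rcons; apply: PM => //; last exact: IH.
by apply/gen_wordP; exists ws.
Qed.

Lemma gen_word_reduced J w : J \subset S -> w \in <<J>> ->
  exists ws, [/\ is_word J ws, size ws = len w & word_prod ws = w].
Proof.
move=> sJ Jw; elim/gen_indl: w / Jw => [|s x Js _ [ws [Jws sz E]]].
  by exists [::]; rewrite word_prod_nil len1.
have Ss : s \in S by apply: (subsetP sJ).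
have Sws : is_word S ws by apply: sub_all Jws => y; apply: (subsetP sJ).
case: (boolP (ldesc x s)) => dx; last first.
  exists (s :: ws); split; rewrite /= ?word_prod_cons ?E //; first by apply/andP.
  by rewrite len_ldesc // (negbTE dx) sz.
have := dx; rewrite -E => /(inversion_delete Sws)[us [a [vs [Ews Ep]]]].
exists (us ++ vs); split; last by rewrite -Ep.
- by move: Jws; rewrite Ews; apply: is_word_delete.
- by rewrite len_ldesc // E dx -sz Ews size_delete.
Qed.

Lemma gen_gens J s : J \subset S -> s \in S -> (s \in <<J>>) = (s \in J).
Proof.
move=> sJ Ss; apply/idP/idP; last exact: mem_gen.
case/(gen_word_reduced sJ)=> [[|a [|b ws]]] []; rewrite (len_gen Ss) //.
by rewrite word_prod_cons word_prod_nil mulg1 /= andbT => Ja _ <-.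
Qed.

Lemma inversion_gen_mem J w x : J \subset S -> w \in <<J>> -> inversion w x ->
  x \in <<J>>.
Proof.
move=> sJ /[dup] Jw /gen_wordP[ws [Jws E]].
have Sws : is_word S ws by apply: sub_all Jws => y; apply: (subsetP sJ).
rewrite -E => /(inversion_delete Sws)[us [a [vs [Ews Ep]]]].
rewrite -(groupMr _ Jw) -E Ep; apply/gen_wordP; exists (us ++ vs); split=> //.
by move: Jws; rewrite Ews; apply: is_word_delete.
Qed.

Lemma ldesc_gen J w s : J \subset S -> w \in <<J>> -> s \in S -> ldesc w s ->
  s \in J.
Proof. by move=> sJ Jw Ss /(inversion_gen_mem sJ Jw); rewrite gen_gens. Qed.

Lemma rdesc_gen J w s : J \subset S -> w \in <<J>> -> s \in S -> rdesc w s ->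
  s \in J.
Proof. by move=> sJ Jw Ss; rewrite rdescE; apply: ldesc_gen; rewrite ?groupV. Qed.

Lemma genI J K w : J \subset S -> K \subset S ->
  w \in <<J>> -> w \in <<K>> -> w \in <<J :&: K>>.
Proof.
move=> sJ sK; have [n] := ubnP (len w); elim: n w => // n IH w lt_wn Jw Kw.
have [->|/ldesc_ex-/(_ cox)[s Ss dw]] := eqVneq w 1; first exact: group1.
have Js := ldesc_gen sJ Jw Ss dw; have Ks := ldesc_gen sK Kw Ss dw.
have := lenS_ldesc Ss dw => lw.
have JKs : s \in <<J :&: K>> by rewrite mem_gen // inE Js.
rewrite -(groupMl _ JKs); apply: IH; first by rewrite -ltnS -lw.
- by rewrite groupM // mem_gen.
- by rewrite groupM // mem_gen.
Qed.

Lemma genS_mem J K w : J \subset K -> w \in <<J>> -> w \in <<K>>.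
Proof. by move=> sJK; apply/subsetP/genS. Qed.

(** Otherwise a descent of x z that does not come from z would be a reflection of W_J
    that shortens x. *)
Lemma len_min_coset J x : J \subset S ->
  (forall y, y \in <<J>> -> len x <= len (x * y)) ->
  forall z, z \in <<J>> -> len (x * z) = (len x + len z)%N.
Proof.
move=> sJ minx z; have [n] := ubnP (len z); elim: n z => // n IH z lt_zn Jz.
have [->|/rdesc_ex-/(_ cox)[s Ss dz]] := eqVneq z 1; first by rewrite mulg1 len1 addn0.
have Js := rdesc_gen sJ Jz Ss dz.
have lz := lenS_rdesc Ss dz.
pose z1 := z * s; have Jz1 : z1 \in <<J>> by rewrite groupM // mem_gen.
have IH1 : len (x * z1) = (len x + len z1)%N by apply: IH => //; rewrite -ltnS -lz.
have Ez : z = z1 * s by rewrite /z1 -mulA (gensK Ss) mulg1.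
rewrite lz -/z1 addnS -IH1 {1}Ez mulA len_rdesc //.
suff /negbTE-> : ~~ rdesc (x * z1) s by [].
rewrite rdescE ldescE invM inversionM -[inversion z1^-1 s]/(rdesc z1 s).
rewrite {1}/z1 rdesc_mul // dz /=; apply/negP=> /inversion_lt.
rewrite -lenV invM invgK lenV ltnNge minx // groupV groupJ ?groupV //.
exact: mem_gen.
Qed.

Lemma min_cosetr J w : J \subset S -> exists x y, [/\ w = x * y, y \in <<J>>
  & forall z, z \in <<J>> -> len (x * z) = (len x + len z)%N].
Proof.
move=> sJ; have [y Jy miny] : exists2 y, y \in <<J>> &
    forall z, z \in <<J>> -> len (w * y) <= len (w * z).
  case: (arg_minnP (fun y => len (w * y)) (group1 <<J>>)) => y Jy miny.
  by exists y.
exists (w * y), y^-1; split; rewrite ?mulgK ?groupV //.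
by apply: len_min_coset => // z Jz; rewrite -mulA miny // groupM.
Qed.

Lemma lenD_no_rdesc J x z : J \subset S -> (forall s, s \in J -> ~~ rdesc x s) ->
  z \in <<J>> -> len (x * z) = (len x + len z)%N.
Proof.
move=> sJ nd; have [m [y [Ex Jy addm]]] := min_cosetr x sJ.
have [y1|/rdesc_ex-/(_ cox)[s Ss dy]] := eqVneq y 1.
  by rewrite Ex y1 mulg1; apply: addm.
have Js := rdesc_gen sJ Jy Ss dy; have /negP[] := nd s Js.
have Jys : y * s \in <<J>> by rewrite groupM // mem_gen.
by rewrite rdescP // Ex -mulA (addm _ Jys) (addm _ Jy) ltn_add2l -rdescP.
Qed.

Lemma lenD_no_ldesc J y z : J \subset S -> (forall s, s \in J -> ~~ ldesc y s) ->
  z \in <<J>> -> len (z * y) = (len z + len y)%N.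
Proof.
move=> sJ nd Jz; rewrite -lenV invM (lenD_no_rdesc (J := J)) ?groupV //.
  by rewrite !lenV addnC.
by move=> s Js; rewrite rdescE invgK nd.
Qed.

(** The factor a adds its length to that of y on one side and b on the other, which
    leaves no room for y. This tells double cosets apart. *)
Lemma double_coset_trivial A B y a b : A \subset S -> B \subset S ->
  (forall s, s \in A -> ~~ ldesc y s) -> (forall s, s \in B -> ~~ rdesc y s) ->
  a \in <<A>> -> b \in <<B>> -> y = a * b -> y = 1.
Proof.
move=> sA sB ndA ndB Aa Bb E.
have l1 : len b = (len a + len y)%N.
  by rewrite -(lenV _ a) -(lenD_no_ldesc sA ndA) ?groupV // E mulKg.
have l2 : len a = (len y + len b)%N.
  by rewrite -(lenV _ b) -(lenD_no_rdesc sB ndB) ?groupV // E mulgK.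
by apply/eqP; rewrite -(len_eq0 cox); lia.
Qed.

Lemma gen_not_ldesc J w s : J \subset S -> w \in <<J>> -> s \in S -> s \notin J ->
  ~~ ldesc w s.
Proof. by move=> sJ Jw Ss; apply: contra => /(ldesc_gen sJ Jw Ss). Qed.

Lemma gen_not_rdesc J w s : J \subset S -> w \in <<J>> -> s \in S -> s \notin J ->
  ~~ rdesc w s.
Proof. by move=> sJ Jw Ss; apply: contra => /(rdesc_gen sJ Jw Ss). Qed.

Lemma gen1 J s w : J = [set s] -> s \in S -> w \in <<J>> -> w = 1 \/ w = s.
Proof.
move=> -> Ss; elim/gen_indl: w / => [|t x /set1P-> _ [->|->]]; first by left.
- by right; rewrite mulg1.
- by left; apply: gensK Ss.
Qed.

(** The element s t s lies in W_J and in the dihedral group of s and t, so that it is t. *)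
Lemma gens_conj_commute J s t : J \subset S -> s \in S -> s \notin J -> t \in J ->
  s * t * s \in <<J>> -> s * t = t * s.
Proof.
move=> sJ Ss nJs Jt Jsts; have St := subsetP sJ t Jt.
have sK : [set s; t] \subset S by apply/subsetP=> x /set2P[]->.
have Ksts : s * t * s \in <<[set s; t]>>.
  by rewrite !groupM // mem_gen // ?set21 ?set22.
have := genI sJ sK Jsts Ksts; have -> : J :&: [set s; t] = [set t].
  apply/setP=> x; rewrite !inE; apply/andP/eqP => [[Jx /orP[] /eqP E] | ->].
  - by rewrite E (negbTE nJs) in Jx.
  - by [].
  - by rewrite eqxx orbT.
case/(gen1 (erefl _) St) => E.
  have Et : t = 1.
    by apply: (mulgI s); apply: (mulIg s); rewrite E mulg1 (gensK Ss).
  by have := gens_neq1 St; rewrite Et eqxx.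
by rewrite -{2}E -!mulA (gensK Ss) mulg1.
Qed.

(** A last letter t of w is a descent of s w, so that the reflection s t s belongs to W_J:
    hence t commutes with s and can be cancelled. *)
Lemma gen_conj_commute J s w : J \subset S -> s \in S -> s \notin J ->
  w \in <<J>> -> s * w * s \in <<J>> ->
  s * w = w * s /\ w \in <<[set t in J | s * t == t * s]>>.
Proof.
move=> sJ Ss nJs; have [n] := ubnP (len w); elim: n w => // n IH w lt_wn Jw Jg.
have [->|/rdesc_ex-/(_ cox)[t St dw]] := eqVneq w 1.
  by rewrite mulg1 mul1g group1.
have Jt := rdesc_gen sJ Jw St dw; set g := s * w * s in Jg.
have lsw : len (s * w) = (len w).+1.
  by rewrite len_ldesc // (negbTE (gen_not_ldesc sJ Jw Ss nJs)).
have Egs : g * s = s * w by rewrite /g -mulA (gensK Ss) mulg1.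
have lg : len g = len w.
  by apply: succn_inj; rewrite -lsw -Egs len_rdesc // (negbTE (gen_not_rdesc sJ Jg Ss nJs)).
have dgs : rdesc (g * s) t.
  rewrite rdescP // Egs lsw ltnS -mulA (leq_trans (len_mul_leq _ _ _)) //.
  by rewrite len_gen // add1n -rdescP.
have Jtst : s * t * s \in <<J>>.
  have : inversion g^-1 (t ^ s).
    move: dgs; rewrite rdescE ldescE invM (gensV Ss) inversionM (inversion_gen _ Ss).
    by case: eqP => // ts; rewrite -ts Jt in nJs.
  move/(inversion_gen_mem sJ); rewrite groupV conjE (gensV Ss) mulA; exact.
have st := gens_conj_commute sJ Ss nJs Jt Jtst.
pose w1 := w * t; have Ew : w = w1 * t by rewrite /w1 -mulA (gensK St) mulg1.
have Jw1 : w1 \in <<J>> by rewrite groupM // mem_gen.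
have [] := IH w1.
- by rewrite -ltnS -(lenS_rdesc St dw).
- by [].
- have -> : s * w1 * s = g * (s * t * s).
    by rewrite /g /w1 !mulA -(mulA (s * w) s s) (gensK Ss) mulg1.
  by rewrite groupM.
move=> sw1 Cw1; split; first by rewrite Ew mulA sw1 -!mulA st.
by rewrite Ew groupM // mem_gen // inE Jt st eqxx.
Qed.

(** Induction along a reduced word of x: if x = s u is reduced then s, a descent of v but
    not of u, gives the inversion s ^ u of u^-1 v. *)
Lemma full_ldesc_len J v : J \subset S -> (forall s, s \in J -> ldesc v s) ->
  forall x, x \in <<J>> -> len v = (len x + len (x^-1 * v))%N.
Proof.
move=> sJ dv x; have [n] := ubnP (len x); elim: n x => // n IH x lt_xn Jx.
have [->|/ldesc_ex-/(_ cox)[s Ss dx]] := eqVneq x 1.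
  by rewrite len1 invg1 mul1g.
have Js := ldesc_gen sJ Jx Ss dx; have lx := lenS_ldesc Ss dx.
have [u Eu] : exists u : gT, u = s * x by exists (s * x).
have Ex : x = s * u by rewrite Eu mulA (gensK Ss) mul1g.
have Ju : u \in <<J>> by rewrite Eu groupM // mem_gen.
have IHu := IH u _ Ju; rewrite Eu -ltnS -lx in IHu.
have {}IHu := IHu lt_xn; rewrite -Eu in IHu.
have du : inversion u s = false by rewrite -ldescE Eu ldesc_mul // dx.
have : inversion (u^-1 * v) (s ^ u).
  have Ev : v = u * (u^-1 * v) by rewrite mulVKg.
  by have := dv s Js; rewrite ldescE Ev inversionM du -Ev.
move/inversion_lt; have -> : s ^ u * (u^-1 * v) = x^-1 * v.
  by rewrite conjE -!mulA mulVKg Ex invM (gensV Ss) -mulA.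
have := len_mul_leq cox x (x^-1 * v); rewrite mulVKg IHu lx -Eu; lia.
Qed.

Lemma full_ldesc_uniq J v v' : J \subset S -> v \in <<J>> -> v' \in <<J>> ->
  (forall s, s \in J -> ldesc v s) -> (forall s, s \in J -> ldesc v' s) -> v = v'.
Proof.
move=> sJ Jv Jv' dv dv'.
have l1 := full_ldesc_len sJ dv Jv'; have l2 := full_ldesc_len sJ dv' Jv.
have l3 : len (v^-1 * v') = len (v'^-1 * v) by rewrite -lenV invM invgK.
have E : v'^-1 * v = 1 by apply/eqP; rewrite -(len_eq0 cox); apply/eqP; lia.
by apply/esym; rewrite -[LHS]mulg1 -E mulVKg.
Qed.

(** Reduced words of w can be chosen to end in any element of the dihedral group of s and
    t, for instance in s t s, which has length three. *)
Lemma rdesc_noncommuting w s t : s \in S -> t \in S -> s * t != t * s ->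
  rdesc w s -> rdesc w t -> rdesc (w * s) t /\ rdesc (w * s * t) s.
Proof.
move=> Ss St nst ds dt; have sK : [set s; t] \subset S by apply/subsetP=> x /set2P[]->.
have Ks : s \in <<[set s; t]>> by rewrite mem_gen ?set21.
have Kt : t \in <<[set s; t]>> by rewrite mem_gen ?set22.
have full r : r \in [set s; t] -> ldesc w^-1 r by case/set2P=> ->.
have L x := full_ldesc_len sK full (x := x).
have neq_st : s != t by apply: contraNneq nst => ->.
have lst : len (s * t) = 2.
  rewrite len_ldesc // ldescE inversion_gen // (negbTE neq_st) len_gen //.
have dst : ~~ ldesc (t * s) s.
  rewrite ldescE inversionM !inversion_gen // (negbTE neq_st) /=.
  apply: contra nst => /eqP; rewrite conjE (gensV St) => E.
  by rewrite -{2}E mulA mulA (gensK St) mul1g.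
have lts : len (t * s) = 2.
  by rewrite len_ldesc // ldescE inversion_gen // eq_sym (negbTE neq_st) len_gen.
have lsts : len (s * (t * s)) = 3 by rewrite len_ldesc // (negbTE dst) lts.
have l1 := L s Ks; have l2 := L (s * t) (groupM Ks Kt).
have l3 := L (s * (t * s)) (groupM Ks (groupM Kt Ks)).
have e1 : len (w * s) = len (s^-1 * w^-1) by rewrite -lenV invM.
have e2 : len (w * s * t) = len ((s * t)^-1 * w^-1).
  by rewrite -lenV !invM !mulA.
have e3 : len (w * s * t * s) = len ((s * (t * s))^-1 * w^-1).
  by rewrite -lenV !invM !mulA.
rewrite (len_gen Ss) in l1; rewrite !rdescP // e1 e2 e3.
rewrite lst in l2; rewrite lsts in l3.
have aux (n a b c : nat) : n = (1 + a)%N -> n = (2 + b)%N -> n = (3 + c)%N ->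
  b < a /\ c < b by clear; lia.
exact: aux l1 l2 l3.
Qed.

Lemma longest_max w : len w <= len w0.
Proof. by rewrite /longest; case: arg_maxnP => // x _; apply. Qed.

Lemma longest_ldesc s : s \in S -> ldesc w0 s.
Proof.
move=> Ss; have := longest_max (s * w0); rewrite len_ldesc //.
by case: ifP => // _; rewrite ltnn.
Qed.

Lemma longest_len x : len w0 = (len x + len (x^-1 * w0))%N.
Proof.
apply: full_ldesc_len (subxx _) longest_ldesc _ _.
by rewrite gens_generate inE.
Qed.

Lemma longestV : w0^-1 = w0.
Proof.
apply: (full_ldesc_uniq (subxx S)); rewrite ?gens_generate ?inE //; last exact: longest_ldesc.
move=> s Ss; rewrite -rdescE rdescP //.
have := longest_max (w0 * s); rewrite len_rdesc //.
case: ifP => [dw _|_]; last by rewrite ltnn.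
by rewrite prednK // -lenV (ldesc_len_gt0 Ss dw).
Qed.

Lemma longestK : w0 * w0 = 1.
Proof. by rewrite -{2}longestV mulgV. Qed.

Lemma len_mul_longest x : len (x * w0) = (len w0 - len x)%N.
Proof. by rewrite (longest_len x^-1) invgK lenV addKn. Qed.

Lemma len_gens w : len w = 1%N -> w \in S.
Proof.
have [[|a [|b ws]] [Sws <- E]] := len_word cox w => // _.
by move: Sws; rewrite -E word_prod_cons word_prod_nil mulg1 /= andbT.
Qed.

Lemma conj_longest_gens s : s \in S -> s ^ w0 \in S.
Proof.
move=> Ss; apply: len_gens; rewrite conjE longestV mulA len_mul_longest.
have := longest_len s; rewrite (len_gen Ss) (gensV Ss).
have E : len (w0 * s) = len (s * w0) by rewrite -lenV invM longestV (gensV Ss).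
by rewrite E; set a := len w0; set b := len _; lia.
Qed.

End Parabolic.

(** * Weyl distance and codistance *)

Section WeylDistance.

Variables (gT : finGroupType) (cox : coxeter_system gT) (Delta : building cox).
Local Notation S := (gens cox).
Local Notation len := (cox_length cox).
Local Notation "x * y" := (@mul gT x y) : group_scope.
Local Notation ldesc := (ldesc cox).
Local Notation rdesc := (rdesc cox).
Local Notation w0 := (longest cox).

Implicit Types (s t x y : gT) (J K : {set gT}) (C D E X Y Z : chamber Delta).

Lemma wdistxx C : wdist C C = 1.
Proof. by apply/wdist1. Qed.

Lemma adj_sym C D s : s \in S -> wdist C D = s -> wdist D C = s.
Proof.
move=> Ss cd; have [] := wdist_step C Ss cd; rewrite wdistxx => /esym dc.
  by rewrite -[RHS]mulg1 -dc mulA (gensK Ss) mul1g.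
move/wdist1: dc => dc; move: cd; rewrite dc wdistxx => s1.
by have := gens_neq1 Ss; rewrite -s1 eqxx.
Qed.

(** The building axioms move the first chamber; induction on the distance transfers them
    to the second one. *)
Lemma wdist_upr_aux C D E s v : s \in S -> wdist D E = s -> wdist C D = v ->
  ~~ rdesc v s -> wdist C E = v * s.
Proof.
move=> Ss de; have [n] := ubnP (len v); elim: n C v => // n IH C v lt_vn cd nd.
have [v1|/ldesc_ex-/(_ cox)[r Sr dv]] := eqVneq v 1.
  by move: cd; rewrite v1 => /wdist1 ->; rewrite mul1g.
have [C1 [c1 cd1]] := wdist_ex C D Sr; rewrite cd in cd1.
have Ev : v = r * (r * v) by rewrite mulA (gensK Sr) mul1g.
have nrv : ~~ rdesc (r * v) s.
  have E1 : r * (r * v * s) = v * s by rewrite !mulA (gensK Sr) mul1g.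
  have := len_mul_leq cox r (r * v * s); rewrite rdescP //.
  rewrite E1 (len_gen Sr) (len_rdesc _ Ss) (negbTE nd) (lenS_ldesc Sr dv); lia.
have ec1 : wdist C1 E = r * v * s.
  by apply: IH => //; rewrite -ltnS -(lenS_ldesc Sr dv).
rewrite (wdist_up Sr (adj_sym Sr c1)) ec1 ?mulA ?(gensK Sr) ?mul1g //.
rewrite len_rdesc // (negbTE nd) len_rdesc // (negbTE nrv).
by rewrite (lenS_ldesc Sr dv).
Qed.

Lemma wdistV C D : wdist D C = (wdist C D)^-1.
Proof.
have [n] := ubnP (len (wdist C D)); elim: n C => // n IH C lt_n.
have [v1|/ldesc_ex-/(_ cox)[r Sr dv]] := eqVneq (wdist C D) 1.
  by rewrite v1 invg1; move/wdist1: v1 => ->; apply: wdistxx.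
have [C1 [c1 cd1]] := wdist_ex C D Sr.
have := IH C1; rewrite cd1 -ltnS -(lenS_ldesc Sr dv) => /(_ lt_n) E.
rewrite (wdist_upr_aux Sr c1 E) ?invM ?(gensV Sr) -?mulA ?(gensK Sr) ?mulg1 //.
by rewrite (rdesc_mul _ Sr) negbK rdescE invgK.
Qed.

Lemma wdist_stepr C D D' s : s \in S -> wdist D D' = s ->
  wdist C D' = wdist C D * s \/ wdist C D' = wdist C D.
Proof.
move=> Ss /(adj_sym Ss) d; rewrite !(wdistV _ C).
have [E|E] := wdist_step C Ss d; rewrite E; first by left; rewrite invM (gensV Ss).
by right.
Qed.

Lemma wdist_upr C D D' s : s \in S -> wdist D D' = s -> ~~ rdesc (wdist C D) s ->
  wdist C D' = wdist C D * s.
Proof. by move=> Ss dd nd; apply: (wdist_upr_aux Ss dd (erefl _) nd). Qed.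

Lemma wdist_exr C D s : s \in S ->
  exists D', wdist D D' = s /\ wdist C D' = wdist C D * s.
Proof.
move=> Ss; have [D' [d1 d2]] := wdist_ex D C Ss.
by exists D'; rewrite (adj_sym Ss d1) wdistV d2 invM -wdistV (gensV Ss).
Qed.

Lemma wdist_res_l J C C' D : J \subset S -> wdist C C' \in <<J>> ->
  exists2 j, j \in <<J>> & wdist C' D = j * wdist C D.
Proof.
move=> sJ; move E: (wdist C C') => x Jx.
elim/gen_indl: x / Jx C E => [|s x Js _ IH] C.
  by move/wdist1=> ->; exists 1; rewrite ?mul1g.
have Ss := subsetP sJ s Js.
move=> E; have [C1 [c1]] := wdist_ex C C' Ss; rewrite E mulA (gensK Ss) mul1g.
case/IH=> j Jj ->; have [->|->] := wdist_step D Ss c1; last by exists j.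
by exists (j * s); rewrite ?mulA // groupM // mem_gen.
Qed.

Lemma wdist_res_r J C D D' : J \subset S -> wdist D D' \in <<J>> ->
  exists2 j, j \in <<J>> & wdist C D' = wdist C D * j.
Proof.
move=> sJ /(wdist_res_l C sJ)[j Jj E].
by exists j^-1; rewrite ?groupV // wdistV E invM -wdistV.
Qed.

Lemma wdist_mv_l J C D x : J \subset S -> x \in <<J>> ->
  exists2 C', wdist C C' \in <<J>> & wdist C' D = x * wdist C D.
Proof.
move=> sJ; elim/gen_indl: x / => [|s x Js _ [C1 c1 E]].
  by exists C; rewrite ?mul1g // wdistxx group1.
have Ss := subsetP sJ s Js; have [C' [c' E']] := wdist_ex C1 D Ss.
exists C'; last by rewrite E' E mulA.
have [->|->//] := wdist_stepr C Ss (adj_sym Ss c').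
by rewrite groupM // mem_gen.
Qed.

Lemma res_sym J C D : (wdist D C \in <<J>>) = (wdist C D \in <<J>>).
Proof. by rewrite wdistV groupV. Qed.

Lemma res_trans J C D E : J \subset S -> wdist C D \in <<J>> ->
  wdist D E \in <<J>> -> wdist C E \in <<J>>.
Proof. by move=> sJ cd /(wdist_res_r C sJ)[j Jj ->]; rewrite groupM. Qed.

Lemma wdist_mv_r J C D x : J \subset S -> x \in <<J>> ->
  exists2 D', wdist D D' \in <<J>> & wdist C D' = wdist C D * x.
Proof.
move=> sJ Jx; have [|D' dd E] := @wdist_mv_l J D C x^-1 sJ; first by rewrite groupV.
by exists D' => //; rewrite wdistV E invM invgK -wdistV.
Qed.

Lemma adj_trans C X Y s : s \in S -> wdist X C = s -> wdist Y C = s ->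
  X <> Y -> wdist X Y = s.
Proof.
move=> Ss xc yc neqXY.
have [|] := wdist_stepr X Ss (adj_sym Ss yc); rewrite xc // (gensK Ss).
by move/wdist1.
Qed.

End WeylDistance.

Section Codistance.

Variables (gT : finGroupType) (cox : coxeter_system gT) (Delta : building cox).
Local Notation S := (gens cox).
Local Notation len := (cox_length cox).
Local Notation "x * y" := (@mul gT x y) : group_scope.
Local Notation ldesc := (ldesc cox).
Local Notation rdesc := (rdesc cox).
Local Notation w0 := (longest cox).

(** The action of an automorphism on chambers, and its type permutation. *)
Variables (th : chamber Delta -> chamber Delta) (p : {perm gT}).
Hypothesis pS : perm_on S p.
Hypothesis th_adj : forall C D s, s \in S ->
  wdist C D = s <-> wdist (th C) (th D) = p s.
Hypothesis th_surj : forall D', exists D, th D = D'.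

Implicit Types (s t x y : gT) (J K : {set gT}) (C D E X Y Z : chamber Delta).

(** The distance from C to the image of D, measured from opposition: the value is
    1 when C is opposite the image of D, and a longer value means that the two
    are closer.  Moving the second argument multiplies on the right, by the
    generator twisted with both the type permutation and opposition. *)
Definition codist C D : gT := wdist C (th D) * w0.

Definition twist s : gT := p s ^ w0.

Lemma p_gens s : s \in S -> p s \in S.
Proof. by rewrite (perm_closed _ pS). Qed.

Lemma twist_gens s : s \in S -> twist s \in S.
Proof. by move=> Ss; apply: conj_longest_gens; apply: p_gens. Qed.

Lemma twist_inj : injective twist.
Proof. by move=> s t /conjg_inj/perm_inj. Qed.

Lemma codist_opp C D : codist C D = 1 <-> wdist C (th D) = w0.
Proof.
rewrite /codist; split=> [E|->]; last exact: longestK.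
by rewrite -[LHS]mulg1 -(longestK cox) mulA E mul1g.
Qed.

Lemma ldesc_codist C D s : s \in S -> ldesc (codist C D) s = ~~ ldesc (wdist C (th D)) s.
Proof.
move=> Ss; rewrite !ldescP // /codist mulA !len_mul_longest -leqNgt.
have := longest_max cox (wdist C (th D)); have := longest_max cox (s * wdist C (th D)).
have : len (s * wdist C (th D)) != len (wdist C (th D)).
  rewrite len_ldesc //; case: ifP => dw; last by rewrite neq_ltn ltnSn orbT.
  by rewrite neq_ltn prednK ?leqnn // (ldesc_len_gt0 Ss dw).
lia.
Qed.

Lemma codist_l C C' D s : s \in S -> wdist C' C = s ->
  codist C' D = s * codist C D \/ codist C' D = codist C D.
Proof.
move=> Ss cc; have [E|E] := wdist_step (th D) Ss cc; rewrite /codist E ?mulA.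
  by left.
by right.
Qed.

Lemma codist_l_down C C' D s : s \in S -> wdist C' C = s ->
  ldesc (codist C D) s -> codist C' D = s * codist C D.
Proof.
move=> Ss cc; rewrite ldesc_codist // => nd.
by rewrite /codist (wdist_up Ss cc) ?mulA // len_ldesc // (negbTE nd).
Qed.

Lemma codist_l_ex C D s : s \in S ->
  exists C', wdist C' C = s /\ codist C' D = s * codist C D.
Proof.
by move=> Ss; have [C' [c E]] := wdist_ex C (th D) Ss; exists C'; rewrite /codist E mulA.
Qed.

Lemma mul_twist x s : x * w0 * twist s = x * p s * w0.
Proof. by rewrite /twist conjE longestV -!mulA (mulA w0) longestK mul1g. Qed.

Lemma rdesc_codist C D s : s \in S ->
  rdesc (codist C D) (twist s) = ~~ rdesc (wdist C (th D)) (p s).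
Proof.
move=> Ss; rewrite !rdescP ?p_gens ?twist_gens // {1}/codist mul_twist.
rewrite /codist !len_mul_longest -leqNgt.
have := longest_max cox (wdist C (th D)); have := longest_max cox (wdist C (th D) * p s).
have : len (wdist C (th D) * p s) != len (wdist C (th D)).
  rewrite len_rdesc ?p_gens //; case: ifP => dw; last by rewrite neq_ltn ltnSn orbT.
  have := ldesc_len_gt0 (p_gens Ss) dw; rewrite lenV => l0.
  by rewrite neq_ltn prednK ?leqnn.
lia.
Qed.

Lemma codist_r C D D' s : s \in S -> wdist D' D = s ->
  codist C D' = codist C D * twist s \/ codist C D' = codist C D.
Proof.
move=> Ss /(adj_sym Ss)/(th_adj _ _ Ss) dd.
have [E|E] := wdist_stepr C (p_gens Ss) dd; rewrite /codist E ?mul_twist.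
  by left.
by right.
Qed.

Lemma codist_r_down C D D' s : s \in S -> wdist D' D = s ->
  rdesc (codist C D) (twist s) -> codist C D' = codist C D * twist s.
Proof.
move=> Ss /(adj_sym Ss)/(th_adj _ _ Ss) dd; rewrite rdesc_codist // => nd.
by rewrite /codist (wdist_upr (p_gens Ss) dd nd) mul_twist.
Qed.

Lemma codist_r_ex C D s : s \in S ->
  exists D', wdist D' D = s /\ codist C D' = codist C D * twist s.
Proof.
move=> Ss; have [D1 [d1 E]] := wdist_exr C (th D) (p_gens Ss).
have [D' ED] := th_surj D1; exists D'; rewrite /codist ED E mul_twist; split=> //.
by apply: adj_sym => //; apply/(th_adj _ _ Ss); rewrite ED.
Qed.

(** Going from X to Y inside the panel, s would be a descent and the codistance would
    drop. *)
Lemma codist_l_uniq C D X Y s : s \in S -> ~~ ldesc (codist C D) s ->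
  wdist X C = s -> wdist Y C = s ->
  codist X D = s * codist C D -> codist Y D = s * codist C D -> X = Y.
Proof.
move=> Ss nd xc yc dX dY; have [//|neq] := pselect (X = Y).
have := codist_l_down (D := D) Ss (adj_trans Ss yc xc (nesym neq)).
rewrite dX dY ldesc_mul // nd => /(_ isT)/mulgI E.
by have := gens_neq1 Ss; rewrite -[s]mulg1 -(mulgV (codist C D)) mulA -E mulgV eqxx.
Qed.

Lemma codist_r_uniq C D X Y s : s \in S -> ~~ rdesc (codist C D) (twist s) ->
  wdist X D = s -> wdist Y D = s ->
  codist C X = codist C D * twist s -> codist C Y = codist C D * twist s -> X = Y.
Proof.
move=> Ss nd xd yd dX dY; have [//|neq] := pselect (X = Y).
have := codist_r_down (C := C) Ss (adj_trans Ss yd xd (nesym neq)).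
have St := twist_gens Ss; rewrite dX dY rdesc_mul // nd => /(_ isT) /mulIg E.
have := gens_neq1 St.
by rewrite -[twist s]mul1g -(mulVg (codist C D)) -mulA -E mulVg eqxx.
Qed.

Lemma codist_res_l J C C' D : J \subset S -> wdist C C' \in <<J>> ->
  exists2 j, j \in <<J>> & codist C' D = j * codist C D.
Proof.
move=> sJ /(wdist_res_l (th D) sJ)[j Jj E].
by exists j => //; rewrite /codist E mulA.
Qed.

Lemma codist_mv_l J C D x : J \subset S -> x \in <<J>> ->
  exists2 C', wdist C C' \in <<J>> & codist C' D = x * codist C D.
Proof.
move=> sJ Jx; have [C' c E] := wdist_mv_l C (th D) sJ Jx.
by exists C' => //; rewrite /codist E mulA.
Qed.

Lemma codist_res_r J K C D D' : J \subset S -> (forall s, s \in J -> twist s \in K) ->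
  wdist D D' \in <<J>> -> exists2 j, j \in <<K>> & codist C D' = codist C D * j.
Proof.
move=> sJ JK; move E: (wdist D D') => x Jx.
elim/gen_indl: x / Jx D E => [|s x Js _ IH] D.
  by move/wdist1=> ->; exists 1; rewrite ?mulg1.
have Ss := subsetP sJ s Js.
move=> E; have [D1 [c1]] := wdist_ex D D' Ss; rewrite E mulA (gensK Ss) mul1g.
case/IH=> j Jj ->; have [->|->] := codist_r C Ss c1; last by exists j.
exists (twist s * j); last by rewrite mulA.
by apply: groupM => //; apply/mem_gen/JK.
Qed.

Lemma codist_mv_r J C D x : J \subset S -> x \in <<twist @: J>> ->
  exists2 D', wdist D D' \in <<J>> & codist C D' = codist C D * x.
Proof.
move=> sJ; elim/gen_indr: x / => [|s x /imsetP[t Jt ->] _ [D1 d1 E]].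
  by exists D; rewrite ?mulg1 // wdistxx group1.
have St := subsetP sJ t Jt; have [D' [d' E']] := codist_r_ex C D1 St.
exists D'; last by rewrite E' E mulA.
have [->|->//] := wdist_stepr D St (adj_sym St d').
by rewrite groupM // mem_gen.
Qed.

Definition displ C : gT := codist C C.

Lemma displ_down C C' s : s \in S -> wdist C' C = s -> ldesc (displ C) s ->
  rdesc (s * displ C) (twist s) -> displ C' = s * displ C * twist s.
Proof.
move=> Ss cc dl dr; have E := codist_l_down Ss cc dl.
by rewrite /displ (codist_r_down Ss cc) E.
Qed.

Hypothesis thickD : thick Delta.

Lemma thick_avoid C Z s : s \in S -> exists2 C', wdist C' C = s & C' <> Z.
Proof.
move=> Ss; have [D [E [cD cE DE]]] := thickD C Ss.
have [DZ|neq] := pselect (D = Z); last by exists D => //; apply: adj_sym.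
by exists E; [apply: adj_sym | move=> EZ; apply: DE; rewrite DZ EZ].
Qed.

(** Every other chamber of the panel loses s on the left; it keeps its value on the right
    unless it is the exceptional chamber Z, and the panel has a third chamber. *)
Lemma displ_drop_l C s : s \in S -> ldesc (displ C) s -> ~~ rdesc (displ C) (twist s) ->
  exists2 C', wdist C' C = s & displ C' = s * displ C.
Proof.
move=> Ss dl ndr; set u := displ C in dl ndr *; have St := twist_gens Ss.
have neq : (s ^ u == twist s :> gT) = false.
  apply/negP=> /eqP E; move: dl ndr; rewrite ldescP // rdescP //.
  have -> : s * u = u * twist s by rewrite -E conjE mulKVg.
  by move=> ->.
have [Z [cZ dZ]] := codist_r_ex C C Ss; rewrite -/(displ C) -/u in dZ.
have [C' cC' C'Z] := thick_avoid C Z Ss.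
exists C' => //; have E1 : codist C' C = s * u by apply: codist_l_down.
have E2 : codist C' Z = s * u * twist s.
  rewrite (codist_l_down (D := Z) Ss cC') dZ ?(mulA s u) //.
  by rewrite ldesc_mulr // dl neq.
have [E3|E3] := codist_r C' Ss cC'; last by rewrite /displ E3 E1.
case: C'Z; apply: (codist_r_uniq (C := C') (D := C) Ss) => //; rewrite ?E1 //.
by rewrite rdesc_mull // (negbTE ndr) neq.
Qed.

Lemma displ_drop_r C s : s \in S -> ~~ ldesc (displ C) s -> rdesc (displ C) (twist s) ->
  exists2 C', wdist C' C = s & displ C' = displ C * twist s.
Proof.
move=> Ss ndl dr; set u := displ C in ndl dr *; have St := twist_gens Ss.
have neq : (s ^ u == twist s :> gT) = false.
  apply/negP=> /eqP E.
  move: ndl dr; rewrite ldescP // rdescP //.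
  have -> : s * u = u * twist s by rewrite -E conjE mulKVg.
  by move=> /negbTE->.
have [Z [cZ dZ]] := codist_l_ex C C Ss; rewrite -/(displ C) -/u in dZ.
have [C' cC' C'Z] := thick_avoid C Z Ss.
exists C' => //; have E1 : codist C C' = u * twist s by apply: codist_r_down.
have E2 : codist Z C' = s * (u * twist s).
  rewrite (codist_r_down (C := Z) Ss cC') dZ -?(mulA s u) //.
  by rewrite rdesc_mull // dr neq.
have [E3|E3] := codist_l C' Ss cC'; last by rewrite /displ E3.
case: C'Z; apply: (codist_l_uniq (C := C) (D := C') Ss) => //; rewrite ?E1 //.
  by rewrite ldesc_mulr // (negbTE ndl) neq.
Qed.

(** A descent that is one-sided (displ_drop_l, displ_drop_r), or two-sided without being
    twisted-central (displ_down), leads to a shorter displacement. *)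
Lemma displ_minimal J C0 : J \subset S -> exists2 C, wdist C0 C \in <<J>> &
  forall s, s \in J -> ldesc (displ C) s || rdesc (displ C) (twist s) ->
    [/\ s * displ C = displ C * twist s, ldesc (displ C) s
      & rdesc (displ C) (twist s)].
Proof.
move=> sJ; pose P n := `[< exists2 C, wdist C0 C \in <<J>> & len (displ C) = n >].
have exP : exists n, P n.
  by exists (len (displ C0)); apply/asboolP; exists C0; rewrite // wdistxx group1.
case: (ex_minnP exP) => m /asboolP[C cC lC] minm.
have {}minm C' s : s \in J -> wdist C' C = s -> len (displ C) <= len (displ C').
  move=> Js cc; rewrite lC; apply: minm; apply/asboolP; exists C' => //.
  apply: (res_trans sJ cC); rewrite (adj_sym _ cc) ?mem_gen //.
  exact: (subsetP sJ).
exists C => // s Js dd; have Ss := subsetP sJ s Js; have St := twist_gens Ss.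
set u := displ C in minm dd *.
case: (boolP (ldesc u s)) dd => dl /=; case: (boolP (rdesc u (twist s))) => dr //= _.
- split=> //; apply/eqP/negPn/negP=> neq.
  have neq2 : (s ^ u == twist s :> gT) = false.
    by apply: contraNF neq => /eqP <-; rewrite conjE mulKVg.
  have dr2 : rdesc (s * u) (twist s) by rewrite rdesc_mull // dr neq2.
  have [C' [cc _]] := codist_l_ex C C Ss.
  have := minm C' s Js cc; rewrite (displ_down Ss cc dl dr2) -/u.
  by rewrite (lenS_ldesc Ss dl) (lenS_rdesc St dr2) ltnNge leqnSn.
- have [C' cc E] := displ_drop_l Ss dl dr; have := minm C' s Js cc.
  by rewrite E (lenS_ldesc Ss dl) ltnn.
- have [C' cc E] := displ_drop_r Ss dl dr; have := minm C' s Js cc.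
  by rewrite E (lenS_rdesc St dr) ltnn.
Qed.

End Codistance.

(** * From simplicial automorphisms to chamber maps *)

Section Simplices.

Variables (gT : finGroupType) (cox : coxeter_system gT) (Delta : building cox).
Local Notation S := (gens cox).
Local Notation w0 := (longest cox).

Implicit Types (s t : gT) (J K : {set gT}) (C D E : chamber Delta) (a b : simplex Delta).

Lemma simplex_eq a b : chambers_of a = chambers_of b -> stype a = stype b -> a = b.
Proof.
case: a b => [Ca Ja sa Pa] [Cb Jb sb Pb] /= EC EJ; subst Cb Jb.
by rewrite (bool_irrelevance sa sb) (Prop_irrelevance Pa Pb).
Qed.

Lemma residue_eq J C D : J \subset S -> residue J C D -> residue J C = residue J D.
Proof.
move=> sJ CD; apply: funext => E; apply: propext; split; apply: res_trans => //.
by rewrite res_sym.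
Qed.

Lemma residue_self J C : residue J C C.
Proof. by rewrite /residue wdistxx group1. Qed.

Lemma simplex_res a C : chambers_of a C -> chambers_of a = residue (S :\: stype a) C.
Proof.
have [C0 E] := chambers_ofP a; rewrite E; apply: residue_eq; exact: subsetDl.
Qed.

Lemma simplex_chamber a : exists C, chambers_of a C.
Proof. by have [C ->] := chambers_ofP a; exists C; apply: residue_self. Qed.

Lemma adj_ex C s : s \in S -> exists D, wdist C D = s.
Proof.
move=> Ss; have [D [d _]] := wdist_ex C C Ss; exists D; exact: adj_sym d.
Qed.

Lemma residue_sub J K C : J \subset S -> K \subset S ->
  (forall D, residue J C D -> residue K C D) <-> J \subset K.
Proof.
move=> sJ sK; split=> [sub|sub D]; last exact: genS_mem.
apply/subsetP=> s Js; have Ss := subsetP sJ s Js.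
have [D CD] := adj_ex C Ss; have := sub D; rewrite /residue CD mem_gen // => /(_ isT).
by rewrite (gen_gens sK Ss).
Qed.

Definition face_at C J (sJ : J \subset S) : simplex Delta :=
  Simplex sJ (ex_intro _ C (erefl (residue (S :\: J) C))).

Lemma face_at_in C J (sJ : J \subset S) : chambers_of (face_at C sJ) C.
Proof. exact: residue_self. Qed.

Lemma face_typeP a b C : chambers_of a C -> chambers_of b C ->
  face a b <-> stype a \subset stype b.
Proof.
move=> aC bC; rewrite /face (simplex_res aC) (simplex_res bC).
have sub := residue_sub C (subsetDl S (stype b)) (subsetDl S (stype a)).
apply: (iff_trans sub); split=> [h|]; last exact: setDS.
apply/subsetP=> s as_; have Ss := subsetP (stype_sub a) s as_.
by apply: contraT => nbs; have := subsetP h s; rewrite !inE as_ nbs Ss => /(_ isT).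
Qed.

Lemma face_chamber a b C : face a b -> chambers_of b C -> chambers_of a C.
Proof. by apply. Qed.

Lemma face_anti a b : face a b -> face b a -> a = b.
Proof.
move=> ab ba; have [C bC] := simplex_chamber b; have aC := face_chamber ab bC.
have E : stype a = stype b.
  by apply/eqP; rewrite eqEsubset; apply/andP; split; apply/(face_typeP (C := C)).
by apply: simplex_eq => //; rewrite (simplex_res aC) (simplex_res bC) E.
Qed.

Lemma same_type_eq a b C : chambers_of a C -> chambers_of b C -> stype a = stype b -> a = b.
Proof.
by move=> aC bC E; apply: face_anti; apply/(face_typeP (C := C)) => //; rewrite E.
Qed.

Lemma chamber_simplexE C D : chambers_of (chamber_simplex C) D <-> C = D.
Proof.
rewrite /= /residue setDv; split=> [/gen_set0_1/wdist1//|->].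
by rewrite wdistxx group1.
Qed.

Lemma face_chamber_simplex a C : face a (chamber_simplex C) <-> chambers_of a C.
Proof.
split=> [f|aC D /chamber_simplexE <- //]; apply: face_chamber f _.
exact/chamber_simplexE.
Qed.

(** The empty simplex, the vertices and the chambers, characterized in the face poset and
    therefore preserved by its automorphisms. *)
Definition bottom a : Prop := forall b, face a b.
Definition vertex a : Prop := ~ bottom a /\ forall b, face b a -> b = a \/ bottom b.
Definition maximal a : Prop := forall b, face a b -> b = a.

Lemma bottomP a : bottom a <-> stype a = finset.set0.
Proof.
split=> [bot|E b].
  have [C aC] := simplex_chamber a.
  have := bot (face_at C (sub0set S)); rewrite (face_typeP aC (face_at_in C (sub0set S))) /=.
  by rewrite subset0 => /eqP.
have [C aC] := simplex_chamber a; move=> D _; rewrite (simplex_res aC) E setD0.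
by rewrite /residue gens_generate inE.
Qed.

Lemma vertexP a : vertex a <-> exists2 t, t \in S & stype a = [set t].
Proof.
have [C aC] := simplex_chamber a; split=> [[nbot min]|[t St E]].
  have /set0Pn[t at_] : stype a != finset.set0.
    by apply/eqP=> /bottomP.
  have St := subsetP (stype_sub a) t at_; exists t => //.
  have sub : [set t] \subset S by rewrite sub1set.
  have f : face (face_at C sub) a.
    by apply/(face_typeP (face_at_in C sub) aC); rewrite sub1set.
  have [<-//|/bottomP /= /setP/(_ t)] := min _ f.
  by rewrite set11 inE.
split=> [/bottomP|b ba].
  by rewrite E => /setP/(_ t); rewrite set11 inE.
have bC := face_chamber ba aC.
have := (face_typeP bC aC).1 ba; rewrite E subset1 => /orP[/eqP Eb|/eqP/bottomP].
  by left; apply: (same_type_eq bC aC); rewrite Eb E.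
by right.
Qed.

Lemma maximalP a : maximal a <-> stype a = S.
Proof.
have [C aC] := simplex_chamber a; split=> [max|E b ab].
  by rewrite -(max (chamber_simplex C)) //; apply/face_chamber_simplex.
have [D bD] := simplex_chamber b; have aD := face_chamber ab bD.
apply: (same_type_eq bD aD); apply/eqP; rewrite eqEsubset {1}E stype_sub.
exact/(face_typeP aD bD).
Qed.

Lemma maximal_chamber a : maximal a -> exists C, a = chamber_simplex C.
Proof.
move/maximalP=> E; have [C aC] := simplex_chamber a; exists C.
by apply: (same_type_eq aC) => //; apply/chamber_simplexE.
Qed.

Lemma chamber_simplex_inj C D : chamber_simplex C = chamber_simplex D -> C = D.
Proof. by move=> E; apply/chamber_simplexE; rewrite E; apply/chamber_simplexE. Qed.

Variable theta : automorphism Delta.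

Lemma theta_inj : injective theta.
Proof. by case: (aut_bij theta) => g gK _; apply: can_inj gK. Qed.

Lemma theta_surj a : exists b, theta b = a.
Proof. by case: (aut_bij theta) => g _ Kg; exists (g a). Qed.

Lemma theta_bottom a : bottom (theta a) <-> bottom a.
Proof.
split=> bot b; first exact/(aut_face theta)/bot.
by have [c <-] := theta_surj b; apply/(aut_face theta)/bot.
Qed.

Lemma theta_vertex a : vertex a -> vertex (theta a).
Proof.
case=> nbot min; split=> [/theta_bottom//|b]; have [c <-] := theta_surj b.
by move/(aut_face theta)/min=> [->|/theta_bottom bot]; [left|right].
Qed.

Lemma theta_maximal a : maximal a -> maximal (theta a).
Proof.
by move=> max b; have [c <-] := theta_surj b; move/(aut_face theta)/max->.
Qed.

Lemma maximal_theta a : maximal (theta a) -> maximal a.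
Proof. by move=> max b /(aut_face theta)/max/theta_inj. Qed.

Lemma chamber_simplex_max C : maximal (chamber_simplex C).
Proof. exact/maximalP. Qed.

Definition chamber_map C : chamber Delta :=
  projT1 (cid (maximal_chamber (theta_maximal (@chamber_simplex_max C)))).

Local Notation th := chamber_map.

Lemma chamber_mapE C : theta (chamber_simplex C) = chamber_simplex (th C).
Proof. by rewrite /chamber_map; case: cid. Qed.

Lemma chamber_map_inj : injective th.
Proof.
move=> C D E; apply/chamber_simplex_inj/theta_inj.
by rewrite !chamber_mapE E.
Qed.

Lemma chamber_map_surj D : exists C, th C = D.
Proof.
have [a E] := theta_surj (chamber_simplex D).
have [C Ca] : exists C, a = chamber_simplex C.
  by apply/maximal_chamber/maximal_theta; rewrite E; apply: chamber_simplex_max.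
by exists C; apply: chamber_simplex_inj; rewrite -chamber_mapE -Ca.
Qed.

Lemma theta_chambers a C : chambers_of (theta a) (th C) <-> chambers_of a C.
Proof.
rewrite -!face_chamber_simplex -chamber_mapE; exact: aut_face.
Qed.

Lemma vertex_ex C t : t \in S -> exists2 a, stype a = [set t] & chambers_of a C.
Proof.
move=> St; have sub : [set t] \subset S by rewrite sub1set.
by exists (face_at C sub) => //; apply: residue_self.
Qed.

Lemma type_at_ex C t : exists t', (t \notin S -> t' = t) /\ (t \in S -> t' \in S /\
  forall a, stype a = [set t] -> chambers_of a C -> stype (theta a) = [set t']).
Proof.
case: (boolP (t \in S)) => [St|_]; last by exists t.
have [a Ea aC] := vertex_ex C St.
have /theta_vertex/vertexP[t' St' E'] : vertex a by apply/vertexP; exists t.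
exists t'; split=> // _; split=> // b Eb bC; rewrite -E'.
by rewrite (same_type_eq bC aC) // Eb Ea.
Qed.

(** The type of the image of the vertex of type t of C, and t itself outside S to make
    this an injection of the whole group. *)
Definition type_at C t : gT := projT1 (cid (type_at_ex C t)).

Lemma type_at_out C t : t \notin S -> type_at C t = t.
Proof. by move=> nSt; rewrite /type_at; case: cid => t' /= [/(_ nSt)]. Qed.

Lemma type_at_gens C t : t \in S -> type_at C t \in S.
Proof. by move=> St; rewrite /type_at; case: cid => t' /= [_ /(_ St)[]]. Qed.

Lemma type_atE C t a : t \in S -> stype a = [set t] -> chambers_of a C ->
  stype (theta a) = [set type_at C t].
Proof. by move=> St; rewrite /type_at; case: cid => t' /= [_ /(_ St)[_]]; apply. Qed.

Lemma type_at_inj C : injective (type_at C).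
Proof.
move=> s t; case: (boolP (s \in S)) => Ss; case: (boolP (t \in S)) => St; last first.
- by rewrite !type_at_out.
- by move=> E; have := type_at_gens C St; rewrite -E type_at_out // (negbTE Ss).
- by move=> E; have := type_at_gens C Ss; rewrite E type_at_out // (negbTE St).
move=> E; have [a Ea aC] := vertex_ex C Ss; have [b Eb bC] := vertex_ex C St.
have ab : a = b.
  apply: theta_inj; apply: (same_type_eq (C := th C)); rewrite ?theta_chambers //.
  by rewrite (type_atE Ss Ea aC) (type_atE St Eb bC) E.
by apply/set1P; rewrite -Eb -ab Ea set11.
Qed.

(** Adjacent chambers have all their vertices but one in common, and two permutations
    that agree off one point are equal. *)
Lemma type_at_adj C D s : s \in S -> wdist C D = s -> type_at C =1 type_at D.
Proof.
move=> Ss CD; have other t : t != s -> type_at C t = type_at D t.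
  move=> neq; case: (boolP (t \in S)) => St; last by rewrite !type_at_out.
  have [a Ea aC] := vertex_ex C St.
  have aD : chambers_of a D.
    by rewrite (simplex_res aC) /residue CD mem_gen // Ea !inE eq_sym neq.
  by apply/set1P; rewrite -(type_atE St Ea aD) (type_atE St Ea aC) set11.
move=> t; have [->|] := eqVneq t s; last exact: other.
pose f := perm (@type_at_inj C); pose t1 := f^-1 (type_at D s).
have E1 : type_at C t1 = type_at D s by rewrite -(permE (@type_at_inj C)) permKV.
have [E2|neq] := eqVneq t1 s; first by rewrite -{1}E2.
by have := other t1 neq; rewrite E1 => /type_at_inj E3; rewrite -E3 eqxx in neq.
Qed.

Lemma type_at_const C D : type_at C =1 type_at D.
Proof.
have: wdist C D \in <<S>> by rewrite gens_generate inE.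
move E: (wdist C D) => x Sx; elim/gen_indl: x / Sx C E => [|s x Ss _ IH] C.
  by move/wdist1->.
move=> E; have [C1 [c1]] := wdist_ex C D Ss; rewrite E mulA (gensK Ss) mul1g.
move/IH=> E1 t; rewrite -E1; exact/esym/(type_at_adj Ss).
Qed.

(** Two chambers are s-adjacent when they share the face that lacks the vertex of type s,
    and theta permutes the types of faces by p. *)
Lemma type_perm_ex : exists p : {perm gT}, [/\ perm_on S p,
  forall a, stype (theta a) = (p @: stype a)%SET &
  forall C D s, s \in S -> wdist C D = s <-> wdist (th C) (th D) = p s].
Proof.
have [C0] := chamber_inhabited Delta; pose p := perm (@type_at_inj C0).
have pE C t : type_at C t = p t by rewrite permE; apply: type_at_const.
have pS : perm_on S p.
  by apply/subsetP=> t; rewrite inE; apply: contraR => nSt; rewrite -(pE C0) type_at_out.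
have typeE a : stype (theta a) = (p @: stype a)%SET.
  have [C aC] := simplex_chamber a; have taC := (theta_chambers a C).2 aC.
  apply/setP=> t'; rewrite -[t'](permKV p) mem_imset; last exact: perm_inj.
  set t := p^-1 t'; case: (boolP (t \in S)) => [St|nSt]; last first.
    apply/idP/idP=> /(subsetP (stype_sub _)); last by rewrite (negbTE nSt).
    by rewrite (perm_closed _ pS) (negbTE nSt).
  have [b Eb bC] := vertex_ex C St.
  have Etb := type_atE St Eb bC; have tbC := (theta_chambers b C).2 bC.
  have := aut_face theta b a; rewrite (face_typeP tbC taC) (face_typeP bC aC).
  by rewrite Etb Eb pE !sub1set => -[h1 h2]; apply/idP/idP.
exists p; split=> // C D s Ss.
have sub : S :\ s \subset S by apply: subsetDl.
pose a := face_at C sub; have aC : chambers_of a C by apply: face_at_in.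
have Sps : p s \in S by rewrite (perm_closed _ pS).
have EP t E F : t \in S -> wdist E F \in <<S :\: (S :\ t)>> -> E <> F -> wdist E F = t.
  have -> : S :\: (S :\ t) = S :&: [set t].
    by apply/setP=> x; rewrite !inE; case: (x == t); case: (x \in S).
  move=> St; rewrite (setIidPr _) ?sub1set // => h neq.
  by case: (gen1 (erefl _) St h) => // /wdist1.
have PE t E : t \in S -> t \in <<S :\: (S :\ t)>>.
  by move=> St; rewrite mem_gen // !inE eqxx St.
have Ea : stype (theta a) = S :\ p s.
  rewrite typeE /=; apply/setP=> t'; rewrite -[t'](permKV p) mem_imset ?inE; last exact: perm_inj.
  by rewrite (inj_eq perm_inj) (perm_closed _ pS).
have taC := (theta_chambers a C).2 aC.
have Cth : chambers_of a D <-> wdist (th C) (th D) \in <<S :\: (S :\ p s)>>.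
  by rewrite -theta_chambers (simplex_res taC) Ea.
split=> E.
  apply: EP => //; first by apply/Cth; rewrite (simplex_res aC) /residue /= E; apply: (PE s C).
  by move/chamber_map_inj=> CD; have := gens_neq1 Ss; rewrite -E CD wdistxx eqxx.
apply: EP => //; last first.
  by move=> CD; have := gens_neq1 Sps; rewrite -E CD wdistxx eqxx.
have: chambers_of a D by apply/Cth; rewrite E; apply: (PE _ C).
by rewrite (simplex_res aC).
Qed.

Lemma type_permP : [/\ perm_on S (type_perm theta),
  forall a, stype (theta a) = (type_perm theta @: stype a)%SET &
  forall C D s, s \in S -> wdist C D = s <-> wdist (th C) (th D) = type_perm theta s].
Proof.
have [p [pS typeE adjE]] := type_perm_ex.
have ind : induces_type_perm theta p.
  split=> // C D C' D'; rewrite !chamber_mapE => /chamber_simplex_inj <-.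
  by move/chamber_simplex_inj <-; apply: adjE.
have [qS adjq] : induces_type_perm theta (type_perm theta).
  by rewrite /type_perm; apply: (classical_sets.xgetPex 1); exists p.
suff -> : type_perm theta = p by [].
apply/permP=> s; case: (boolP (s \in S)) => [Ss|nSs]; last by rewrite !(out_perm _ nSs).
have [C0] := chamber_inhabited Delta; have [D CD] := adj_ex C0 Ss.
rewrite -((adjE _ _ _ Ss).1 CD); apply/esym.
by apply/(adjq C0 D _ _ (chamber_mapE _) (chamber_mapE _) s Ss).
Qed.

Local Notation p := (type_perm theta).
Local Notation displ := (displ th).

Lemma chambers_codist_r C D D' J K : J \subset S ->
  (forall s, s \in J -> twist cox p s \in K) ->
  wdist D D' \in <<J>> -> exists2 j, j \in <<K>> & codist th C D' = codist th C D * j.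
Proof. by case: type_permP => pS _ adjE; apply: codist_res_r. Qed.

(** Moving inside a residue of type S minus J multiplies codistances by elements of its
    parabolic subgroup, on both sides as the twist preserves J. So opposite chambers exist in
    a residue and its image exactly when displacements lie in this parabolic subgroup. *)
Lemma Opp_has_typeP J : J \subset S ->
  Opp_has_type theta J <->
  (p @: J)%SET :^ w0 = J /\ exists C, displ C \in <<S :\: J>>.
Proof.
move=> sJ; have [pS typeE adjE] := type_permP.
have twJ : (p @: J)%SET :^ w0 = J -> forall s, (twist cox p s \in J) = (s \in J).
  by move=> EJ s; rewrite -{1}EJ /twist memJ_conjg mem_imset //; apply: perm_inj.
split=> [[a [[Et [C [D' [aC bD E]]]] Ea]]|[EJ [C dC]]].
  have EJ : (p @: J)%SET :^ w0 = J.
    by rewrite -Ea -typeE Et -conjsgM longestK conjsg1.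
  split=> //; exists C; have [D ED] := chamber_map_surj D'.
  rewrite -ED in bD E; have aD := (theta_chambers a D).1 bD.
  have DC : wdist D C \in <<S :\: J>>.
    by rewrite res_sym; move: aD; rewrite (simplex_res aC) Ea.
  have tK s : s \in S :\: J -> twist cox p s \in S :\: J.
    by rewrite !inE twJ // => /andP[-> /(twist_gens pS)->].
  have [j Jj Ej] := chambers_codist_r C (subsetDl S J) tK DC.
  by rewrite -[displ C]/(codist th C C) Ej /codist E longestK mul1g.
have dV : (displ C)^-1 \in <<S :\: J>> by rewrite groupV.
have [C' CC' E] := codist_mv_l th C C (subsetDl S J) dV.
exists (face_at C sJ); split=> //; split; first by rewrite typeE /= -{2}EJ -conjsgM longestK conjsg1.
exists C', (th C); split=> //; last by apply/codist_opp; rewrite E mulVg.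
by apply/theta_chambers/face_at_in.
Qed.

End Simplices.

(** * Finite Coxeter graphs have no short cycles *)

Section Cycles.

Variables (gT : finGroupType) (cox : coxeter_system gT).
Local Notation S := (gens cox).
Local Notation len := (cox_length cox).
Local Notation "x * y" := (@mul gT x y) : group_scope.
Local Notation ldesc := (ldesc cox).
Local Notation rdesc := (rdesc cox).

Implicit Types (s t x y u v w : gT) (J K L : {set gT}).

Lemma rdesc_commute w s t : s \in S -> t \in S -> s * t = t * s -> s != t ->
  rdesc (w * t) s = rdesc w s.
Proof.
move=> Ss St st neq; rewrite !rdescE invM (gensV St) !ldescE inversionM.
rewrite (inversion_gen _ St) (negbTE neq) /= conjE (gensV St) mulA -st -mulA.
by rewrite (gensK St) mulg1.
Qed.

(** When neighbouring letters do not commute and letters at distance two differ,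
    neither a commutation nor a braid move applies to the word c_0 ... c_(n-1):
    it is the only reduced word of its product. *)
Lemma walk_rdesc (c : nat -> gT) N : (forall n, n < N -> c n \in S) ->
  (forall n, n.+1 < N -> c n * c n.+1 != c n.+1 * c n) ->
  (forall n, n.+2 < N -> c n != c n.+2) ->
  forall n, n <= N -> len (word_prod [seq c i | i <- iota 0 n]) = n /\
    forall s, s \in S -> rdesc (word_prod [seq c i | i <- iota 0 n]) s ->
      exists2 i, n = i.+1 & s = c i.
Proof.
move=> cS nc nc2; pose w n := word_prod [seq c i | i <- iota 0 n].
have w0 : w 0 = 1 by rewrite /w word_prod_nil.
have wS n : w n.+1 = w n * c n.
  by rewrite /w -addn1 iotaD map_cat word_prod_cat /= word_prod_cons word_prod_nil mulg1.
move=> n; rewrite -/(w n); have [m] := ubnP n; elim: m n => // m IH [_ _|n lt_nm leN].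
  by rewrite w0 len1; split=> // s Ss; rewrite rdescE invg1 ldescE inversion1.
have [ln dn] := IH n lt_nm (ltnW leN); have Sn := cS n leN.
have wK : w n.+1 * c n = w n by rewrite wS -mulA (gensK Sn) mulg1.
have ndn : ~~ rdesc (w n) (c n).
  apply/negP=> /(dn _ Sn)[i En E]; rewrite En in E leN; move: (nc i leN).
  by rewrite E eqxx.
split; first by rewrite wS len_rdesc // (negbTE ndn) ln.
move=> s Ss ds; have [->|neq] := eqVneq s (c n); first by exists n.
have [st|/eqP st] := pselect (s * c n = c n * s).
  move: ds; rewrite wS rdesc_commute // => /(dn _ Ss)[i En Es].
  by rewrite En in st leN; move: (nc i leN); rewrite -Es st eqxx.
have dc : rdesc (w n.+1) (c n) by rewrite wS rdesc_mul.
have [] := rdesc_noncommuting Sn Ss _ dc ds; first by rewrite eq_sym.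
rewrite wK => /(dn _ Ss)[i En Es].
have lt_im : i < m by rewrite -ltnS (leq_trans _ lt_nm) // En.
have leiN : i < N by rewrite (leq_trans _ leN) // En ltnS ltnW.
have Si := cS i leiN.
rewrite [in w n]En wS -Es -mulA Es (gensK Si) mulg1.
have [_ di] := IH i lt_im (ltnW leiN) => /(di _ Sn)[i' Ei E].
rewrite En Ei in E leN; move: (nc2 i' leN); by rewrite E eqxx.
Qed.

(** Such a word cannot go on for ever, as lengths are bounded. *)
Lemma no_infinite_word (c : nat -> gT) : (forall n, c n \in S) ->
  (forall n, c n * c n.+1 != c n.+1 * c n) -> (forall n, c n != c n.+2) -> False.
Proof.
move=> cS nc nc2; pose N := (len (longest cox)).+1.
have [//|//|//|] := @walk_rdesc c N _ _ _ N (leqnn N).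
by move=> lN _; have := longest_max cox (word_prod [seq c i | i <- iota 0 N]); rewrite lN ltnn.
Qed.

(** A closed walk is described by its successor function. *)
Lemma no_cycle (l : seq gT) (f : gT -> gT) a : a \in l ->
  (forall x, x \in l -> [/\ x \in S, f x \in l, x * f x != f x * x & x != f (f x)]) ->
  False.
Proof.
move=> la lP; have cl n : iter n f a \in l.
  by elim: n => // n IH; rewrite iterS; case: (lP _ IH).
by apply: (@no_infinite_word (fun n => iter n f a)) => n; rewrite ?iterS; case: (lP _ (cl n)).
Qed.

Lemma no_triangle a b c : a \in S -> b \in S -> c \in S ->
  a * b != b * a -> b * c != c * b -> c * a != a * c -> False.
Proof.
move=> Sa Sb Sc ab bc ca.
have neq x y : x * y != y * x -> x != y by apply: contraNneq => ->.
have [nab nbc nca] := And3 (neq _ _ ab) (neq _ _ bc) (neq _ _ ca).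
pose f x := if x == a then b else if x == b then c else a.
have fa : f a = b by rewrite /f eqxx.
have fb : f b = c by rewrite /f eq_sym (negbTE nab) eqxx.
have fc : f c = a by rewrite /f (negbTE nca) eq_sym (negbTE nbc).
apply: (@no_cycle [:: a; b; c] f a); first by rewrite inE eqxx.
move=> x; rewrite !inE => /or3P[] /eqP->; rewrite ?(fa, fb, fc) eqxx ?orbT;
  by split=> //; rewrite eq_sym.
Qed.

Lemma no_square a b c d : a \in S -> b \in S -> c \in S -> d \in S ->
  a * b != b * a -> b * c != c * b -> c * d != d * c -> d * a != a * d ->
  a != c -> b != d -> False.
Proof.
move=> Sa Sb Sc Sd ab bc cd da nac nbd.
have neq x y : x * y != y * x -> x != y by apply: contraNneq => ->.
have [nab nbc ncd nda] := And4 (neq _ _ ab) (neq _ _ bc) (neq _ _ cd) (neq _ _ da).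
pose f x := if x == a then b else if x == b then c else if x == c then d else a.
have fa : f a = b by rewrite /f eqxx.
have fb : f b = c by rewrite /f eq_sym (negbTE nab) eqxx.
have fc : f c = d by rewrite /f eq_sym (negbTE nac) eq_sym (negbTE nbc) eqxx.
have fd : f d = a by rewrite /f (negbTE nda) eq_sym (negbTE nbd) eq_sym (negbTE ncd).
apply: (@no_cycle [:: a; b; c; d] f a); first by rewrite inE eqxx.
move=> x; rewrite !inE => /or4P[] /eqP->; rewrite ?(fa, fb, fc, fd) eqxx ?orbT;
  by split=> //; rewrite eq_sym.
Qed.

Lemma edge_noncommuting s t : coxeter_edge cox s t -> s * t != t * s.
Proof.
case/and3P=> Ss St; apply: contraTneq => st; rewrite -leqNgt; apply: dvdn_leq => //.
rewrite order_dvdn; apply/eqP; rewrite -[LHS]/(s * t * (s * t)).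
by rewrite {2}st mulA -(mulA s t t) (gensK St) mulg1 (gensK Ss).
Qed.

Lemma connect_exit (T : finType) (e : rel T) (A : {set T}) (x y : T) :
  connect e x y -> x \in A -> y \notin A -> exists s t : T, [/\ s \in A, t \notin A & e s t].
Proof.
case/connectP=> q; elim: q x => [|z q IH] x /=; first by move=> _ -> ->.
case/andP=> xz zq Ey xA yA; case: (boolP (z \in A)) => zA; last by exists x, z.
exact: IH zq Ey zA yA.
Qed.

End Cycles.

(** * Automorphisms that are not oppomorphisms *)

Section NotOppomorphism.

Variables (gT : finGroupType) (cox : coxeter_system gT) (Delta : building cox).
Variable theta : automorphism Delta.
Local Notation S := (gens cox).
Local Notation len := (cox_length cox).
Local Notation "x * y" := (@mul gT x y) : group_scope.
Local Notation ldesc := (ldesc cox).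
Local Notation rdesc := (rdesc cox).
Local Notation th := (chamber_map theta).
Local Notation p := (type_perm theta).
Local Notation displ := (displ th).
Local Notation twist := (twist cox p).

Implicit Types (s t x y u v w : gT) (J K L : {set gT}) (C D X : chamber Delta).

Let pS : perm_on S p. Proof. by case: (type_permP theta). Qed.
Let th_adj C D s : s \in S -> wdist C D = s <-> wdist (th C) (th D) = p s.
Proof. by case: (type_permP theta) => _ _; apply. Qed.
Let th_surj := @chamber_map_surj _ _ _ theta.

Definition twist_perm : {perm gT} := perm (@twist_inj _ cox p).

Lemma twist_permE s : twist_perm s = twist s. Proof. exact: permE. Qed.

(** If p s and p t commute, the image of a gallery of type (s, t) closes up to a square,
    and the other half of this square comes from a gallery of type (t, s). *)
Lemma p_commute s t : s \in S -> t \in S -> p s * p t = p t * p s -> s * t = t * s.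
Proof.
move=> Ss St st; have Sps := p_gens pS Ss; have Spt := p_gens pS St.
have [C] := chamber_inhabited Delta; have [C1 CC1] := adj_ex C Ss.
have [D [C1D CD]] := wdist_exr C C1 St; rewrite CC1 in CD.
have thCD : wdist (th C) (th D) = p t * p s.
  have := wdist_stepr (th C) Spt ((th_adj _ _ St).1 C1D).
  rewrite ((th_adj _ _ Ss).1 CC1) st => -[->//|].
  move/(th_adj _ _ Ss)=> E; have := gens_neq1 St.
  by rewrite -[t](mulKg s) -CD E mulVg eqxx.
have [X' [X'C]] := wdist_ex (th C) (th D) Spt.
rewrite thCD mulA (gensK Spt) mul1g => X'D.
have [X EX] := th_surj X'; rewrite -EX in X'C X'D.
have XC := (th_adj _ _ St).2 X'C; have XD := (th_adj _ _ Ss).2 X'D.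
have [] := wdist_step D St (adj_sym St XC); rewrite CD XD // => E.
by have := gens_neq1 St; rewrite -[t](mulKg s) E mulVg eqxx.
Qed.

Lemma twist_noncommuting s t : s \in S -> t \in S ->
  s * t != t * s -> twist s * twist t != twist t * twist s.
Proof.
move=> Ss St; apply: contraNneq => st; apply/eqP/p_commute => //.
apply: (conjg_inj (longest cox)); rewrite !conjMg; exact: st.
Qed.

Hypothesis thickD : thick Delta.

(** A minimal displacement in a parabolic subgroup W_K stable under the twist is
    the longest element of W_K, and it realizes the twist by conjugation on K; an
    involution can only have orbits of size two, and must join them by an edge. *)
Lemma twist_orbit t K : K = porbit twist_perm t -> t \in S -> twist t != t ->
  (exists2 C, displ C \in <<K>> & forall C', displ C' != 1) ->
  twist (twist t) = t /\ t * twist t != twist t * t.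
Proof.
move=> EK St nt [C0 dC0 ndom].
have tK s : (twist s \in K) = (s \in K).
  by rewrite EK -twist_permE -{1}(expg1 twist_perm) -!eq_porbit_mem porbit_perm.
have sK : K \subset S.
  apply/subsetP=> s; rewrite EK => /porbitP[i ->].
  elim: i => [|i IH]; first by rewrite expg0 perm1.
  by rewrite expgSr permM twist_permE twist_gens.
have Kt : t \in K by rewrite EK porbit_id.
have [C CC0 minC] := displ_minimal pS th_adj th_surj thickD C0 sK.
have tKs s : s \in K -> twist s \in K by rewrite tK.
have dC : displ C \in <<K>>.
  have [j Kj E] := codist_res_l th C sK CC0.
  have [j' Kj' E'] := codist_res_r pS th_adj C0 sK tKs CC0.
  by rewrite /displ E E'; apply: groupM => //; apply: groupM.
set u := displ C in minC dC.
have u1 : u != 1 by apply: ndom.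
pose L := [set s in K | ldesc u s].
have sLK : L \subset K by apply/subsetP=> s; rewrite inE => /andP[].
have sL : L \subset S by apply: subset_trans sK.
have LP s : s \in L -> [/\ s ^ u = twist s, ldesc u s & rdesc u (twist s)].
  rewrite inE => /andP[Ks ds]; have [|E _ dr] := minC s Ks; first by rewrite ds.
  by split=> //; rewrite conjE E mulKg.
pose L' := (twist @: L)%SET.
have sL' : L' \subset S by apply/subsetP=> _ /imsetP[s Ls ->]; rewrite twist_gens // (subsetP sL).
have conj_word ws : is_word L ws -> word_prod ws ^ u = word_prod [seq twist s | s <- ws].
  elim: ws => [|a ws IH] /=; first by rewrite !word_prod_nil conj1g.
  case/andP=> La Lws; rewrite !word_prod_cons conjMg IH //.
  by case: (LP a La) => ->.
(* u = x v with x in W_L and v minimal; conjugation by u sends x to some y in W_L' that is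
   not longer, and u = v y, so that a first letter of v would be a descent of u, in L *)
have [v' [x' [Eu' Lx' addm]]] := min_cosetr u^-1 sL.
pose x := x'^-1; pose v := v'^-1.
have Lx : x \in <<L>> by rewrite groupV.
have Eu : u = x * v by rewrite -[u]invgK Eu' invM.
have lenu : len u = (len x + len v)%N.
  by rewrite -lenV Eu' addm // !lenV addnC.
pose y := x ^ u.
have [ly L'y] : len y <= len x /\ y \in <<L'>>.
  have [ws [Lws <- E]] := gen_word_reduced sL Lx.
  have L'ws : is_word L' [seq twist s | s <- ws].
    by rewrite /is_word all_map; apply: sub_all Lws => s Ls /=; apply: imset_f.
  rewrite /y -E conj_word //; split; last by apply/gen_wordP; exists [seq twist s | s <- ws].
  rewrite -(size_map twist); apply: len_leq; apply: sub_all L'ws => s; exact: (subsetP sL').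
have Ev : u = v * y by rewrite /y conjE {2}Eu mulA mulA Eu invM !mulA mulgV mul1g mulVg mul1g.
have v1 : v = 1.
  apply/eqP/negPn/negP=> /ldesc_ex-/(_ cox)[s Ss ds].
  have ds' : ldesc u s.
    have := len_mul_leq cox (s * v) y; rewrite -mulA -Ev (ldescP _ Ss) lenu.
    rewrite (lenS_ldesc Ss ds) addnS ltnS (addnC (len x)) => h.
    by apply: leq_trans h _; rewrite leq_add2l.
  have Ls : s \in L by rewrite inE (ldesc_gen sK dC Ss ds').
  have := addm s (mem_gen Ls); rewrite -lenV invM (gensV Ss) -/v (len_gen Ss).
  rewrite -(lenV cox v') -/v (lenS_ldesc Ss ds) addn1 => E.
  by move: (len (s * v)) E => n E; clear -E; lia.
have Lu : u \in <<L>> by rewrite Eu v1 mulg1.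
have L'u : u \in <<L'>> by rewrite Ev v1 mul1g.
have LL' : L = L'.
  apply/eqP; rewrite eqEcard card_imset ?leqnn ?andbT; last exact: twist_inj.
  by apply/subsetP=> s Ls; apply: (ldesc_gen sL' L'u (subsetP sL s Ls)); case: (LP s Ls).
have [s0 Ss0 ds0] := ldesc_ex cox u1.
have Ls0 : s0 \in L by rewrite inE (ldesc_gen sK dC Ss0 ds0).
have LK s : s \in K -> s \in L.
  have Ks0 := subsetP sLK s0 Ls0.
  have -> : K = porbit twist_perm s0.
    by apply/eqP; rewrite eq_sym EK eq_porbit_mem -EK.
  case/porbitP=> i ->; elim: i => [|i IH]; first by rewrite expg0 perm1.
  by rewrite expgSr permM twist_permE LL' imset_f.
have uV : u^-1 = u.
  apply: (full_ldesc_uniq sK); rewrite ?groupV // => s Ks; last by case: (LP s (LK s Ks)).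
  have: s \in L' by rewrite -LL' LK.
  by case/imsetP=> r Lr ->; rewrite -rdescE; case: (LP r Lr).
have [Et _ _] := LP t (LK t Kt); split.
  have [<- _ _] := LP (twist t) (LK _ (tKs _ Kt)).
  by rewrite -Et -conjgM -{1}uV mulVg conjg1.
apply: contra nt => /eqP tt; rewrite -Et; apply/eqP.
have: u \in <<[set t; twist t]>>.
  apply: genS_mem dC; apply/subsetP=> s; rewrite EK => /porbitP[i ->].
  elim: i => [|i IH]; first by rewrite expg0 perm1 set21.
  rewrite expgSr permM twist_permE; case/set2P: IH => ->; first exact: set22.
  have [<- _ _] := LP (twist t) (LK _ (tKs _ Kt)).
  by rewrite -Et -conjgM -{1}uV mulVg conjg1 set21.
have: t \in 'C(<<[set t; twist t]>>).
  by rewrite -sub_cent1 gen_subG; apply/subsetP=> s /set2P[] ->; apply/cent1P.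
by move/centP=> ct /ct/commgP/conjg_fixP.
Qed.

(** By connectedness some edge leads from a nontrivial orbit {a, twist a}, itself an edge,
    to a vertex c outside; with c and twist c this makes a triangle or a square. *)
Lemma not_opp_not_strong : irreducible cox -> exceptional_domestic theta ->
  ~ oppomorphism theta -> ~ strongly_exceptional_domestic theta.
Proof.
move=> [_ irr] [[_ dom] typS] nopp [_ strong].
have ndom C : displ C != 1.
  apply/eqP=> d1; have [_] := Opp_has_typeP theta (subxx S).
  have ES : (p @: S)%SET :^ longest cox = S.
    apply/eqP; rewrite eqEcard cardJg card_imset ?leqnn ?andbT; last exact: perm_inj.
    apply/subsetP=> _ /imsetP[_ /imsetP[s Ss ->] ->].
    exact: twist_gens.
  case; first by split=> //; exists C; rewrite d1 group1.
  move=> a [aO Ea]; have [D aD] := simplex_chamber a.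
  apply: (dom D); rewrite (_ : chamber_simplex D = a) //.
  apply: (same_type_eq _ aD); last by rewrite Ea.
  exact/chamber_simplexE.
have [s Ss ns] : exists2 s, s \in S & twist s != s.
  apply: contrapT => h; apply: nopp => s Ss; apply: contrapT => ns; apply: h.
  exists s => //; apply: contra_notN ns => /eqP E.
  by rewrite -{2}E /twist -conjgM longestK conjg1.
pose O t := porbit twist_perm t.
have stableJ (J : {set gT}) : (p @: J)%SET :^ longest cox = J -> forall t, t \in J -> O t \subset J.
  move=> EJ t Jt; apply/subsetP=> r /porbitP[i ->].
  elim: i => [|i IH]; first by rewrite expg0 perm1.
  by rewrite expgSr permM twist_permE -EJ memJ_conjg imset_f.
have sO t : t \in S -> O t \subset S.
  move=> St; apply/subsetP=> r /porbitP[i ->].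
  elim: i => [|i IH]; first by rewrite expg0 perm1.
  by rewrite expgSr permM twist_permE twist_gens.
have OS t : t \in S -> O t != S.
  move=> St; apply/eqP=> EO.
  have := St; rewrite -{1}typS => /bigcupP[J /andP[sJ /asboolP OJ] Jt].
  have [EJ [C dC]] := (Opp_has_typeP theta sJ).1 OJ.
  have ES : J = S by apply/eqP; rewrite eqEsubset sJ -EO stableJ.
  have := ndom C; rewrite ES setDv in dC.
  by rewrite (gen_set0_1 dC) eqxx.
have orb t : t \in S -> twist t != t -> twist (twist t) = t /\ t * twist t != twist t * t.
  move=> St nt; apply: (twist_orbit (erefl (O t)) St nt).
  have EJ : (p @: (S :\: O t))%SET :^ longest cox = S :\: O t.
    apply/eqP; rewrite eqEcard cardJg card_imset ?leqnn ?andbT; last exact: perm_inj.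
    apply/subsetP=> _ /imsetP[_ /imsetP[r /setDP[Sr nOr] ->] ->].
    rewrite inE (twist_gens pS Sr) andbT; apply: contra nOr.
    by rewrite -[p r ^ _]/(twist r) /O -twist_permE -{1}(expg1 twist_perm) -!eq_porbit_mem porbit_perm.
  have [|_ [C dC]] := (Opp_has_typeP theta (subsetDl S (O t))).1 (strong _ _ EJ).
    by rewrite properE subsetDl; apply/subsetPn; exists t; rewrite // !inE porbit_id.
  by exists C => //; move: dC; rewrite setDDr setDv set0U (setIidPr (sO t St)).
have Sts := twist_gens pS Ss; have [tts nst] := orb s Ss ns.
have OsE : O s = [set s; twist s].
  apply/eqP; rewrite eqEsubset; apply/andP; split; last first.
    by rewrite subUset !sub1set porbit_id -twist_permE -{1}(expg1 twist_perm) mem_porbit.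
  apply/subsetP=> r /porbitP[i ->]; elim: i => [|i IH]; first by rewrite expg0 perm1 set21.
  by rewrite expgSr permM twist_permE; case/set2P: IH => ->; rewrite ?tts ?set21 ?set22.
have /subsetPn[y Sy nOy] : ~~ (S \subset [set s; twist s]).
  by apply: contra (OS s Ss) => sub; rewrite eqEsubset sO // OsE.
have [a [c [Oa nOc ac]]] := connect_exit (irr s y Ss Sy) (set21 _ _) nOy.
have Sc : c \in S by case/and3P: ac.
have {}ac := edge_noncommuting ac.
have Sa : a \in S by case/set2P: Oa => ->.
have [taa nta nab] : [/\ twist (twist a) = a, twist a != a & a * twist a != twist a * a].
  by case/set2P: Oa => ->; rewrite ?tts; split; rewrite // eq_sym.
have Stc := twist_gens pS Sc; have Sta := twist_gens pS Sa.
have tac := twist_noncommuting Sa Sc ac.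
have [ca cb] : c != a /\ c != twist a.
  case/set2P: Oa (nOc) => ->; rewrite !inE negb_or ?tts => /andP[]; by split.
have [Ec|nc] := eqVneq (twist c) c.
  apply: (no_triangle Sa Sta Sc nab); first by rewrite -{1 2}Ec.
  by rewrite eq_sym.
have [ttc ncc] := orb c Sc nc.
apply: (no_square Sa Sta Stc Sc nab tac _ _ _ _); rewrite // 1?eq_sym //.
by rewrite -taa (inj_eq (@twist_inj _ _ _)).
Qed.

End NotOppomorphism.

(** * Paths in the Coxeter graph *)

Section Paths.

Variables (gT : finGroupType) (cox : coxeter_system gT).
Local Notation S := (gens cox).
Local Notation len := (cox_length cox).
Local Notation "x * y" := (@mul gT x y) : group_scope.
Local Notation ldesc := (ldesc cox).
Local Notation rdesc := (rdesc cox).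

Implicit Types (s x y z u v w : gT) (i j k m n r t : nat) (I J K L : {set gT}) (a : nat -> gT).

(** An induced path with simple bonds a_0, ..., a_(n-1), a diagram of type A. *)
Record path_in a n : Prop := PathIn {
  path_gens : forall i, i < n -> a i \in S;
  path_inj : forall i j, i < n -> j < n -> a i = a j -> i = j;
  path_braid : forall i, i.+1 < n -> a i * a i.+1 * a i = a i.+1 * a i * a i.+1;
  path_far : forall i j, i.+1 < j -> j < n -> a i * a j = a j * a i
}.

Lemma braid_noncommuting (s t : gT) : s \in S -> t \in S -> s != t ->
  s * t * s = t * s * t -> s * t != t * s.
Proof.
move=> Ss St neq E; apply: contra neq => /eqP st; apply/eqP.
have E1 : s * t * s = t by rewrite st -mulA (gensK Ss) mulg1.
have E2 : t * s * t = s by rewrite -st -mulA (gensK St) mulg1.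
by rewrite -E2 -E E1.
Qed.

Definition seg a i j : {set gT} := [set x in [seq a t | t <- iota i (j - i)]].

Lemma segP a i j x : reflect (exists t, [/\ i <= t, t < j & x = a t]) (x \in seg a i j).
Proof.
rewrite inE; apply: (iffP mapP) => [[t]|[t [it tj ->]]].
  by rewrite mem_iota => /andP[it tj] ->; exists t; split=> //; lia.
by exists t => //; rewrite mem_iota it; lia.
Qed.

Lemma seg_at a i j t : i <= t -> t < j -> a t \in seg a i j.
Proof. by move=> it tj; apply/segP; exists t. Qed.

Lemma seg_sub a i j i' j' : i' <= i -> j <= j' -> seg a i j \subset seg a i' j'.
Proof.
move=> ii jj; apply/subsetP=> x /segP[t [it tj ->]].
by apply: seg_at; [apply: leq_trans it | apply: leq_trans jj].
Qed.

Lemma seg_gens a n i j : path_in a n -> j <= n -> seg a i j \subset S.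
Proof.
move=> pa jn; apply/subsetP=> x /segP[t [_ tj ->]]; apply: (path_gens pa).
exact: leq_trans jn.
Qed.

Lemma seg_shift a i n j m : seg (fun t => a (i + t)%N) j m = seg a (i + j) (i + m).
Proof.
apply/setP=> x; apply/segP/segP=> [[t [jt tm ->]]|[t [jt tm ->]]].
  by exists (i + t)%N; rewrite leq_add2l ltn_add2l.
exists (t - i)%N; rewrite leq_subRL ?ltn_subLR ?subnKC //; lia.
Qed.

Lemma seg_rev a n i j : j <= n -> seg (fun t => a (n - t.+1)%N) i j = seg a (n - j) (n - i).
Proof.
move=> jn; apply/setP=> x; apply/segP/segP=> [[t [jt tm ->]]|[t [jt tm ->]]].
  by exists (n - t.+1)%N; split=> //; lia.
exists (n - t.+1)%N; split; try lia; congr (a _); lia.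
Qed.

Lemma path_shift a n i m : path_in a n -> i + m <= n -> path_in (fun t => a (i + t)%N) m.
Proof.
move=> pa imn; have lt t : t < m -> i + t < n by move=> tm; lia.
split=> [t tm|t r tm rm E|t tm|t r tr rm].
- exact/(path_gens pa)/lt.
- by have := path_inj pa (lt t tm) (lt r rm) E; lia.
- by rewrite addnS; apply: (path_braid pa); rewrite -addnS; apply: lt.
- by apply: (path_far pa); [rewrite -addnS ltn_add2l | apply: lt].
Qed.

Lemma path_prefix a n m : path_in a n -> m <= n -> path_in a m.
Proof. by move=> pa mn; apply: (path_shift (i := 0) pa). Qed.

Lemma path_rev a n : path_in a n -> path_in (fun t => a (n - t.+1)%N) n.
Proof.
move=> pa; split=> [t tm|t r tm rm E|t tm|t r tr rm].
- by apply: (path_gens pa); lia.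
- by have := path_inj pa _ _ E; lia.
- have -> : (n - t.+1 = (n - t.+2).+1)%N by lia.
  by apply/esym/(path_braid pa); lia.
- by apply/esym/(path_far pa); lia.
Qed.

Lemma path_noncommuting a n i : path_in a n -> i.+1 < n -> a i * a i.+1 != a i.+1 * a i.
Proof.
move=> pa lt; apply: braid_noncommuting; rewrite ?(path_braid pa) ?(path_gens pa) //.
- exact: ltnW.
- by apply/eqP=> /(path_inj pa (ltnW lt) lt); lia.
Qed.

(** Minimal representatives of cosets of the parabolic subgroups that omit an end of the
    path. *)
Definition up a i m : gT := word_prod [seq a t | t <- iota i m].
Definition down a i m : gT := (up a i m)^-1.

Lemma up0 a i : up a i 0 = 1. Proof. exact: word_prod_nil. Qed.
Lemma down0 a i : down a i 0 = 1. Proof. by rewrite /down up0 invg1. Qed.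

Lemma upS a i m : up a i m.+1 = a i * up a i.+1 m.
Proof. exact: word_prod_cons. Qed.

Lemma upSr a i m : up a i m.+1 = up a i m * a (i + m)%N.
Proof.
by rewrite /up -addn1 iotaD map_cat word_prod_cat /= word_prod_cons word_prod_nil mulg1.
Qed.

Lemma up_seg a i m : up a i m \in <<seg a i (i + m)>>.
Proof.
apply/gen_wordP; exists [seq a t | t <- iota i m]; split=> //.
by apply/allP=> x /mapP[t]; rewrite mem_iota => /andP[it tm] ->; apply: seg_at.
Qed.

Lemma down_seg a i m : down a i m \in <<seg a i (i + m)>>.
Proof. by rewrite groupV up_seg. Qed.

Section PathWords.

Variables (a : nat -> gT) (n : nat).
Hypothesis pa : path_in a n.

Lemma downS i m : i + m < n -> down a i m.+1 = a (i + m)%N * down a i m.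
Proof. by move=> lt; rewrite /down upSr invM (gensV (path_gens pa lt)). Qed.

Lemma downSr i m : i < n -> down a i m.+1 = down a i.+1 m * a i.
Proof. by move=> lt; rewrite /down upS invM (gensV (path_gens pa lt)). Qed.

Lemma up_rdesc i m s : i + m <= n -> s \in S -> rdesc (up a i m) s ->
  exists2 k, m = k.+1 & s = a (i + k)%N.
Proof.
move=> imn Ss; have pi := path_shift pa imn.
have [_ uniq] := @walk_rdesc _ cox (fun t => a (i + t)%N) m (path_gens pi)
  (fun t => path_noncommuting pi (i := t))
  (fun t lt => introN eqP (fun E => ltac:(have := path_inj pi (ltnW (ltnW lt)) lt E; lia)))
  m (leqnn m).
have -> : up a i m = word_prod [seq a (i + t)%N | t <- iota 0 m].
  by rewrite /up -[in iota i m](addn0 i) iotaDl -map_comp.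
exact: uniq.
Qed.

Lemma down_ldesc i m s : i + m <= n -> s \in S -> ldesc (down a i m) s ->
  exists2 k, m = k.+1 & s = a (i + k)%N.
Proof. exact: up_rdesc. Qed.

Lemma down_word i m : i + m <= n ->
  down a i m = word_prod [seq a (i + (m - t.+1))%N | t <- iota 0 m].
Proof.
elim: m => [|m IH] imn; first by rewrite down0 word_prod_nil.
have lt : i + m < n by lia.
rewrite downS // IH ?(ltnW lt) // [iota 0 m.+1]/= map_cons word_prod_cons subn1 /=.
congr (_ * word_prod _); rewrite (iotaDl 1 0) -map_comp; apply: eq_map => t /=.
by congr (a (_ + _)%N); lia.
Qed.

Lemma down_rdesc i m s : i + m <= n -> s \in S -> rdesc (down a i m) s ->
  0 < m /\ s = a i.
Proof.
move=> imn Ss; have pi := path_rev (path_shift pa imn).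
have [_ uniq] := @walk_rdesc _ cox (fun t => a (i + (m - t.+1))%N) m (path_gens pi)
  (fun t => path_noncommuting pi (i := t))
  (fun t lt => introN eqP (fun E => ltac:(have := path_inj pi (ltnW (ltnW lt)) lt E; lia)))
  m (leqnn m).
rewrite down_word // => /(uniq _ Ss)[k Ek ->]; split; first by rewrite Ek.
by congr a; lia.
Qed.

Lemma up_ldesc i m s : i + m <= n -> s \in S -> ldesc (up a i m) s -> 0 < m /\ s = a i.
Proof. by move=> imn Ss ds; apply: down_rdesc imn Ss _; rewrite rdescE invgK. Qed.

Lemma down_neq1 i m : 0 < m -> i + m <= n -> down a i m <> 1.
Proof.
case: m => // m _ imn; have lt : i + m < n by lia.
have Sm := path_gens pa lt; rewrite downS // => E.
have : a (i + m)%N \in <<seg a i (i + m)>>.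
  have -> : a (i + m)%N = (down a i m)^-1.
    by rewrite -[LHS]mulg1 -(mulgV (down a i m)) mulA E mul1g.
  by rewrite groupV; apply: down_seg.
rewrite (gen_gens (seg_gens i pa (ltnW lt)) Sm).
by move=> /segP[r [_ lt_r /(path_inj pa lt)]]; lia.
Qed.

Lemma far_down i m (x : nat) : i + m < x -> x < n -> down a i m * a x = a x * down a i m.
Proof.
elim: m => [|m IH] lt xn; first by rewrite down0 mul1g mulg1.
rewrite downS ?(ltn_trans _ xn) //; last by lia.
by rewrite -mulA IH; try lia; rewrite !mulA (path_far pa) //; lia.
Qed.

Lemma far_down_low i m (x : nat) : x.+1 < i -> i + m <= n ->
  down a i m * a x = a x * down a i m.
Proof.
move=> lt; elim: m => [|m IH] imn; first by rewrite down0 mul1g mulg1.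
rewrite downS; last by lia.
by rewrite -mulA IH ?mulA ?(path_far pa (i := x)) //; lia.
Qed.

(** The letters far from a_x commute with it, and the two next to it provide a braid
    relation. *)
Lemma down_shift i m (x : nat) : i < x -> x < i + m -> i + m <= n ->
  down a i m * a x = a x.-1 * down a i m.
Proof.
case: x => // x; elim: m => [|m IH] ix xm imn; first by lia.
rewrite downS; last by lia.
have [lt|ge] := ltnP x.+1 (i + m).
  rewrite -mulA IH //; last by lia.
  by rewrite !mulA /= -(path_far pa) //; lia.
case: m IH xm imn ge => [|m] IH xm imn ge; first by lia.
have Ex : x = (i + m)%N by lia.
have lt : i + m < n by lia.
have Em : (i + m.+1 = (i + m).+1)%N by lia.
rewrite Em Ex /= downS // !mulA -!(mulA _ (down a i m)) far_down; try lia.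
by rewrite !mulA -Em in imn *; rewrite Em (path_braid pa) //; lia.
Qed.

(** In the symmetric group of the path, the word a_(n-1) ... a_j records which point is
    sent to the last place. *)
Lemma path_normal_form c : c \in <<seg a 0 n>> -> exists j x,
  [/\ j <= n, x \in <<seg a 0 n.-1>> & c = x * down a j (n - j)].
Proof.
elim/gen_indr: c / => [|s c /segP[i [_ lt_in ->]] _ [j [x [jn Jx ->]]]].
  by exists n, 1; rewrite subnn down0 mulg1 group1.
have [lt_ij|gt_ij|E] := ltngtP i j; last first.
- exists j.+1, x; subst i; split=> //.
  have -> : (n - j = (n - j.+1).+1)%N by lia.
  by rewrite downSr // -!mulA (gensK (path_gens pa lt_in)) mulg1.
- exists j, (x * a i.-1); split=> //; last by rewrite -!mulA down_shift //; lia.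
  by rewrite groupM // mem_gen // seg_at //; lia.
have [E|lt] := eqVneq i.+1 j.
  exists i, x; split; [exact: ltnW | by [] |].
  have -> : (n - i = (n - j).+1)%N by lia.
  by rewrite downSr // E mulA.
exists j, (x * a i); split=> //; first by rewrite groupM // mem_gen // seg_at //; lia.
by rewrite -!mulA far_down_low //; lia.
Qed.

(** In the projective space of the path, c is the position of a point of a line relative
    to a hyperplane: the line meets the hyperplane, here or in the point reached by a_0. *)
Lemma path_line_meets c : 0 < n -> c \in <<seg a 0 n>> -> exists e x y,
  [/\ e = 1 \/ e = a 0, x \in <<seg a 0 n.-1>>, y \in <<seg a 1 n>> & c * e = x * y].
Proof.
move=> n0 /path_normal_form[[|j] [x [jn Jx ->]]].
  exists (a 0), x, (down a 1 n.-1); split=> //; first by right.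
    by apply: genS_mem (down_seg a 1 n.-1); apply: seg_sub; lia.
  rewrite subn0 -(prednK n0) downSr // -!mulA (gensK (path_gens pa n0)) mulg1.
  by rewrite prednK.
exists 1, x, (down a j.+1 (n - j.+1)); split=> //; first by left.
  by apply: genS_mem (down_seg _ _ _); apply: seg_sub; lia.
by rewrite mulg1.
Qed.

(** Write u = m z with m minimal modulo the parabolic subgroup J that omits the end. A first
    letter of m in J would commute with u and shorten m; so m is minimal on both sides, and the
    normal form leaves only 1 and the end. *)
Lemma path_end_descents u : 0 < n -> u \in <<seg a 0 n>> ->
  (forall j, j < n.-1 -> ldesc u (a j) -> a j * u = u * a j) ->
  u \in <<seg a 0 n.-1>> \/ exists2 z, z \in <<seg a 0 n.-1>> & u = a n.-1 * z.
Proof.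
move=> n0 Pu comm; pose J := seg a 0 n.-1.
have sJ : J \subset S by apply: seg_gens pa _; lia.
have sJP : J \subset seg a 0 n by apply: seg_sub; lia.
have [m [z [Eu Jz addm]]] := min_cosetr u sJ.
have ndm s : s \in J -> ~~ ldesc m s.
  move=> /segP[j [_ lt_j ->]]; apply/negP=> dm.
  have Sj : a j \in S by apply: (path_gens pa); lia.
  have du : ldesc u (a j).
    rewrite ldescP // Eu mulA addm // (lenS_ldesc Sj dm) addSn ltnS.
    exact: len_mul_leq.
  have E := comm j lt_j du.
  have Em : a j * m = m * (z * a j * z^-1).
    by rewrite !mulA -Eu -E Eu -!mulA mulgV mulg1.
  have : len (a j * m) < len m by rewrite -ldescP.
  have Jc : z * a j * z^-1 \in <<J>> by rewrite !groupM ?groupV // mem_gen // seg_at.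
  by rewrite Em addm // ltnNge leq_addr.
have Pm : m \in <<seg a 0 n>>.
  have -> : m = u * z^-1 by rewrite Eu -mulA mulgV mulg1.
  by rewrite groupM ?groupV // (genS_mem sJP).
have m1 : m \in <<J>> -> m = 1.
  move=> Jm; have Jm' : m^-1 \in <<J>> by rewrite groupV.
  have := addm _ Jm'; rewrite mulgV len1 lenV => E.
  by apply/eqP; rewrite -(len_eq0 cox); apply/eqP; lia.
have [j [x [jn Jx Em]]] := path_normal_form Pm.
have [Ej|lt_jn] := eqVneq j n.
  left; rewrite Eu m1 ?mul1g //; rewrite Em Ej subnn down0 mulg1 //.
right; have lt : j < n by lia.
have Ed : down a j (n - j) = a n.-1 * down a j (n.-1 - j).
  have -> : (n - j = (n.-1 - j).+1)%N by lia.
  by rewrite downS; [congr (a _ * _); lia | lia].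
set y := down a j (n.-1 - j) in Ed.
have Jy : y \in <<J>> by apply: genS_mem (down_seg _ _ _); apply: seg_sub; lia.
have lt_en : n.-1 < n by lia.
have Se := path_gens pa lt_en.
(* comparing lengths in m = x e y *)
have l1 : (len x + len m <= 1 + len y)%N.
  have Jx' : x^-1 \in <<J>> by rewrite groupV.
  have := lenD_no_ldesc sJ ndm Jx'; rewrite lenV => <-.
  by rewrite Em Ed mulKg -(len_gen Se) len_mul_leq.
have l2 : (len m + len y <= len x + 1)%N.
  have Jy' : y^-1 \in <<J>> by rewrite groupV.
  have := addm _ Jy'; rewrite lenV => <-.
  by rewrite Em Ed mulA mulgK -(len_gen Se) len_mul_leq.
have [lm0|lm] := eqVneq (len m) 0.
  move/eqP: lm0; rewrite len_eq0 => /eqP m0.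
  exfalso; have : a n.-1 \in <<J>>.
    have -> : a n.-1 = x^-1 * m * y^-1 by rewrite Em Ed !mulA mulVg mul1g mulgK.
    rewrite m0 mulg1; apply: groupM; rewrite groupV; [exact: Jx | exact: Jy].
  by rewrite (gen_gens sJ Se) => /segP[r [_ lt_r /(path_inj pa lt_en)]]; lia.
have Sm : m \in S by apply: (@len_gens _ cox); lia.
move: Pm; rewrite (gen_gens (seg_gens 0 pa (leqnn n)) Sm) => /segP[r [_ rn Er]].
have [lt_r|] := ltnP r n.-1.
  have := ndm (a r); rewrite seg_at // -Er ldescE (inversion_gen _ Sm) eqxx.
  by move=> /(_ isT).
by move=> ge_r; exists z => //; rewrite Eu Er; congr (a _ * _); lia.
Qed.

(** By path_end_descents, u and its inverse both split off the end e; then e z e lies in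
    the parabolic subgroup that omits e, and gen_conj_commute applies. *)
Lemma path_end_split u : 0 < n -> u \in <<seg a 0 n>> ->
  (forall j, j < n.-1 -> ldesc u (a j) || rdesc u (a j) -> a j * u = u * a j) ->
  u \in <<seg a 0 n.-1>> \/
  exists z, [/\ z \in <<seg a 0 (n - 2)>>, u = a n.-1 * z & u = z * a n.-1].
Proof.
move=> n0 Pu comm; pose J := seg a 0 n.-1.
have sJ : J \subset S by apply: seg_gens pa _; lia.
have lt_en : n.-1 < n by lia.
have Se := path_gens pa lt_en.
have [Ju|[z Jz Eu]] := path_end_descents n0 Pu (fun j lt dl => comm j lt (introT orP (or_introl dl))).
  by left.
have Pu' : u^-1 \in <<seg a 0 n>> by rewrite groupV.
have [|Ju|[z' Jz' Eu']] := path_end_descents n0 Pu'.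
- move=> j lt dl; have := comm j lt; rewrite rdescE dl orbT => /(_ isT) E.
  by apply: (mulgI u); apply: (mulIg u); rewrite !mulA -E mulgK mulgV mul1g.
- by left; rewrite -groupV.
have nJe : a n.-1 \notin J by apply/segP=> -[r [_ lt_r /(path_inj pa lt_en)]]; lia.
have [|E Cz] := gen_conj_commute sJ Se nJe Jz.
  suff -> : a n.-1 * z * a n.-1 = z'^-1 by rewrite groupV.
  by rewrite -Eu -[u]invgK Eu' invM (gensV Se) -mulA (gensK Se) mulg1.
right; exists z; rewrite Eu E; split=> //.
apply: genS_mem Cz; apply/subsetP=> s; rewrite inE => /andP[/segP[r [_ lt_r ->]] /eqP c].
apply: seg_at => //; have [Er|] := eqVneq r (n - 2)%N; last by lia.
have lt : r.+1 < n by lia.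
have := path_noncommuting pa lt; have -> : r.+1 = n.-1 by lia.
by rewrite c eqxx.
Qed.

End PathWords.

(** In the projective space of the path, two points are equal or joined by a line. *)
Lemma path_join a n c : path_in a n -> c \in <<seg a 0 n>> ->
  c \in <<seg a 1 n>> \/
  exists x y, [/\ x \in <<seg a 1 n>>, y \in <<seg a 1 n>> & c = x * a 0 * y].
Proof.
elim: n a c => [|n IH] a c pa Pc.
  by left; apply: genS_mem Pc; apply/subsetP=> s /segP[t []].
elim/gen_indr: c / Pc => [|? c /segP[i [_ lt_in ->]] _]; first by left; rewrite group1.
have S0 : a 0 \in S by apply: (path_gens pa).
have [i0|i0] := posnP i; last first.
  have J : a i \in <<seg a 1 n.+1>> by rewrite mem_gen // seg_at.
  by case=> [Jc|[x [y [Jx Jy ->]]]]; [left | right; exists x, (y * a i)];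
    rewrite ?groupM // -?mulA.
rewrite {i lt_in}i0; case=> [Jc|[x [y [Jx Jy ->]]]].
  by right; exists c, 1; rewrite mulg1 group1.
have pa' := path_shift (i := 1) pa (leqnn _).
have seg1 : seg (fun t => a (1 + t)%N) 0 n = seg a 1 n.+1 by rewrite seg_shift.
have seg2 : seg (fun t => a (1 + t)%N) 1 n = seg a 2 n.+1 by rewrite seg_shift.
have comm z : z \in <<seg a 2 n.+1>> -> z * a 0 = a 0 * z.
  elim/gen_indr: z / => [|? z /segP[i [i2 lt_in ->]] _ IHz]; first by rewrite mul1g mulg1.
  by rewrite -mulA -(path_far pa (i := 0)) // mulA IHz mulA.
have sub : seg a 2 n.+1 \subset seg a 1 n.+1 by apply: seg_sub.
have : y \in <<seg a 2 n.+1>> \/ 0 < n /\ exists y1 y2,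
    [/\ y1 \in <<seg a 2 n.+1>>, y2 \in <<seg a 2 n.+1>> & y = y1 * a 1%N * y2].
  have [n0|n0] := posnP n; last first.
    by have := IH _ y pa'; rewrite seg1 seg2 => /(_ Jy)[|Ey]; [left | right].
  left; apply: genS_mem Jy; apply/subsetP=> s /segP[t [t1 tn _]].
  by move: t1 tn; rewrite n0; lia.
case=> [J2y|[lt [y1 [y2 [J1 J2 ->]]]]].
  left; rewrite -!mulA comm // mulA mulA -(mulA x) (gensK S0) mulg1.
  by rewrite groupM // (genS_mem sub).
right; exists (x * y1 * a 1%N), (a 1%N * y2).
have J1' : a 1%N \in <<seg a 1 n.+1>> by rewrite mem_gen // seg_at.
split; rewrite ?groupM // ?(genS_mem sub) //.
have B := path_braid pa (i := 0) lt.
have -> : x * a 0 * (y1 * a 1%N * y2) * a 0 = x * y1 * (a 0 * a 1%N * a 0) * y2.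
  by rewrite -!mulA comm // (mulA _ y1) -comm // !mulA.
by rewrite B !mulA.
Qed.

Lemma commuting_union_split I J w : (forall s x, s \in I -> x \in J -> s * x = x * s) ->
  w \in <<I :|: J>> -> exists x y, [/\ x \in <<I>>, y \in <<J>> & w = x * y].
Proof.
move=> comm; elim/gen_indl: w / => [|s w IJs _ [x [y [Ix Jy ->]]]].
  by exists 1, 1; rewrite mulg1 !group1.
case/setUP: IJs => [Is|Js].
  by exists (s * x), y; rewrite mulA groupM // mem_gen.
exists x, (s * y); split; rewrite ?groupM // ?mem_gen //.
rewrite !mulA; congr (_ * _).
elim/gen_indl: x / Ix => [|r z Ir _ IH]; first by rewrite mul1g mulg1.
by rewrite -mulA -IH !mulA (comm r s).
Qed.

End Paths.

(** * Forms on a linear space *)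

(** A relation b is thought of as a form being nonzero at a pair of points. *)
Section Forms.

Variables (T : Type) (b line : T -> T -> Prop).

Definition same_point X Y := forall Z, (b X Z <-> b Y Z) /\ (b Z X <-> b Z Y).

Definition perp P X := ~ b X P /\ ~ b P X.

Hypothesis line_sym : forall X Y, line X Y -> line Y X.
Hypothesis line_trans : forall X Y Z, line X Y -> line Y Z -> line X Z.
Hypothesis line_third : forall X Y, exists Z, [/\ line X Z, Z <> X & Z <> Y].
Hypothesis zero_l : forall X Y, exists2 Z, line X Z & ~ b Z Y.
Hypothesis zero_r : forall X Y, exists2 Z, line X Z & ~ b Y Z.
Hypothesis line_l : forall X X' Z Y, line X X' -> X <> X' -> line X Z ->
  ~ b X Y -> ~ b X' Y -> ~ b Z Y.
Hypothesis line_r : forall X X' Z Y, line X X' -> X <> X' -> line X Z ->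
  ~ b Y X -> ~ b Y X' -> ~ b Y Z.
Hypothesis join : forall X Y, same_point X Y \/ exists X' Y',
  [/\ same_point X X', same_point Y Y', line X' Y' & X' <> Y'].
Hypothesis nondegenerate : forall X, exists Z, b Z X.
(** No line carries two perpendicular anisotropic points. *)
Hypothesis no_frame : forall A X, b A A -> ~ b X A \/ ~ b A X -> ~ b X X.

Lemma same_point_perp P P' X X' : same_point P P' -> same_point X X' ->
  perp P X -> perp P' X'.
Proof.
move=> PP XX [xp px]; split=> h; [apply: xp | apply: px].
  by apply/(XX P).1/(PP X').2.
by apply/(PP X).1/(XX P').2.
Qed.

Lemma same_point_diag P P' : same_point P P' -> b P P -> b P' P'.
Proof. by move=> PP h; apply/(PP P').1/(PP P).2. Qed.

Lemma perp_join P X : b P P -> perp P X -> exists P' X',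
  [/\ same_point P P', same_point X X', line P' X' & P' <> X'].
Proof.
move=> pp [xp px]; have [E|//] := join P X.
by case: px; apply/(E P).2.
Qed.

(** On the line, each of b(-, P) and b(Y, -) vanishes at X only. *)
Lemma line_anisotropic P X Y : b P P -> perp P X -> ~ b X X -> line P X -> P <> X ->
  line P Y -> Y <> X -> b Y Y.
Proof.
move=> pp [xp px] xx lx Pneq ly Xneq.
have yx : ~ b Y X by apply: (line_l lx Pneq ly).
have lXY : line X Y by apply: line_trans (line_sym lx) ly.
have yp : b Y P.
  apply: contrapT => yp; apply: (line_l lXY (nesym Xneq) (line_sym lx) xp yp pp).
apply: contrapT => yy.
exact: (line_r lXY (nesym Xneq) (line_sym lx) yx yy yp).
Qed.

Lemma perp_line_anisotropic P X Y : b P P -> perp P X -> line P X -> P <> X ->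
  line P Y -> Y <> X -> b Y Y.
Proof.
by move=> pp px; apply: line_anisotropic => //; apply: (no_frame pp); left; case: px.
Qed.

(** For a third point Z, the vanishing of b(X, -) at X and Y gives b(X, Z) = 0, that of
    b(-, Z) at X and Z gives b(Y, Z) = 0, and that of b(Y, -) at Y and Z ends the proof. *)
Lemma isotropic_line_reflexive X Y : line X Y -> X <> Y -> (forall Z, line X Z -> ~ b Z Z) ->
  ~ b X Y -> ~ b Y X.
Proof.
move=> l n iso xy; have [Z [lZ nZX nZY]] := line_third X Y.
have lXX : line X X := line_trans l (line_sym l).
have xz : ~ b X Z by apply: (line_r l n lZ) => //; apply: iso.
have yz : ~ b Y Z by apply: (line_l lZ (nesym nZX) l) => //; apply: iso.
have lYZ : line Y Z := line_trans (line_sym l) lZ.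
by apply: (line_r lYZ (nesym nZY) (line_sym l)) => //; apply: iso.
Qed.

(** Take a third point Y, anisotropic, on the line P X1. The line P X2 has a zero of b(-, Y),
    which is isotropic by no_frame, hence X2. So b(X2, -) vanishes at Y and at P, and on
    the line through them. *)
Lemma perp_isotropic P X1 X2 : b P P -> perp P X1 -> perp P X2 -> ~ b X2 X1.
Proof.
move=> pp p1 p2.
have [P1 [Y1 [EP1 E1 l1 n1]]] := perp_join pp p1.
have [P2 [Y2 [EP2 E2 l2 n2]]] := perp_join pp p2.
have pp1 := same_point_diag EP1 pp; have pp2 := same_point_diag EP2 pp.
have p1' := same_point_perp EP1 E1 p1; have p2' := same_point_perp EP2 E2 p2.
have [Y [lY nY1 nY]] := line_third P1 Y1.
have yy := perp_line_anisotropic pp1 p1' l1 n1 lY nY.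
have [Z lZ zy] := zero_l P2 Y.
have y2 : ~ b Y2 Y.
  have [<-//|neq] := pselect (Z = Y2).
  have zz := perp_line_anisotropic pp2 p2' l2 n2 lZ neq.
  by case: (no_frame yy (or_introl zy) zz).
move=> h; have := line_r (X := P1) (X' := Y) (Z := Y1) (Y := Y2) lY (nesym nY1) l1.
case=> //; first by move=> h'; apply: p2.1; apply/(E2 P).1/(EP1 Y2).2.
by apply/(E2 Y1).1/(E1 X2).2.
Qed.

(** Take Z with b(Z, X) nonzero. The line P Z contains a zero of b(-, P); it is not P, where
    b(-, X) vanishes, so that b(-, X) does not vanish at it. *)
Lemma perp_separated P X : b P P -> ~ b P X -> exists2 Z, ~ b Z P & b Z X.
Proof.
move=> pp px; have [Z zx] := nondegenerate X.
have [E|[P' [Z' [EP EZ l n]]]] := join P Z; first by case: px; apply/(E X).1.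
have [Z1 l1 z1] := zero_l P' P.
exists Z1 => //; apply: contrapT => z1x; have neq : P' <> Z1.
  by move=> E; apply: z1; rewrite -E; apply/(EP P).1.
have px' : ~ b P' X by move=> h; apply: px; apply/(EP X).1.
by apply: (line_l l1 neq l px' z1x); apply/(EZ X).1.
Qed.

(** Let Y on the line be a zero of b(Z0, -), where Z0 is left perpendicular to P but not to
    X, and Z1 left perpendicular to P but not to Y. The line Z0 Z1 has a point H in the
    perpendicular space of P, which is totally isotropic. Then H is not Z0, and b(-, Y) vanishes
    at H and at Z0 but not at Z1. *)
Lemma perp_no_line P X X' : b P P -> perp P X -> perp P X' -> line X X' -> X <> X' -> False.
Proof.
move=> pp px px' l n.
have [Z0 z0p z0x] := perp_separated pp px.2.
have [Y lY z0y] := zero_r X Z0.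
have py : perp P Y.
  by split; [apply: (line_l l n lY px.1 px'.1) | apply: (line_r l n lY px.2 px'.2)].
have [Z1 z1p z1y] := perp_separated pp py.2.
have [E|[A0 [A1 [E0 E1 l01 n01]]]] := join Z0 Z1; first by apply: z0y; apply/(E Y).1.
have [H lH ph] := zero_r A0 P.
have a0p : ~ b A0 P by move=> h; apply: z0p; apply/(E0 P).1.
have a1p : ~ b A1 P by move=> h; apply: z1p; apply/(E1 P).1.
have pH : perp P H by split=> //; apply: (line_l l01 n01 lH).
have hy := perp_isotropic pp py pH.
have [EH|nH] := pselect (A0 = H).
  apply: (perp_isotropic pp px pH); rewrite -EH; exact/(E0 X).1.
have a0y : ~ b A0 Y by move=> h; apply: z0y; apply/(E0 Y).1.
by apply: (line_l lH nH l01 a0y hy); apply/(E1 Y).1.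
Qed.

End Forms.

(** * Panels and one-sided parabolic cosets of codistances *)

Section CodistancePanels.

Variables (gT : finGroupType) (cox : coxeter_system gT) (Delta : building cox).
Local Notation S := (gens cox).
Local Notation len := (cox_length cox).
Local Notation "x * y" := (@mul gT x y) : group_scope.
Local Notation ldesc := (ldesc cox).
Local Notation rdesc := (rdesc cox).

Variables (th : chamber Delta -> chamber Delta) (p : {perm gT}).
Hypothesis pS : perm_on S p.
Hypothesis th_adj : forall C D s, s \in S ->
  wdist C D = s <-> wdist (th C) (th D) = p s.
Hypothesis th_surj : forall D', exists D, th D = D'.
Hypothesis thickD : thick Delta.
Hypothesis twist_id : forall s, s \in S -> twist cox p s = s.

Implicit Types (s t x y z : gT) (I J K L : {set gT}) (A B C D E X Y Z : chamber Delta).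

Local Notation codist := (codist th).
Local Notation displ := (displ th).

Lemma codist_right C D D' s : s \in S -> wdist D' D = s ->
  codist C D' = codist C D * s \/ codist C D' = codist C D.
Proof. by move=> Ss dd; have := codist_r pS th_adj C Ss dd; rewrite twist_id. Qed.

Lemma codist_right_down C D D' s : s \in S -> wdist D' D = s ->
  rdesc (codist C D) s -> codist C D' = codist C D * s.
Proof. by move=> Ss dd; have := codist_r_down pS th_adj (C := C) Ss dd; rewrite twist_id. Qed.

Lemma codist_right_ex C D s : s \in S ->
  exists D', wdist D' D = s /\ codist C D' = codist C D * s.
Proof. by move=> Ss; have := codist_r_ex pS th_adj th_surj C D Ss; rewrite twist_id. Qed.

Lemma codist_right_uniq C D X Y s : s \in S -> ~~ rdesc (codist C D) s ->
  wdist X D = s -> wdist Y D = s ->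
  codist C X = codist C D * s -> codist C Y = codist C D * s -> X = Y.
Proof.
by move=> Ss; have := @codist_r_uniq _ _ _ _ _ pS th_adj C D X Y s Ss; rewrite twist_id.
Qed.

Lemma codist_res_right J C D D' : J \subset S -> wdist D D' \in <<J>> ->
  exists2 j, j \in <<J>> & codist C D' = codist C D * j.
Proof.
move=> sJ; apply: (codist_res_r pS th_adj C sJ) => s Js.
by rewrite twist_id ?(subsetP sJ).
Qed.

Lemma codist_mv_right J C D x : J \subset S -> x \in <<J>> ->
  exists2 D', wdist D D' \in <<J>> & codist C D' = codist C D * x.
Proof.
move=> sJ Jx; apply: (codist_mv_r pS th_adj th_surj C D sJ).
suff -> : twist cox p @: J = J by [].
rewrite -[RHS]imset_id; apply: eq_in_imset => s /(subsetP sJ); exact: twist_id.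
Qed.

(** The panel of type s, its chambers taken as the points of a line. *)
Definition panel s X Y := X = Y \/ wdist X Y = s.

Lemma panel_sym s X Y : s \in S -> panel s X Y -> panel s Y X.
Proof. by move=> Ss [->|/(adj_sym Ss)]; [left | right]. Qed.

Lemma panel_trans s X Y Z : s \in S -> panel s X Y -> panel s Y Z -> panel s X Z.
Proof.
move=> Ss [->//|xy] [<-|yz]; first by right.
have [->|neq] := pselect (X = Z); first by left.
by right; apply: (adj_trans Ss xy (adj_sym Ss yz)).
Qed.

Lemma panel_third s X Y : s \in S -> exists Z, [/\ panel s X Z, Z <> X & Z <> Y].
Proof.
move=> Ss; have [Z zx zy] := thick_avoid thickD X Y Ss; exists Z; split=> //.
  by right; apply: adj_sym.
move=> E; move: zx; rewrite E wdistxx => s1; have := gens_neq1 Ss.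
by rewrite -s1 eqxx.
Qed.

(** The form attached to J is nonzero at X and Y. *)
Definition incident J X Y : Prop := codist X Y \in <<J>>.

Lemma gen_mull J s x : J \subset S -> s \in S -> s \notin J -> x \in <<J>> ->
  s * x \notin <<J>>.
Proof.
move=> sJ Ss nJs Jx; apply: contra nJs => h; rewrite -(gen_gens sJ Ss).
have -> : s = s * x * x^-1 by rewrite mulgK.
by rewrite groupM ?groupV.
Qed.

Lemma gen_mulr J s x : J \subset S -> s \in S -> s \notin J -> x \in <<J>> ->
  x * s \notin <<J>>.
Proof.
move=> sJ Ss nJs Jx; apply: contra nJs => h; rewrite -(gen_gens sJ Ss).
have -> : s = x^-1 * (x * s) by rewrite mulKg.
by rewrite groupM ?groupV.
Qed.

Lemma incident_zero_l J s X Y : J \subset S -> s \in S -> s \notin J ->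
  exists2 Z, panel s X Z & ~ incident J Z Y.
Proof.
move=> sJ Ss nJs; have [h|h] := pselect (incident J X Y); last by exists X; [left|].
have [Z [zx E]] := codist_l_ex th X Y Ss.
exists Z; first by right; apply: adj_sym.
by rewrite /incident E; apply/negP/gen_mull.
Qed.

Lemma incident_zero_r J s X Y : J \subset S -> s \in S -> s \notin J ->
  exists2 Z, panel s X Z & ~ incident J Y Z.
Proof.
move=> sJ Ss nJs; have [h|h] := pselect (incident J Y X); last by exists X; [left|].
have [Z [zx E]] := codist_right_ex Y X Ss.
exists Z; first by right; apply: adj_sym.
by rewrite /incident E; apply/negP/gen_mulr.
Qed.

(** A panel has one chamber of longer codistance to Y, and the others all have the shorter
    one, which differs from it by s: at most one of the two values is in W_J, and if any then the
    shorter one. *)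
Lemma incident_line_l J s X X' Z Y : J \subset S -> s \in S -> s \notin J ->
  panel s X X' -> X <> X' -> panel s X Z ->
  ~ incident J X Y -> ~ incident J X' Y -> ~ incident J Z Y.
Proof.
move=> sJ Ss nJs lx nx lz nX nX' jZ.
have eq W : panel s W Z -> ~ incident J W Y ->
  wdist W Z = s /\ codist W Y = s * codist Z Y.
  move=> [->//|wz] nW; split=> //; have [//|E] := codist_l th Y Ss wz.
  by case: nW; rewrite /incident E.
have lz' : panel s X' Z by apply: panel_trans lz => //; apply: panel_sym.
have [d1 E1] := eq X lz nX; have [d2 E2] := eq X' lz' nX'.
apply: nx; apply: (codist_l_uniq pS (C := Z) (D := Y) Ss) => //.
- exact: (gen_not_ldesc sJ jZ Ss nJs).
- exact: E1.
exact: E2.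
Qed.

Lemma incident_line_r J s X X' Z Y : J \subset S -> s \in S -> s \notin J ->
  panel s X X' -> X <> X' -> panel s X Z ->
  ~ incident J Y X -> ~ incident J Y X' -> ~ incident J Y Z.
Proof.
move=> sJ Ss nJs lx nx lz nX nX' jZ.
have eq W : panel s W Z -> ~ incident J Y W ->
  wdist W Z = s /\ codist Y W = codist Y Z * s.
  move=> [->//|wz] nW; split=> //; have [//|E] := codist_right Y Ss wz.
  by case: nW; rewrite /incident E.
have lz' : panel s X' Z by apply: panel_trans lz => //; apply: panel_sym.
have [d1 E1] := eq X lz nX; have [d2 E2] := eq X' lz' nX'.
apply: nx; apply: (codist_right_uniq (C := Y) (D := Z) Ss) => //.
exact: (gen_not_rdesc sJ jZ Ss nJs).
Qed.

Lemma incident_res_l J L X X' Y : J \subset S -> L \subset J -> wdist X X' \in <<L>> ->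
  incident J X Y <-> incident J X' Y.
Proof.
move=> sJ LJ; move/(codist_res_l th Y (subset_trans LJ sJ))=> [j Lj E].
by rewrite /incident E (groupMl _ (genS_mem LJ Lj)).
Qed.

Lemma incident_res_r J L X X' Y : J \subset S -> L \subset J -> wdist X X' \in <<L>> ->
  incident J Y X <-> incident J Y X'.
Proof.
move=> sJ LJ; move/(codist_res_right Y (subset_trans LJ sJ))=> [j Lj E].
by rewrite /incident E (groupMr _ (genS_mem LJ Lj)).
Qed.

(** If X and A are perpendicular, X has displacement s u s, where u is that of A; both are
    in W_J and gen_conj_commute applies. *)
Lemma frame_displ J s A X : J \subset S -> s \in S -> s \notin J -> wdist A X = s ->
  incident J A A -> incident J X X -> ~ incident J X A \/ ~ incident J A X ->
  displ A \in <<[set t in J | s * t == t * s]>>.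
Proof.
move=> sJ Ss nJs ax jA jX nXA; have xa := adj_sym Ss ax.
have [|_ //] := @gen_conj_commute _ cox J s (displ A) sJ Ss nJs jA.
case: nXA => n.
  have [E|E] := codist_l th A Ss xa; last by case: n; rewrite /incident E.
  have [E'|E'] := codist_right X Ss xa; rewrite E in E'; first by rewrite -E'.
  by case: (negP (gen_mull sJ Ss nJs jA)); rewrite -E'.
have [E|E] := codist_right A Ss xa; last by case: n; rewrite /incident E.
have [E'|E'] := codist_l th X Ss xa; rewrite E in E'; first by rewrite -mulA -E'.
by case: (negP (gen_mulr sJ Ss nJs jA)); rewrite -E'.
Qed.


Lemma join_chambers a n X Y : path_in cox a n -> wdist X Y \in <<seg a 0 n>> ->
  wdist X Y \in <<seg a 1 n>> \/
  exists X' Y', [/\ wdist X X' \in <<seg a 1 n>>, wdist Y Y' \in <<seg a 1 n>>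
    & wdist X' Y' = a 0].
Proof.
move=> pa /(path_join pa)[|[x [y [Lx Ly E]]]]; [by left | right].
have sL : seg a 1 n \subset S by apply: seg_gens pa _.
have [X' XX' E1] := @wdist_mv_l _ _ _ (seg a 1 n) X Y x^-1 sL (groupVr Lx).
have [Y' YY' E2] := @wdist_mv_r _ _ _ (seg a 1 n) X' Y y^-1 sL (groupVr Ly).
by exists X', Y'; split=> //; rewrite E2 E1 E !mulA mulVg mul1g mulgK.
Qed.

(** * Lines of type A in a simply laced building *)

Section Cone.

Variables (I : {set gT}) (a : nat -> gT) (n : nat).
Hypothesis pa : path_in cox a n.
Hypothesis sI : I \subset S.
Hypothesis farI : forall x i, x \in I -> i < n -> x * a i = a i * x.
Hypothesis disjI : forall i, i < n -> a i \notin I.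

Local Notation J := (I :|: seg a 1 n).

Lemma sub_cone : J \subset S.
Proof. by rewrite subUset sI (seg_gens 1 pa). Qed.

Lemma apex_notin : 0 < n -> a 0 \notin J.
Proof.
move=> n0; rewrite inE (negbTE (disjI n0)) /=.
by apply/segP=> -[r [r0 rn /(path_inj pa n0 rn)]]; lia.
Qed.

(** Some plane lies in the left hyperplane of C, since a_2 a_1 a_0 is not the product of an
    element of the parabolic subgroup of a_0, a_1 by one of that of J; the right hyperplane
    of C meets this plane in a line. *)
Lemma perp_line C : 2 < n -> displ C \in <<J>> -> exists X X',
  [/\ wdist C X \in <<seg a 0 n>>, wdist X X' = a 0, perp (incident J) C X
    & perp (incident J) C X'].
Proof.
move=> n2 dC; have [lt0 lt1] : 0 < n /\ 1 < n by lia.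
have S0 := path_gens pa lt0; have S1 := path_gens pa lt1.
have nJ := apex_notin lt0; have sJ := sub_cone.
have sP := seg_gens 0 pa (leqnn n); have sL := seg_gens 1 pa (leqnn n).
have s2 : seg a 0 2 \subset S by apply: seg_gens pa _.
have s2P : seg a 0 2 \subset seg a 0 n by apply: seg_sub.
have s12 : seg a 1 2 \subset seg a 0 2 by apply: seg_sub.
have L2J : seg a 1 2 \subset J.
  by apply: subset_trans (subsetUr _ _); apply: seg_sub.
have P3 : down a 0 3 \in <<seg a 0 n>>.
  by apply: genS_mem (down_seg _ _ _); apply: seg_sub.
(* a plane all of whose points X satisfy b(X, C) = 0 *)
have [Z CZ EZ] := codist_mv_l th C C sP P3.
have plane X : wdist Z X \in <<seg a 0 2>> -> ~ incident J X C.
  move=> /(codist_res_l th C s2)[j Kj E] jX.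
  apply: (down_neq1 pa (i := 0) (m := 3)) => //.
  apply: (double_coset_trivial (cox := cox) s2 sJ (a := j^-1)
           (b := codist X C * (displ C)^-1)).
  - move=> s Ks; apply/negP=> /(down_ldesc pa (i := 0) (m := 3) n2 (subsetP s2 s Ks))[k [<-] Es].
    by move: Ks; rewrite Es => /segP[r [_ rn /(path_inj pa n2 (leq_trans rn lt1)) E2]]; move: rn; rewrite -E2.
  - move=> s Js; apply/negP=> /(down_rdesc pa (i := 0) (m := 3) n2 (subsetP sJ s Js))[_ Es].
    by move: nJ; rewrite -Es Js.
  - by rewrite groupV.
  - by rewrite groupM ?groupV.
  rewrite E EZ -/(displ C); move: (displ C) (down a 0 3) => u d.
  by rewrite !mulA mulVg mul1g mulgK.
have K0 : a 0 \in <<seg a 0 2>> by rewrite mem_gen // seg_at.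
have K1 : a 1%N \in <<seg a 0 2>> by rewrite mem_gen // seg_at.
have Kpan X Y : wdist Z X \in <<seg a 0 2>> -> panel (a 0) X Y -> wdist Z Y \in <<seg a 0 2>>.
  by move=> ZX [<-//|xy]; apply: (res_trans s2 ZX); rewrite xy.
have toC X : wdist Z X \in <<seg a 0 2>> -> wdist C X \in <<seg a 0 n>>.
  by move=> ZX; apply: (res_trans sP CZ); apply: genS_mem ZX.
have ZZ : wdist Z Z \in <<seg a 0 2>> by rewrite wdistxx group1.
have [X1 l1 n1] := incident_zero_r Z C sJ S0 nJ.
have ZX1 := Kpan _ _ ZZ l1.
have [[W [lW jW]]|allW] := pselect (exists W, panel (a 0) X1 W /\ incident J C W); last first.
  have [X [lX nX _]] := panel_third X1 X1 S0.
  have ZX := Kpan _ _ ZX1 lX.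
  exists X1, X; split; [exact: toC | | by split=> //; apply: plane |].
    by case: lX => // E; case: nX.
  by split; [exact: plane | move=> h; apply: allW; exists X].
have dW : wdist X1 W = a 0 by case: lW => // E; case: n1; rewrite E.
have [W' [wW _]] := wdist_ex W W S1; have {wW}dW' := adj_sym S1 wW.
have a01 : (a 0 == a 1%N :> gT) = false by apply/eqP=> /(path_inj pa lt0 lt1).
have dXW' : wdist X1 W' = a 0 * a 1%N.
  rewrite -dW; apply: (wdist_upr S1 dW'); rewrite dW.
  apply: (gen_not_rdesc (J := [set a 0])) => //.
  - by rewrite sub1set.
  - by rewrite mem_gen ?set11.
  by rewrite inE eq_sym a01.
have jW' : incident J C W'.
  by apply/(incident_res_r C sJ L2J _ (X := W)) => //; rewrite dW' mem_gen // seg_at.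
have [X2 l2 n2'] := incident_zero_r W' C sJ S0 nJ.
have dWX : wdist W' X2 = a 0 by case: l2 => // E; case: n2'; rewrite -E.
have ZW := Kpan _ _ ZX1 lW.
have ZW' : wdist Z W' \in <<seg a 0 2>> by apply: (res_trans s2 ZW); rewrite dW'.
have ZX2 := Kpan _ _ ZW' l2.
have dX : wdist X1 X2 \in <<seg a 0 2>>.
  by apply: (res_trans s2 _ ZX2); rewrite res_sym.
have s1 : seg a 1 2 \subset S := subset_trans s12 s2.
have n0 : a 0 \notin seg a 1 2.
  by apply/segP=> -[r [r1 rn /(path_inj pa lt0 (leq_trans rn lt1)) E0]]; move: r1; rewrite -E0.
have i1 : a 1%N \in seg a 1 2 by apply: seg_at.
have [h|[Y1 [Y2 [xy1 xy2 yy]]]] := join_chambers (path_prefix pa lt1) dX.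
  exfalso; have [E|E] := wdist_stepr X1 S0 dWX; rewrite dXW' in E; rewrite E in h.
    have := gens_conj_commute s1 S0 n0 i1 h => c.
    by have := path_noncommuting pa lt1; rewrite c eqxx.
  by case/negP: (gen_mull s1 S0 n0 (mem_gen i1)).
have ZY1 : wdist Z Y1 \in <<seg a 0 2>> by apply: (res_trans s2 ZX1); apply: genS_mem xy1.
have ZY2 : wdist Z Y2 \in <<seg a 0 2>> by apply: (res_trans s2 ZX2); apply: genS_mem xy2.
exists Y1, Y2; split=> //; [exact: toC | split; [exact: plane|] | split; [exact: plane|]].
  by move=> h; apply: n1; apply/(incident_res_r C sJ L2J xy1).
by move=> h; apply: n2'; apply/(incident_res_r C sJ L2J xy2).
Qed.


(** If no displacement is as claimed, frame_displ says that the form has no frame, and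
    perp_no_line contradicts perp_line. *)
Lemma cone C : 2 < n -> displ C \in <<J>> -> exists C', displ C' \in <<I :|: seg a 2 n>>.
Proof.
move=> n2 dC; apply: contrapT => no.
have n0 : 0 < n by lia.
have S0 := path_gens pa n0; have nJ := apex_notin n0; have sJ := sub_cone.
have sP := seg_gens 0 pa (leqnn n); have sL := seg_gens 1 pa (leqnn n).
have LJ : seg a 1 n \subset J by apply: subsetUr.
have P0 : a 0 \in <<seg a 0 n>> by rewrite mem_gen // seg_at.
have LP : seg a 1 n \subset seg a 0 n by apply: seg_sub.
pose R X := wdist C X \in <<seg a 0 n>>.
have sig_inj (X Y : {X | R X}) : sval X = sval Y -> X = Y.
  by case: X Y => X RX [Y RY] /= E; subst Y; congr exist; apply: bool_irrelevance.
have RL X Y : R X -> wdist X Y \in <<seg a 1 n>> -> R Y.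
  by move=> RX xy; apply: (res_trans sP RX); apply: genS_mem xy.
have Rpan X Y : R X -> panel (a 0) X Y -> R Y.
  by move=> RX [<-//|xy]; apply: (res_trans sP RX); rewrite xy.
have [X [X' [RX XX' pX pX']]] := perp_line n2 dC.
have RX' : R X' by apply: (Rpan X) => //; right.
have R0 : R C by rewrite /R wdistxx group1.
pose b (X Y : {X | R X}) := incident J (sval X) (sval Y).
pose line (X Y : {X | R X}) := panel (a 0) (sval X) (sval Y).
have same (Y Z : {X | R X}) : wdist (sval Y) (sval Z) \in <<seg a 1 n>> -> same_point b Y Z.
  move=> yz W; split; first exact: (incident_res_l _ sJ LJ yz).
  exact: (incident_res_r _ sJ LJ yz).
apply: (@perp_no_line _ b line _ _ _ _ _ _ _ _ _ _
  (exist _ C R0) (exist _ X RX) (exist _ X' RX')) => //=.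
- by move=> Y Z; apply: panel_sym.
- by move=> Y Z W; apply: panel_trans.
- move=> Y Z; have [W [l1 n1 n2']] := panel_third (sval Y) (sval Z) S0.
  exists (exist _ W (Rpan _ _ (svalP Y) l1)); split=> //=.
    by move=> E; apply: n1; rewrite -E.
  by move=> E; apply: n2'; rewrite -E.
- move=> Y Z; have [W l1 n1] := incident_zero_l (sval Y) (sval Z) sJ S0 nJ.
  by exists (exist _ W (Rpan _ _ (svalP Y) l1)).
- move=> Y Z; have [W l1 n1] := incident_zero_r (sval Y) (sval Z) sJ S0 nJ.
  by exists (exist _ W (Rpan _ _ (svalP Y) l1)).
- move=> Y Y' Z W l1 n1 l2; apply: (incident_line_l sJ S0 nJ l1) => //.
  by move=> E; apply: n1; apply: sig_inj.
- move=> Y Y' Z W l1 n1 l2; apply: (incident_line_r sJ S0 nJ l1) => //.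
  by move=> E; apply: n1; apply: sig_inj.
- move=> Y Z.
  have yz : wdist (sval Y) (sval Z) \in <<seg a 0 n>>.
    by apply: (res_trans sP _ (svalP Z)); rewrite res_sym; apply: (svalP Y).
  have [E|[Y' [Z' [yy zz E]]]] := join_chambers pa yz; [left; exact: same | right].
  exists (exist _ Y' (RL _ _ (svalP Y) yy)), (exist _ Z' (RL _ _ (svalP Z) zz)).
  split; [exact: same | exact: same | by right |].
  move=> /(congr1 sval) /= E'; move: E; rewrite E' wdistxx => E.
  by have := gens_neq1 S0; rewrite -E eqxx.
- move=> Y; have [j Pj E] := codist_res_right C sP (svalP Y).
  have : codist C (sval Y) \in <<seg a 0 n :|: I>>.
    rewrite E; apply: groupM; last by apply: genS_mem Pj; apply: subsetUl.
    by apply: genS_mem dC; rewrite setUC setUSS // seg_sub.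
  case/commuting_union_split=> [s x /segP[i [_ lt_in ->]] Ix|q [i [Pq Ii Eq]]].
    by rewrite farI.
  have [Z CZ EZ] := codist_mv_l th C (sval Y) sP (groupVr Pq).
  exists (exist _ Z CZ); rewrite /b /incident /= EZ Eq mulKg.
  by apply: genS_mem Ii; apply: subsetUl.
- move=> Y Z jY nYZ jZ; apply: no.
  have yz : wdist (sval Y) (sval Z) \in <<seg a 0 n>>.
    by apply: (res_trans sP _ (svalP Z)); rewrite res_sym; apply: (svalP Y).
  have [E|[Y' [Z' [yy zz E]]]] := join_chambers pa yz.
    by case: nYZ; case; [apply/((same _ _ E) Y).1 | apply/((same _ _ E) Y).2].
  have jY' : incident J Y' Y'.
    apply/(incident_res_l _ sJ LJ yy); exact/(incident_res_r _ sJ LJ yy).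
  have jZ' : incident J Z' Z'.
    apply/(incident_res_l _ sJ LJ zz); exact/(incident_res_r _ sJ LJ zz).
  exists Y'; apply: genS_mem (frame_displ sJ S0 nJ E jY' jZ' _).
    apply/subsetP=> x; rewrite inE => /andP[/setUP[Ix|/segP[r [r1 rn ->]]] c].
      by apply/setUP; left.
    apply/setUP; right; apply: seg_at => //; case: r r1 rn c => // -[_ lt|//].
    by rewrite (negbTE (path_noncommuting pa lt)).
  case: nYZ => h0; [left | right] => h; apply: h0.
    apply/(incident_res_l _ sJ LJ zz); exact/(incident_res_r _ sJ LJ yy).
  apply/(incident_res_l _ sJ LJ yy); exact/(incident_res_r _ sJ LJ zz).
- by right.
- move=> /(congr1 sval) /= E; move: XX'; rewrite E wdistxx => E'.
  by have := gens_neq1 S0; rewrite -E' eqxx.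
Qed.

(** A neighbour Z of C of longer codistance has displacement z s k or z s k s, where s is
    a_0 and k is a_1 and z commutes with both; each of the two can be shortened to z s. *)
Lemma slide C : n = 2 -> displ C \in <<I :|: [set a 1%N]>> ->
  exists C', displ C' \in <<I :|: [set a 0]>>.
Proof.
move=> n2 dC; have [lt0 lt1] : 0 < n /\ 1 < n by rewrite n2.
have S0 := path_gens pa lt0; have S1 := path_gens pa lt1.
have noncomm := path_noncommuting pa lt1; have br := path_braid pa lt1.
have [s x Is /set1P ->|z [q [Iz /gen1 q1 E]]] := commuting_union_split _ dC.
  by rewrite farI.
have zc i : i < n -> z * a i = a i * z.
  move=> lt; clear E; elim/gen_indl: z / Iz => [|s z Is _ IH]; first by rewrite mul1g mulg1.
  by rewrite -mulA IH !mulA farI.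
have [q0|q0] := q1 _ _ (erefl _) S1.
  by exists C; rewrite E q0 mulg1; apply: genS_mem Iz; apply: subsetUl.
have sK : seg a 0 n \subset S by apply: seg_gens pa _.
have lenz y : y \in <<seg a 0 n>> -> len (z * y) = (len z + len y)%N.
  move=> Ky; apply: (lenD_no_ldesc sI _ Iz) => s Is.
  apply: (gen_not_ldesc sK Ky (subsetP sI s Is)).
  by apply/segP=> -[r [_ rn Er]]; have := disjI rn; rewrite -Er Is.
have zrdesc y i : y \in <<seg a 0 n>> -> i < n -> rdesc (z * y) (a i) = rdesc y (a i).
  move=> Ky lt; have Si := path_gens pa lt.
  by rewrite !rdescP // -mulA !lenz ?ltn_add2l // groupM // mem_gen // seg_at.
have zldesc y i : y \in <<seg a 0 n>> -> i < n -> ldesc (z * y) (a i) = ldesc y (a i).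
  move=> Ky lt; have Si := path_gens pa lt.
  by rewrite !ldescP // mulA -zc // -mulA !lenz ?ltn_add2l // groupM // mem_gen // seg_at.
have K0 : a 0 \in <<seg a 0 n>> by rewrite mem_gen // seg_at.
have K1 : a 1%N \in <<seg a 0 n>> by rewrite mem_gen // seg_at.
have up2 : up a 0 2 = a 0 * a 1%N by rewrite !upS up0 mulg1.
have uniq s : s \in S -> rdesc (a 0 * a 1%N) s -> s = a 1%N.
  by rewrite -up2 => Ss /(up_rdesc pa _ Ss)[|k [<-] ->] //; rewrite n2.
have uniql s : s \in S -> ldesc (a 0 * a 1%N) s -> s = a 0.
  by rewrite -up2 => Ss /(up_ldesc pa _ Ss)[|_ ->] //; rewrite n2.
have [Z [zC EZ]] := codist_l_ex th C C S0.
have {}EZ : codist Z C = z * (a 0 * a 1%N).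
  by rewrite EZ -/(displ C) E q0 !mulA -zc.
have a01 : (a 0 == a 1%N :> gT) = false by apply/eqP=> /(path_inj pa lt0 lt1).
have rd1 : rdesc (a 0 * a 1%N) (a 1%N).
  rewrite rdesc_mul //; apply/negP=> h.
  have := gen_not_rdesc (J := [set a 0]) _ _ S1; rewrite sub1set inE eq_sym a01.
  by move=> /(_ (a 0) S0 (mem_gen (set11 _)) isT); rewrite h.
have nld1 : ~~ ldesc (a 0 * a 1%N) (a 1%N).
  by apply/negP=> /(uniql _ S1)/eqP; rewrite eq_sym a01.
have K01 : a 0 * a 1%N \in <<seg a 0 n>> by rewrite groupM.
have Ez : z * (a 0 * a 1%N) * a 1%N = z * a 0 by rewrite -!mulA (gensK S1) mulg1.
have Iza : z * a 0 \in <<I :|: [set a 0]>>.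
  by rewrite groupM ?(genS_mem (subsetUl _ _) Iz) // mem_gen // !inE eqxx orbT.
have t1 := twist_id S1.
have [EZZ|EZZ] := codist_right Z S0 zC; rewrite EZ in EZZ; last first.
  have [||C' _ E'] := displ_drop_r pS th_adj thickD (C := Z) S1.
  - by rewrite /displ EZZ zldesc.
  - by rewrite t1 /displ EZZ zrdesc.
  by exists C'; rewrite E' t1 /displ EZZ Ez.
have EZ1 : displ Z = z * (a 1%N * (a 0 * a 1%N)).
  by rewrite /displ EZZ -(mulA z) br -(mulA (a 1%N)).
have Ed : a 1%N * displ Z = z * (a 0 * a 1%N).
  by rewrite EZ1 mulA -zc // -mulA (mulA (a 1%N) (a 1%N)) (gensK S1) mul1g.
have [C' [cc _]] := codist_l_ex th Z Z S1.
have := displ_down pS th_adj (C := Z) (C' := C') S1 cc.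
rewrite t1 Ed zrdesc // rd1 Ez EZ1 zldesc ?groupM // ldesc_mul // nld1.
by move=> /(_ isT isT) E'; exists C'; rewrite E'.
Qed.

End Cone.

(** Repeated cones reach the last nodes of the path, and slides lead back from there. *)
Lemma path_displ I a n C : path_in cox a n -> I \subset S -> 1 < n ->
  (forall x i, x \in I -> i < n -> x * a i = a i * x) ->
  (forall i, i < n -> a i \notin I) ->
  displ C \in <<I :|: seg a 1 n>> ->
  forall i, i < n -> exists C', displ C' \in <<I :|: [set a i]>>.
Proof.
elim: n a C => // n IH a C pa sI n1 farI disjI dC.
have slide01 C1 : displ C1 \in <<I :|: [set a 1%N]>> ->
    exists C', displ C' \in <<I :|: [set a 0]>>.
  apply: (slide (path_prefix pa n1)) => // [x i Ix i2|i i2].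
    by apply: farI => //; apply: leq_trans n1.
  by apply: disjI; apply: leq_trans n1.
have all1 (i : nat) : 0 < i -> i < n.+1 -> exists C', displ C' \in <<I :|: [set a i]>>.
  move=> i0 lt_in; have [n2|lt1n] := leqP n 1.
    exists C; apply: genS_mem dC; apply: setUS; apply/subsetP=> x /segP[r [r1 rn ->]].
    by rewrite inE; apply/eqP; congr a; lia.
  have [C1 dC1] := cone pa sI farI disjI (C := C) lt1n dC.
  have seg1 : seg (fun r : nat => a (1 + r)%N) 1 n = seg a 2 n.+1 by rewrite seg_shift.
  have lt : i.-1 < n by lia.
  have [|||C' dC'] := IH _ C1 (path_shift (i := 1) pa (leqnn _)) sI lt1n _ _ _ _ lt.
  - by move=> x j Ix jn; apply: farI.
  - by move=> j jn; apply: disjI.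
  - by rewrite seg1.
  by exists C'; move: dC'; rewrite add1n prednK.
case=> [_|i lt]; last exact: all1.
by have [|C1] := all1 1%N isT; [exact: n1 | exact: slide01].
Qed.

End CodistancePanels.

(** * Forked diagrams with one short branch *)

Section Fork.

Variables (gT : finGroupType) (cox : coxeter_system gT).
Local Notation S := (gens cox).
Local Notation len := (cox_length cox).
Local Notation "x * y" := (@mul gT x y) : group_scope.
Local Notation ldesc := (ldesc cox).
Local Notation rdesc := (rdesc cox).

Implicit Types (s x y z w : gT) (i j r t : nat) (I J K L : {set gT}).

Lemma gen_commute J x w : (forall s, s \in J -> x * s = s * x) -> w \in <<J>> ->
  x * w = w * x.
Proof.
move=> comm; elim/gen_indl: w / => [|s w Js _ IH]; first by rewrite mul1g mulg1.
by rewrite mulA (comm s) // -!mulA IH.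
Qed.

Lemma path_normal_form_l a n c : path_in cox a n -> c \in <<seg a 0 n>> ->
  exists i q, [/\ i <= n, q \in <<seg a 1 n>> & c = down a 0 i * q].
Proof.
move=> pa; elim/gen_indl: c / => [|s c /segP[t [_ tn ->]] _ [i [q [in_ Lq ->]]]].
  by exists 0, 1; rewrite down0 mulg1 group1.
have St := path_gens pa tn.
have [ti|it|E] := ltngtP t i; last first.
- exists i.+1, q; rewrite -E in in_ Lq *; split=> //.
  by rewrite (downS pa) // add0n mulA.
- exists i, (a t * q); split=> //.
    by rewrite groupM // mem_gen // seg_at // (leq_trans _ it).
  by rewrite mulA -(far_down pa) // -mulA.
have [E|neq] := eqVneq t.+1 i.
  exists t, q; rewrite -E; split=> //; first exact: ltnW.
  by rewrite (downS pa) // add0n !mulA (gensK St) mul1g.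
exists i, (a t.+1 * q); split=> //.
  by rewrite groupM // mem_gen // seg_at //; lia.
by rewrite mulA -(down_shift pa (x := t.+1)) -?mulA //; lia.
Qed.

Variables (a : nat -> gT) (m : nat) (k : gT).
Local Notation N := m.+2.
Hypothesis pa : path_in cox a N.
Hypothesis Sk : k \in S.
Hypothesis k_new : forall i, i < N -> k <> a i.
Hypothesis k_far : forall i, i < N -> i != m -> k * a i = a i * k.
Hypothesis k_braid : k * a m * k = a m * k * a m.
Hypothesis SE : S = k |: seg a 0 N.

(** The other maximal path, ending in k. *)
Definition other_arm i := if i == m.+1 then k else a i.
Local Notation other := other_arm.

Lemma other_path : path_in cox other N.
Proof.
split=> [i iN|i j iN jN|i iN|i j ij jN].
- by rewrite /other; case: eqP => // _; apply: (path_gens pa).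
- rewrite /other; case: eqP => [->|_]; case: eqP => [->|_] //.
  + by move=> E; case: (k_new jN).
  + by move=> E; case: (k_new iN).
  + exact: (path_inj pa).
- rewrite /other_arm ltn_eqF //; case: eqP => [[->]|_]; first by rewrite k_braid.
  exact: (path_braid pa).
rewrite /other_arm (@ltn_eqF i); last by lia.
case: eqP => [E|_]; last exact: (path_far pa).
by rewrite k_far //; lia.
Qed.

Lemma other_seg i j : j <= m.+1 -> seg other i j = seg a i j.
Proof.
move=> jm; apply/setP=> x; apply/segP/segP=> -[t [it tj ->]]; exists t; split=> //;
  by rewrite /other_arm ltn_eqF // (leq_trans tj).
Qed.

Lemma other_up i j : i + j <= m.+1 -> up other i j = up a i j.
Proof.
elim: j i => [|j IH] i ij; first by rewrite !up0.
by rewrite !upS IH ?addSnnS // /other_arm ltn_eqF // (leq_trans _ ij) // addnS ltnS leq_addr.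
Qed.

(** The type of the residues that serve as points of the polar space: all nodes but a_0. *)
Definition hub := k |: seg a 1 N.

Lemma hub_sub : hub \subset S.
Proof. by rewrite subUset sub1set Sk (seg_gens 1 pa). Qed.

Lemma other_sub_hub : seg other 1 N \subset hub.
Proof.
apply/subsetP=> x /segP[t [t1 tN ->]]; rewrite /other; case: eqP => _.
  by rewrite !inE eqxx.
by rewrite inE seg_at // orbT.
Qed.

(** A maximal subspace and a point always have a maximal subspace of the other
    family adjacent to the first and through the second. *)
Lemma fork_cosets w : exists x y z,
  [/\ x \in <<seg a 0 N>>, y \in <<seg other 0 N>>, z \in <<hub>> & w = x * y * z].
Proof.
pose d := down a 0 m.+1; pose P := seg a 0 N.
have Sm : a m \in S by apply: (path_gens pa).
have Se : a m.+1 \in S by apply: (path_gens pa).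
have Qk : k \in <<hub>> by rewrite mem_gen // !inE eqxx.
have Qseg i : 0 < i -> i < N -> a i \in <<hub>>.
  by move=> i0 iN; rewrite mem_gen // inE seg_at ?orbT.
have QL q : q \in <<seg a 1 N>> -> q \in <<hub>>.
  by apply: genS_mem; apply: subsetUr.
have Pseg i j : i <= j -> j <= N -> down a i (j - i) \in <<P>>.
  by move=> ij jN; apply: genS_mem (down_seg _ _ _); apply: seg_sub; lia.
have Pa i : i < N -> a i \in <<P>> by move=> iN; rewrite mem_gen // seg_at.
have Pd : d \in <<P>> by apply: (Pseg 0 m.+1).
have Od : d \in <<seg other 0 N>>.
  by apply: genS_mem (down_seg _ _ _); rewrite -(other_seg 0) // seg_sub.
have Ok : k \in <<seg other 0 N>>.
  have -> : k = other m.+1 by rewrite /other_arm eqxx.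
  by rewrite mem_gen // seg_at.
have comm j : j <= m -> k * down a 0 j = down a 0 j * k.
  move=> jm; apply: (gen_commute _ (down_seg _ _ _)) => s /segP[t [_ tj ->]].
  by apply: k_far; lia.
have ke : k * a m.+1 = a m.+1 * k by rewrite k_far // gtn_eqF.
have EdN : down a 0 N = a m.+1 * d by rewrite (downS pa).
have Ed : d = a m * down a 0 m by rewrite /d (downS pa).
have absorb x : x \in <<seg a 0 m.+1>> -> exists2 q, q \in <<hub>> & x * (k * d) = k * d * q.
  elim/gen_indl: x / => [|s x /segP[t [_ tm ->]] _ [q Qq E]].
    by exists 1; rewrite ?mul1g ?mulg1 ?group1.
  have [->|neq] := eqVneq t m.
    exists (k * q); first exact: groupM.
    rewrite -mulA E Ed; move: (comm m (leqnn m)) => c.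
    have -> : a m * (k * (a m * down a 0 m) * q) = (a m * k * a m) * down a 0 m * q.
      by rewrite !mulA.
    by rewrite -k_braid -!mulA (mulA k (down a 0 m)) c !mulA.
  exists (a t.+1 * q); first by rewrite groupM // Qseg //; lia.
  have sh : a t * d = d * a t.+1 by rewrite (down_shift pa (x := t.+1)) //; lia.
  have c : k * a t = a t * k by apply: k_far => //; lia.
  by rewrite -mulA E !mulA -c -(mulA k) sh !mulA.
(* two double cosets cover the group, and both meet the other maximal path *)
suff [[x [z [Px Qz ->]]]|[x [z [Px Qz ->]]]] :
    (exists x z, [/\ x \in <<P>>, z \in <<hub>> & w = x * z]) \/
    (exists x z, [/\ x \in <<P>>, z \in <<hub>> & w = x * (k * d) * z]).
- by exists x, 1, z; rewrite mulg1 group1.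
- by exists x, (k * d), z; rewrite (groupM Ok Od).
have Sw : w \in <<S>> by rewrite gens_generate inE.
elim/gen_indl: w / Sw => [|s w Ss _].
  by left; exists 1, 1; rewrite mulg1 !group1.
have [Ps|->] : s \in P \/ s = k.
- by move: Ss; rewrite SE => /setU1P[->|h]; [right | left].
- by case=> -[x [z [Px Qz ->]]]; [left | right]; exists (s * x), z;
    rewrite !mulA groupM // mem_gen.
case=> -[x [z [Px Qz ->]]].
- have [i [q [iN /QL Qq ->]]] := path_normal_form_l pa Px.
  have Qqz : q * z \in <<hub>> by rewrite groupM.
  have [im|im] := leqP i m.
    left; exists (down a 0 i), (k * (q * z)); split; [|by rewrite groupM|].
      by have := Pseg 0 i (leq0n _) iN; rewrite subn0.
    by rewrite -mulA !mulA comm.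
  right; have [E|neq] := eqVneq i m.+1.
    by exists 1, (q * z); rewrite group1 E mul1g !mulA.
  have -> : i = N by apply: anti_leq; rewrite iN /= ltn_neqAle eq_sym neq.
  by exists (a m.+1), (q * z); split; rewrite ?Pa // EdN !mulA ke.
have Px' : x^-1 \in <<P>> by rewrite groupV.
have [j [x' [jN Hx Ex]]] := path_normal_form pa Px'.
have Hx' : x'^-1 \in <<seg a 0 m.+1>> by rewrite groupV.
have [q Qq Eq] := absorb _ Hx'.
have {}Ex : x * (k * d) * z = up a j (N - j) * (k * d) * (q * z).
  have -> : x = up a j (N - j) * x'^-1.
    by rewrite -[x]invgK Ex invM /down invgK.
  by rewrite -(mulA _ x'^-1) Eq !mulA.
have Qqz : q * z \in <<hub>> by rewrite groupM.
rewrite Ex; have [jm|jm] := leqP j m; last first.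
  left; have [->|neq] := eqVneq j N.
    by exists d, (q * z); split=> //; rewrite subnn up0 mul1g !mulA (gensK Sk) mul1g.
  have -> : j = m.+1 by apply: anti_leq; rewrite jm andbT -ltnS ltn_neqAle neq.
  exists (a m.+1 * d), (q * z); split; [exact: groupM (Pa _ (ltnSn _)) Pd | by [] |].
  rewrite subSnn upS up0 mulg1 !mulA; congr (_ * _ * _ * _).
  by rewrite ke -mulA (gensK Sk) mulg1.
right; exists (up a j (N - j)), (a m.+1 * (q * z)); split.
- by rewrite -groupV; apply: (Pseg j N).
- by rewrite groupM // Qseg.
rewrite -addn2 -addnBAC // addn2 !upSr addnS subnKC //.
have c1 : k * up a j (m - j) = up a j (m - j) * k.
  apply: (gen_commute _ (up_seg _ _ _)) => ? /segP[t [_ tj ->]].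
  have lt : t < m by rewrite -(subnKC jm).
  by apply: k_far; [apply: ltn_trans lt (leqnSn _) | rewrite ltn_eqF].
have sh : a m * (a m.+1 * d) = a m.+1 * d * a m.+1.
  by rewrite -EdN (down_shift pa (x := m.+1)).
set U := up a j (m - j) in c1 *; set e := a m.+1 in sh ke *.
have -> : k * (U * a m * e * (k * d) * (q * z)) = U * (k * a m * (e * k) * d) * (q * z).
  by rewrite !mulA c1.
rewrite -ke -!(mulA U); congr (U * _); rewrite !mulA k_braid.
have -> : a m * k * a m * e * d = a m * k * (a m * (e * d)) by rewrite !mulA.
by rewrite sh !mulA -(mulA (a m) k e) ke !mulA.
Qed.

End Fork.

Section ForkDisplacement.

Variables (gT : finGroupType) (cox : coxeter_system gT) (Delta : building cox).
Local Notation S := (gens cox).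
Local Notation "x * y" := (@mul gT x y) : group_scope.
Local Notation ldesc := (ldesc cox).
Local Notation rdesc := (rdesc cox).

Variables (th : chamber Delta -> chamber Delta) (p : {perm gT}).
Hypothesis pS : perm_on S p.
Hypothesis th_adj : forall C D s, s \in S ->
  wdist C D = s <-> wdist (th C) (th D) = p s.
Hypothesis th_surj : forall D', exists D, th D = D'.
Hypothesis thickD : thick Delta.
Hypothesis twist_id : forall s, s \in S -> twist cox p s = s.

Implicit Types (s x y z : gT) (I J K L : {set gT}) (A B C D E X Y Z : chamber Delta).
Implicit Types (i j r t n : nat).

Local Notation codist := (codist th).
Local Notation displ := (displ th).
Local Notation incident := (incident th).

Lemma displ_res J C C' : J \subset S -> displ C \in <<J>> -> wdist C C' \in <<J>> ->
  displ C' \in <<J>>.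
Proof.
move=> sJ dC cc; have [j Jj E] := codist_res_l th C' sJ cc.
have [j' Jj' E'] := codist_res_right pS th_adj twist_id C sJ cc.
by rewrite /displ E E'; do 2 apply: groupM => //.
Qed.

Lemma line_meets (a : nat -> gT) n D X : path_in cox a n -> 0 < n ->
  wdist D X \in <<seg a 0 n>> -> exists X1 X2,
  [/\ panel (a 0) X X1, wdist X1 X2 \in <<seg a 1 n>> & wdist D X2 \in <<seg a 0 n.-1>>].
Proof.
move=> pa n0 /(path_line_meets pa n0)[e [x [y [De Hx Ly E]]]].
have sL : seg a 1 n \subset S by apply: seg_gens pa _.
have [X1 l1 E1] : exists2 X1, panel (a 0) X X1 & wdist D X1 = x * y.
  case: De => De; rewrite De in E; first by exists X; [left | rewrite -E mulg1].
  have [X1 [d1 E1]] := wdist_exr D X (path_gens pa n0).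
  by exists X1; [right | rewrite E1].
have [X2 l2 E2] := @wdist_mv_r _ _ _ (seg a 1 n) D X1 y^-1 sL (groupVr Ly).
by exists X1, X2; split=> //; rewrite E2 E1 mulgK.
Qed.

Variables (a : nat -> gT) (m : nat) (k : gT).
Local Notation N := m.+2.
Hypothesis pa : path_in cox a N.
Hypothesis Sk : k \in S.
Hypothesis k_new : forall i, i < N -> k <> a i.
Hypothesis k_far : forall i, i < N -> i != m -> k * a i = a i * k.
Hypothesis k_braid : k * a m * k = a m * k * a m.
Hypothesis SE : S = k |: seg a 0 N.

Local Notation other := (other_arm a m k).
Local Notation hub := (hub a m k).

(** Suppose not. Points of the maximal subspace of a chamber with displacement in the
    parabolic subgroup of the path are then isotropic, so that the form is alternating, hence
    reflexive, there. By fork_cosets, some chamber D0 of such a subspace and an anisotropic point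
    p lie in a common maximal subspace U of the other family, and the displacement of D0 can
    be taken to be e z, where e is the end of the path and z commutes with it. The hyperplane at
    D0 then has a radical point M, which is perpendicular to all of U on both sides. So on the
    line p M only M is isotropic. The chamber next to D0 across k with longer codistance has
    displacement e z as well, so its hyperplane of U is isotropic too and must meet the line p M
    in M; but codistances show that M is not in this hyperplane. *)
Lemma fork_displ Cv Cp : displ Cv \in <<seg a 0 N>> -> displ Cp \in <<hub>> ->
  exists C, displ C \in <<seg a 1 N>> \/ displ C \in <<seg a 0 m.+1>>.
Proof.
move=> dv dp; apply: contrapT => no.
have pa1 : path_in cox a m.+1 := path_prefix pa (leqnSn _).
have po : path_in cox other N := other_path pa Sk k_new k_far k_braid.
have sP : seg a 0 N \subset S := seg_gens 0 pa (leqnn _).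
have sO : seg other 0 N \subset S := seg_gens 0 po (leqnn _).
have sH : seg a 0 m.+1 \subset S := seg_gens 0 pa (leqnSn _).
have sQ : hub \subset S := hub_sub pa Sk.
have sZ : seg a 0 m \subset S := seg_gens 0 pa (leqW (leqnSn _)).
have HP : seg a 0 m.+1 \subset seg a 0 N by apply: seg_sub.
have ZH : seg a 0 m \subset seg a 0 m.+1 by apply: seg_sub.
have OH : seg other 0 m.+1 = seg a 0 m.+1 by apply: other_seg.
have HO : seg a 0 m.+1 \subset seg other 0 N by rewrite -OH seg_sub.
have L1Q : seg a 1 m.+1 \subset hub.
  by apply: subset_trans (subsetUr _ _); apply: seg_sub.
have LOQ : seg other 1 N \subset hub by apply: other_sub_hub.
have S0 : a 0 \in S := path_gens pa (ltn0Sn _).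
have Se : a m.+1 \in S := path_gens pa (ltnSn _).
have nQ0 : a 0 \notin hub.
  apply/setU1P=> -[/esym|/segP[r [r1 rN E]]]; first exact: k_new.
  by have E0 := path_inj pa (ltn0Sn _) rN E; move: r1; rewrite -E0.
have nPk : k \notin seg a 0 N by apply/segP=> -[r [_ rN]]; apply: k_new.
have nOe : a m.+1 \notin seg other 0 N.
  apply/segP=> -[r [_ rN]]; rewrite /other_arm; case: eqP => [_ /esym|nr E].
    exact: k_new.
  by apply: nr; rewrite (path_inj pa (ltnSn _) rN E).
have Qe : a m.+1 \in <<hub>> by rewrite mem_gen // inE seg_at ?orbT.
(* otherwise the form is alternating on a maximal subspace opposite its image *)
have iso D X : displ D \in <<seg a 0 N>> -> wdist D X \in <<seg a 0 N>> ->
    ~ incident hub X X.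
  move=> dD DX iX; apply: no; exists X; left.
  have dX : displ X \in <<seg a 0 N>> := displ_res sP dD DX.
  have : displ X \in <<seg a 0 N :&: hub>> by apply: (genI sP sQ).
  apply: genS_mem; apply/subsetP=> x /setIP[Px /setU1P[E|//]].
  by move: nPk; rewrite -E Px.
(* bring the two given chambers into one residue of the other maximal path *)
have [x [y [z [Px Oy Qz Exyz]]]] := fork_cosets pa Sk k_far k_braid SE (wdist Cv Cp).
have [Cv1 v1 E1] := @wdist_mv_l _ _ _ (seg a 0 N) Cv Cp x^-1 sP (groupVr Px).
have [Cp1 p1 E2] := @wdist_mv_r _ _ _ hub Cv1 Cp z^-1 sQ (groupVr Qz).
have {}E2 : wdist Cv1 Cp1 = y by rewrite E2 E1 Exyz !mulA mulVg mul1g mulgK.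
have dv1 : displ Cv1 \in <<seg a 0 N>> := displ_res sP dv v1.
have dp1 : displ Cp1 \in <<hub>> := displ_res sQ dp p1.
have [D0 vD minD] := displ_minimal pS th_adj th_surj thickD Cv1 sH.
have dD : displ D0 \in <<seg a 0 N>> by apply: (displ_res sP dv1); apply: genS_mem vD.
have PD : wdist D0 D0 \in <<seg a 0 N>> by rewrite wdistxx group1.
have [z0 [Zz Euz Eze]] : exists z0, [/\ z0 \in <<seg a 0 m>>,
    displ D0 = a m.+1 * z0 & displ D0 = z0 * a m.+1].
  have [|h|[z0 [Zz E3 E4]]] := path_end_split pa (ltn0Sn _) dD.
  - move=> j lt dj; have Sj : a j \in S := path_gens pa (leqW lt).
    by have := minD (a j) (seg_at _ (leq0n j) lt); rewrite (twist_id Sj) => /(_ dj)[].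
  - by case: no; exists D0; right.
  by exists z0; move: Zz; rewrite subn2.
set u := displ D0 in dD Euz Eze.
have Hu1 : up a 0 m.+1 \in <<seg a 0 m.+1>> by apply: up_seg.
have Hd1 : down a 0 m.+1 \in <<seg a 0 m.+1>> by apply: down_seg.
have Oz : z0 \in <<seg other 0 N>> by apply: genS_mem Zz; apply: subset_trans HO.
(* M spans the left radical, M' the right radical of the hyperplane at D0 *)
have [M DM EM] := codist_mv_l th D0 D0 sH Hu1.
have [M' DM' EM'] := codist_mv_right pS th_adj th_surj twist_id D0 D0 sH Hd1.
rewrite -/(displ D0) -/u in EM EM'.
have upN : up a 0 m.+1 * a m.+1 = up a 0 N by rewrite [RHS]upSr.
have downN : a m.+1 * down a 0 m.+1 = down a 0 N by rewrite [RHS](downS pa).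
have upl s : s \in hub -> ~~ ldesc (up a 0 N) s.
  move=> Qs; apply/negP=> /(up_ldesc pa (i := 0) (m := N) (leqnn _) (subsetP sQ s Qs))[_ Es].
  by move: nQ0; rewrite -Es Qs.
have upr s : s \in seg other 0 N -> ~~ rdesc (up a 0 N) s.
  move=> Os; apply/negP=> /(up_rdesc pa (i := 0) (m := N) (leqnn _) (subsetP sO s Os)).
  by case=> r [<-] Es; move: nOe; rewrite -Es Os.
have upN1 : up a 0 N <> 1.
  by move=> E; apply: (down_neq1 pa (i := 0) (m := N)) => //; rewrite /down E invg1.
have radL Y : wdist D0 Y \in <<seg other 0 N>> -> ~ incident hub M Y.
  move=> /(codist_res_right pS th_adj twist_id M sO)[j Oj E] iY; apply: upN1.
  have Ozj : (z0 * j)^-1 \in <<seg other 0 N>> by rewrite groupV groupM.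
  apply: (double_coset_trivial sQ sO upl upr iY Ozj).
  by rewrite E EM Euz -upN; move: (up a 0 m.+1) => U; rewrite !invM !mulA !mulgK.
have radR Y : wdist D0 Y \in <<seg other 0 N>> -> ~ incident hub Y M'.
  move=> /(codist_res_l th M' sO)[j Oj E] iY; apply: upN1.
  have iY' : (codist Y M')^-1 \in <<hub>> by rewrite groupV.
  apply: (double_coset_trivial sQ sO upl upr iY' (groupM Oj Oz)).
  rewrite E EM' Eze -(mulA z0) downN /down; move: (up a 0 N) => U.
  by rewrite !invM invgK -!mulA mulKg mulVg mulg1.
have toP X : wdist D0 X \in <<seg a 0 m.+1>> -> wdist D0 X \in <<seg a 0 N>>.
  exact: genS_mem.
have toO X : wdist D0 X \in <<seg a 0 m.+1>> -> wdist D0 X \in <<seg other 0 N>>.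
  exact: genS_mem.
have isoH X : wdist D0 X \in <<seg a 0 m.+1>> -> ~ incident hub X X.
  by move=> /toP; apply: iso.
have Hjoin X Y : wdist D0 X \in <<seg a 0 m.+1>> -> wdist D0 Y \in <<seg a 0 m.+1>> ->
    wdist X Y \in <<seg a 0 m.+1>>.
  by move=> DX; apply: (res_trans sH); rewrite res_sym.
have H1 X Y : wdist D0 X \in <<seg a 0 m.+1>> -> wdist X Y \in <<seg a 1 m.+1>> ->
    wdist D0 Y \in <<seg a 0 m.+1>>.
  by move=> DX XY; apply: (res_trans sH DX); apply: genS_mem XY; apply: seg_sub.
have Hpan X Y : wdist D0 X \in <<seg a 0 m.+1>> -> panel (a 0) X Y ->
    wdist D0 Y \in <<seg a 0 m.+1>>.
  move=> DX [<-//|XY]; apply: (res_trans sH DX).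
  by rewrite XY mem_gen // seg_at.
have psym X Y : panel (a 0) X Y -> panel (a 0) Y X by apply: panel_sym.
have ptrans X Y Z : panel (a 0) X Y -> panel (a 0) Y Z -> panel (a 0) X Z.
  exact: panel_trans.
have pthird X Y := panel_third thickD X Y S0.
have pl X X' Z Y := @incident_line_l _ _ _ th p pS hub (a 0) X X' Z Y sQ S0 nQ0.
have pr X X' Z Y := @incident_line_r _ _ _ th p pS th_adj twist_id hub (a 0) X X' Z Y sQ S0 nQ0.
have refl X Y : wdist D0 X \in <<seg a 0 m.+1>> -> wdist D0 Y \in <<seg a 0 m.+1>> ->
    ~ incident hub X Y -> ~ incident hub Y X.
  move=> DX DY nXY; have [XY|[X' [Y' [XX YY XY]]]] := join_chambers pa1 (Hjoin X Y DX DY).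
    by move=> h; apply: (isoH _ DX); apply/(incident_res_l th X sQ L1Q XY).
  have [DX' DY'] : wdist D0 X' \in <<seg a 0 m.+1>> /\ wdist D0 Y' \in <<seg a 0 m.+1>>.
    by split; [apply: H1 XX | apply: H1 YY].
  have nXY' : ~ incident hub X' Y'.
    move=> h; apply: nXY; apply/(incident_res_l th Y sQ L1Q XX).
    exact/(incident_res_r pS th_adj twist_id X' sQ L1Q YY).
  have nYX' : ~ incident hub Y' X'.
    apply: (isotropic_line_reflexive (b := incident hub) psym ptrans pthird pl pr) nXY'.
    - by right.
    - by move=> E; have := gens_neq1 S0; rewrite -XY E wdistxx eqxx.
    - by move=> Z l; apply: isoH; apply: Hpan l.
  move=> h; apply: nYX'; apply/(incident_res_l th X' sQ L1Q YY).
  exact/(incident_res_r pS th_adj twist_id Y sQ L1Q XX).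
have MM : wdist M M' \in <<seg a 1 m.+1>>.
  have [//|[M1 [M2 [M1M M2M l12]]]] := join_chambers pa1 (Hjoin _ _ DM DM').
  exfalso.
  have DM1 := H1 _ _ DM M1M; have DM2 := H1 _ _ DM' M2M.
  have neq : M1 <> M2 by move=> E; have := gens_neq1 S0; rewrite -l12 E wdistxx eqxx.
  (* the line through both would meet a complement on which the form is nondegenerate *)
  have [T1 [T2 [l1 TT DT]]] := line_meets pa1 (ltn0Sn _) DM1.
  have [j Zj ET] := codist_res_l th D0 sZ DT.
  have Zjz : (j * z0)^-1 \in <<seg a 0 m>> by rewrite groupV groupM.
  have [Y DY EY] := codist_mv_right pS th_adj th_surj twist_id T2 D0 sZ Zjz.
  have {}DY : wdist D0 Y \in <<seg a 0 m.+1>> by apply: genS_mem DY.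
  have je : a m.+1 * j = j * a m.+1.
    apply: (gen_commute _ Zj) => s /segP[r [_ rm ->]]; apply/esym/(path_far pa) => //.
  have iT2 : incident hub T2 Y.
    rewrite /incident EY ET -/(displ D0) -/u Euz mulA -je -(mulA (a m.+1)) mulgK.
    exact: Qe.
  have iT1 : incident hub T1 Y by apply/(incident_res_l th Y sQ L1Q TT).
  move: iT1; apply: (pl M1 M2 T1 Y) => //; first by right.
    by move=> h; apply: (radL Y (toO _ DY)); apply/(incident_res_l th Y sQ L1Q M1M).
  move=> h; have nY : ~ incident hub M' Y by apply: refl => //; apply: radR; apply: toO.
  by apply: nY; apply/(incident_res_l th Y sQ L1Q M2M).
have radR' Y : wdist D0 Y \in <<seg other 0 N>> -> ~ incident hub Y M.
  by move=> /radR h iY; apply: h; apply/(incident_res_r pS th_adj twist_id Y sQ L1Q MM).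
have radM Y := radL Y; have {}radL := radM.
have DCp : wdist D0 Cp1 \in <<seg other 0 N>>.
  apply: (res_trans sO (_ : wdist D0 Cv1 \in _)); last by rewrite E2.
  by rewrite res_sym; apply: genS_mem vD.
have CpM : wdist Cp1 M \in <<seg other 0 N>>.
  by apply: (res_trans sO _ (toO _ DM)); rewrite res_sym.
have [CM|[P1 [M1 [CpP MM1 l1]]]] := join_chambers po CpM.
  by apply: (radL _ DCp); apply/(incident_res_l th Cp1 sQ LOQ CM).
have DP1 : wdist D0 P1 \in <<seg other 0 N>>.
  by apply: (res_trans sO DCp); apply: genS_mem CpP; apply: seg_sub.
have iP1 : incident hub P1 P1 := displ_res sQ dp1 (genS_mem LOQ CpP).
have toM Y : incident hub M1 Y <-> incident hub M Y.
  by apply: iff_sym; apply: (incident_res_l th Y sQ LOQ MM1).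
have toM' Y : incident hub Y M1 <-> incident hub Y M.
  by apply: iff_sym; apply: (incident_res_r pS th_adj twist_id Y sQ LOQ MM1).
have pM1 : perp (incident hub) P1 M1.
  by split; [move/toM; apply: radL | move/toM'; apply: radR'].
have nM1 : ~ incident hub M1 M1 by move/toM/toM'; apply: radL; apply: toO.
have {}l1 : wdist P1 M1 = a 0 := l1.
have l1' : panel (a 0) P1 M1 by right.
have neq : P1 <> M1 by move=> E; have := gens_neq1 S0; rewrite -l1 E wdistxx eqxx.
have aniso T : panel (a 0) P1 T -> T <> M1 -> incident hub T T.
  exact: (line_anisotropic psym ptrans pl pr iP1 pM1 nM1 l1' neq).
(* the neighbour at the short branch carries a second isotropic hyperplane *)
have ku : k * u = u * k.
  have kz : k * z0 = z0 * k.
    apply: (gen_commute _ Zz) => s /segP[r [_ rm ->]]; apply: k_far.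
      exact: leq_trans rm (leqW (leqnSn _)).
    by rewrite ltn_eqF.
  by rewrite Euz mulA k_far // ?gtn_eqF // -mulA kz mulA.
have [Xk [XD EX]] := codist_l_ex th D0 D0 Sk.
rewrite -/(displ D0) -/u in EX.
have dXk : displ Xk = u.
  have nr := gen_not_rdesc sP dD Sk nPk.
  rewrite /displ (codist_right_down pS th_adj twist_id (D := D0) Sk XD) EX ku.
    by rewrite -mulA (gensK Sk) mulg1.
  by rewrite rdesc_mul.
have XP1 : wdist Xk P1 \in <<seg other 0 N>>.
  apply: (res_trans sO _ DP1); rewrite XD mem_gen //.
  by apply/segP; exists m.+1; rewrite /other_arm eqxx.
have [T1 [T2 [lT TT XT]]] := line_meets po (ltn0Sn _) XP1.
rewrite OH in XT.
have nT2 : ~ incident hub T2 T2.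
  by apply: (iso Xk); [rewrite dXk | apply: genS_mem XT].
have T1M : T1 = M1.
  apply: contrapT => nT; apply: nT2; apply: (displ_res sQ _ (genS_mem LOQ TT)).
  exact: aniso.
have [j Hj Ej] := codist_res_l th D0 sH XT.
have T2M : wdist T2 M \in <<hub>>.
  rewrite res_sym; apply: (res_trans sQ (genS_mem LOQ MM1)).
  by rewrite -T1M; apply: genS_mem TT.
have [q Qq Eq] := codist_res_l th D0 sQ T2M.
apply: (down_neq1 po (i := 0) (m := N)) => //.
have upo : up other 0 N = q * j.
  rewrite upSr (other_up a k) // /other_arm eqxx.
  move: Eq; rewrite EM Ej EX => Eq; apply: (mulIg k); rewrite -mulA (gensK Sk) mulg1.
  by apply: (mulIg u); rewrite Eq !mulA.
rewrite /down; suff -> : up other 0 N = 1 by rewrite invg1.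
have sOH : seg other 0 m.+1 \subset S by rewrite OH.
apply: (double_coset_trivial sQ sOH _ _ Qq _ upo); last by rewrite OH.
- move=> s Qs; apply/negP=> /(up_ldesc po (i := 0) (m := N) (leqnn _) (subsetP sQ s Qs))[_ Es].
  by move: nQ0; rewrite -[a 0]/(other 0) -Es Qs.
- move=> s Os; apply/negP=> /(up_rdesc po (i := 0) (m := N) (leqnn _) (subsetP sOH s Os)).
  case=> r [<-]; rewrite add0n /other_arm eqxx => Es; move: Os; rewrite OH Es => Hk.
  by move: nPk; rewrite (subsetP HP _ Hk).
Qed.

End ForkDisplacement.

(** * Superharmonic functions on the Coxeter graph *)

Section Bijections.

Variable V : Type.

(** All permutations of a type, finite or not: a group in which the generators can be
    interpreted. *)
Record bijection := Bijection {
  bij_fun :> V -> V;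
  bij_inv : V -> V;
  bij_funK : cancel bij_fun bij_inv;
  bij_invK : cancel bij_inv bij_fun
}.

Lemma bijection_eq (f g : bijection) : bij_fun f =1 bij_fun g -> f = g.
Proof.
case: f g => [f f' fK f'K] [g g' gK g'K] /= E.
have Ef : f = g by apply: funext.
have Ef' : f' = g' by apply: funext => x; rewrite -(gK (f' x)) -E f'K.
by subst g g'; congr Bijection; apply: Prop_irrelevance.
Qed.

HB.instance Definition _ := gen_eqMixin bijection.
HB.instance Definition _ := gen_choiceMixin bijection.

Definition bij_mul (f g : bijection) : bijection :=
  Bijection (can_comp (bij_funK f) (bij_funK g)) (can_comp (bij_invK g) (bij_invK f)).
Definition bij_one : bijection := @Bijection id id (fun=> erefl) (fun=> erefl).
Definition bij_opp (f : bijection) : bijection := Bijection (bij_invK f) (bij_funK f).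

Lemma bij_mulA : associative bij_mul. Proof. by move=> f g h; apply: bijection_eq. Qed.
Lemma bij_mul1g : left_id bij_one bij_mul. Proof. by move=> f; apply: bijection_eq. Qed.
Lemma bij_mulg1 : right_id bij_one bij_mul. Proof. by move=> f; apply: bijection_eq. Qed.
Lemma bij_mulVg : left_inverse bij_one bij_opp bij_mul.
Proof. by move=> f; apply: bijection_eq => x /=; apply: bij_funK. Qed.
Lemma bij_mulgV : right_inverse bij_one bij_opp bij_mul.
Proof. by move=> f; apply: bijection_eq => x /=; apply: bij_invK. Qed.

HB.instance Definition _ := isGroup.Build bijection
  bij_mulA bij_mul1g bij_mulg1 bij_mulVg bij_mulgV.

End Bijections.

Section Superharmonic.

Variables (gT : finGroupType) (cox : coxeter_system gT).
Local Notation S := (gens cox).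
Local Notation "x * y" := (@mul gT x y) : group_scope.
Local Notation edge := (coxeter_edge cox).

Implicit Types (s t u w : gT) (n : gT -> int).

Lemma edge_sym s t : edge s t = edge t s.
Proof.
apply/idP/idP=> /and3P[Ss St o]; apply/and3P; split=> //;
  by rewrite -orderV invM ?(gensV Ss) ?(gensV St).
Qed.

Lemma edge_irr s : edge s s = false.
Proof. by apply/negP=> /edge_noncommuting; rewrite eqxx. Qed.

Definition neighbours s n : int := (\sum_(t | edge s t) n t)%R.

Lemma nonedge_order s t : s \in S -> t \in S -> s != t -> ~~ edge s t -> #[s * t] = 2.
Proof.
move=> Ss St neq nst; have : #[s * t] <= 2.
  by rewrite leqNgt; apply: contra nst => o; apply/and3P.
rewrite leq_eqVlt => /orP[/eqP //|].
rewrite ltnS leq_eqVlt ltnS leqn0 -[_ == 0]negbK -lt0n order_gt0 orbF order_eq1 => /eqP E.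
by case/eqP: neq; rewrite -[LHS]mulg1 -(gensK St) mulA E mul1g.
Qed.

(** The simple reflection s acting on the vectors rho - v, in coordinates with respect to
    the simple roots; so the orbit of 0 consists of the vectors rho - w rho. *)
Definition affine_reflect s n : gT -> int :=
  fun t => if t == s then (1 - n s + neighbours s n)%R else n t.

Lemma reflect_at s n : affine_reflect s n s = (1 - n s + neighbours s n)%R.
Proof. by rewrite /affine_reflect eqxx. Qed.

Lemma reflect_off s t n : t != s -> affine_reflect s n t = n t.
Proof. by rewrite /affine_reflect => /negbTE->. Qed.

Lemma neighbours_reflect s t n : neighbours s (affine_reflect t n) =
  (neighbours s n + if edge s t then affine_reflect t n t - n t else 0)%R.
Proof.
have off (P : pred gT) : (forall r, P r -> r != t) ->
    (\sum_(r | P r) affine_reflect t n r = \sum_(r | P r) n r)%R.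
  by move=> nt; apply: eq_bigr => r Pr; rewrite reflect_off ?nt.
rewrite /neighbours; case: ifP => st; last first.
  rewrite GRing.addr0; apply: off => r sr; apply: contraFneq st => <-; exact: sr.
rewrite (bigD1 t st) [X in (_ = X + _)%R](bigD1 t st) /= off; last by move=> r /andP[].
by rewrite [RHS]GRing.addrAC (GRing.addrC (n t)) GRing.subrK.
Qed.

Lemma reflectK s : involutive (affine_reflect s).
Proof.
move=> n; apply: funext => t; have [->|neq] := eqVneq t s; last by rewrite !reflect_off.
by rewrite !reflect_at neighbours_reflect edge_irr; lia.
Qed.

Lemma reflect_commute s t n : s != t -> ~~ edge s t ->
  affine_reflect s (affine_reflect t n) = affine_reflect t (affine_reflect s n).
Proof.
move=> neq nst; have nts : edge t s = false by rewrite edge_sym (negbTE nst).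
have neq' : t != s by rewrite eq_sym.
apply: funext => u; have [->|us] := eqVneq u s.
  rewrite reflect_at reflect_off // neighbours_reflect (negbTE nst) reflect_off // reflect_at.
  lia.
have [->|ut] := eqVneq u t; last by rewrite !reflect_off.
rewrite reflect_off // !reflect_at neighbours_reflect nts reflect_off //.
lia.
Qed.

Lemma reflect_braid s t n : s != t -> edge s t ->
  affine_reflect s (affine_reflect t (affine_reflect s n)) = affine_reflect t (affine_reflect s (affine_reflect t n)).
Proof.
move=> neq st; have ts : edge t s by rewrite edge_sym.
have neq' : t != s by rewrite eq_sym.
have at_s m : affine_reflect t m s = m s by apply: reflect_off.
have at_t m : affine_reflect s m t = m t by apply: reflect_off.
have E := (reflect_at, at_s, at_t, neighbours_reflect, st, ts, edge_irr).
apply: funext => u; have [->|us] := eqVneq u s; first by rewrite !E; lia.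
have [->|ut] := eqVneq u t; last by rewrite !reflect_off.
by rewrite !E; lia.
Qed.

Definition reflection s : bijection (gT -> int) := Bijection (reflectK s) (reflectK s).

Lemma expg_commuting (G : groupType) (x y : G) : mul x x = 1 -> mul y y = 1 ->
  mul x y = mul y x -> mul x y ^+ 2 = 1.
Proof.
move=> xx yy xy; rewrite expgS expg1 {1}xy.
have -> : mul (mul y x) (mul x y) = mul (mul y (mul x x)) y by rewrite !mulgA.
by rewrite xx mulg1.
Qed.

Lemma expg_braid (G : groupType) (x y : G) : mul x x = 1 -> mul y y = 1 ->
  mul x (mul y x) = mul y (mul x y) -> mul x y ^+ 3 = 1.
Proof.
move=> xx yy xyx; rewrite !expgS expg0 mulg1.
have -> : mul (mul x y) (mul (mul x y) (mul x y)) = mul (mul x (mul y x)) (mul y (mul x y)).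
  by rewrite !mulgA.
rewrite -xyx.
have -> : mul (mul x (mul y x)) (mul x (mul y x)) = mul (mul x (mul y (mul x x))) (mul y x).
  by rewrite !mulgA.
have -> : mul (mul x (mul y (mul x x))) (mul y x) = mul x (mul (mul y (mul x x)) (mul y x)).
  by rewrite !mulgA.
rewrite xx mulg1; have -> : mul y (mul y x) = mul (mul y y) x by rewrite mulgA.
by rewrite yy mul1g.
Qed.

Hypothesis laced : simply_laced cox.

(** Among the nonnegative vectors of the finite orbit of 0, one has the greatest sum; no
    reflection increases its coordinates, which is the claim. *)
Lemma superharmonic : exists N : gT -> nat, forall s, s \in S ->
  \sum_(t | edge s t) N t < 2 * N s.
Proof.
have [s t Ss St|phi [phiM phiE]] := gens_presentation (c := cox) (f := reflection).
  have ff u : mul (reflection u) (reflection u) = 1.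
    by apply: bijection_eq; apply: reflectK.
  have [<-|neq] := eqVneq s t; first by rewrite (gensK Ss) order1 expg1.
  have [st|nst] := boolP (edge s t).
    rewrite (laced st); apply: expg_braid => //.
    by apply: bijection_eq => n; apply: reflect_braid.
  rewrite (nonedge_order Ss St neq nst).
  apply: expg_commuting => //.
  by apply: bijection_eq => n; apply: reflect_commute.
pose orb w := phi w (fun=> 0%R).
have orb1 t : orb 1 t = 0%R.
  have := phiM 1 1; rewrite mulg1 => E; rewrite /orb.
  suff -> : phi 1 = 1 by [].
  by apply: (mulgI (phi 1)); rewrite -E mulg1.
have orbS s w : s \in S -> orb (s * w) = affine_reflect s (orb w).
  by move=> Ss; rewrite /orb phiM phiE.
pose nneg w := [forall t, (0 <= orb w t)%R].
have nneg1 : nneg 1 by apply/forallP=> t; rewrite orb1.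
pose total w := \sum_t `|orb w t|%N.
have [w /forallP posw maxw] := arg_maxnP total nneg1.
exists (fun t => `|orb w t|%N) => s Ss; rewrite ltnNge; apply/negP=> le.
have En : neighbours s (orb w) = Posz (\sum_(t | edge s t) `|orb w t|%N).
  rewrite /neighbours (big_morph Posz PoszD (erefl _)); apply: eq_bigr => t _.
  by have := posw t; case: (orb w t).
have inc : (orb w s < affine_reflect s (orb w) s)%R.
  by rewrite reflect_at En; have := posw s; lia.
have : nneg (s * w).
  apply/forallP=> t; rewrite orbS //; have [->|neq] := eqVneq t s.
    by have := posw s; lia.
  by rewrite reflect_off.
move=> /maxw max; have : total (s * w) <= total w := max.
rewrite /total (bigD1 s) // [X in _ <= X](bigD1 s) //= orbS //.
rewrite [X in (_ + X <= _)%N](eq_bigr (fun t => `|orb w t|%N)) => [|t neq]; last first.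
  by rewrite reflect_off.
by have := posw s; lia.
Qed.

(** Pairing m with the vector of superharmonic, in both orders, gives a contradiction.
    The null vector of an affine diagram is such an m, in any graph that contains the diagram. *)
Lemma no_subharmonic (m : gT -> nat) s0 : 0 < m s0 ->
  (forall s, 0 < m s -> s \in S /\ 2 * m s <= \sum_(t | edge s t) m t) -> False.
Proof.
move=> m0 sub; have [N sup] := superharmonic.
have E : \sum_s m s * \sum_(t | edge s t) N t = \sum_t N t * \sum_(s | edge t s) m s.
  under eq_bigr do rewrite big_distrr.
  rewrite (exchange_big_dep xpredT) //=; apply: eq_bigr => t _; rewrite big_distrr /=.
  by apply: eq_big => [s|s _]; [rewrite edge_sym | rewrite mulnC].
have l1 : \sum_s m s + \sum_s m s * \sum_(t | edge s t) N t <= \sum_s m s * (2 * N s).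
  rewrite -big_split /= leq_sum // => s _; have [->|/sub[/sup lt _]] := posnP (m s); first by [].
  by rewrite -mulnS leq_mul2l lt orbT.
have l2 : \sum_t N t * (2 * m t) <= \sum_t N t * \sum_(s | edge t s) m s.
  apply: leq_sum => t _; have [->|/sub[_ le]] := posnP (m t); first by rewrite !muln0.
  by rewrite leq_mul2l le orbT.
have E3 : \sum_s m s * (2 * N s) = \sum_t N t * (2 * m t).
  by apply: eq_bigr => s _; rewrite mulnCA (mulnC (m s)) mulnCA.
have : 0 < \sum_s m s by rewrite (bigD1 s0) //= addn_gt0 m0.
lia.
Qed.

End Superharmonic.

(** * Finite simply laced diagrams *)

Section Classification.

Variables (gT : finGroupType) (cox : coxeter_system gT).
Local Notation S := (gens cox).
Local Notation "x * y" := (@mul gT x y) : group_scope.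
Local Notation edge := (coxeter_edge cox).

Hypothesis laced : simply_laced cox.

Implicit Types (s t u x y z : gT) (a : nat -> gT) (i j b c n : nat).

Lemma edge_gens s t : edge s t -> s \in S /\ t \in S.
Proof. by case/and3P. Qed.

Lemma nonedge_commute s t : s \in S -> t \in S -> ~~ edge s t -> s * t = t * s.
Proof.
move=> Ss St nst; have [->//|neq] := eqVneq s t.
have := expg_order (s * t); rewrite (nonedge_order Ss St neq nst) expgS expg1 => E.
have : s * (s * t * (s * t)) = s * 1 by rewrite E.
rewrite !mulA (gensK Ss) mul1g mulg1 => E'.
by rewrite -{1}E' -(mulA (t * s)) (gensK St) mulg1.
Qed.

Lemma edge_braid s t : edge s t -> s * t * s = t * s * t.
Proof.
move=> st; have [Ss St] := edge_gens st; have := expg_order (s * t).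
rewrite (laced st) !expgS expg0 mulg1 => E.
have : s * t * s * (t * s * t) = 1 by rewrite -[RHS]E !mulA.
move=> E'; rewrite -[LHS]mulg1 -[in RHS](mul1g (t * s * t)) -[in RHS]E'.
rewrite -(mulA (s * t * s)); congr (_ * _).
by rewrite !mulA -(mulA (t * s)) (gensK St) mulg1 -(mulA t) (gensK Ss) mulg1 (gensK St).
Qed.

Lemma path_edge a n i : path_in cox a n -> i.+1 < n -> edge (a i) (a i.+1).
Proof.
move=> pa lt; apply: contraT => ne.
have := path_noncommuting pa lt.
by rewrite (nonedge_commute (path_gens pa (ltnW lt)) (path_gens pa lt) ne) eqxx.
Qed.

(** Adding a pendant vertex at the start of a path. *)
Definition extend x a i := if i is j.+1 then a j else x.

Lemma path_extend x a n : path_in cox a n -> x \in S -> (forall i, i < n -> x <> a i) ->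
  (0 < n -> edge x (a 0)) -> (forall i, 0 < i -> i < n -> ~~ edge x (a i)) ->
  path_in cox (extend x a) n.+1.
Proof.
move=> pa Sx new x0 far; split=> [[|i]|[|i] [|j]|[|i]|[|i] [|[|j]]] //=.
- exact: (path_gens pa).
- by move=> _ jn E; case: (new _ jn).
- by move=> iN _ E; case: (new _ iN).
- by move=> iN jN /(path_inj pa iN jN)->.
- by rewrite ltnS => n0; apply/edge_braid/x0.
- exact: (path_braid pa).
- rewrite ltnS => _ jn; apply: nonedge_commute => //; first exact: (path_gens pa).
  exact: far.
- by rewrite !ltnS => ij jn; apply: (path_far pa).
Qed.

(** ** Weights on a path with two extra vertices *)

Section Weights.

Variables (a : nat -> gT) (n : nat) (x y : gT) (w : nat -> nat) (cx cy : nat).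
Hypothesis pa : path_in cox a n.
Hypothesis xN : forall i, i < n -> x <> a i.
Hypothesis yN : forall i, i < n -> y <> a i.

(** The function with value w i at a_i, cx at x and cy at y, as a sum, to make
    the sum over neighbours of a vertex immediate. *)
Definition weight s :=
  \sum_(i < n) (a i == s) * w i + (x == s) * cx + (y == s) * cy.

Lemma weight_neighbours s : \sum_(t | edge s t) weight t =
  \sum_(i < n | edge s (a i)) w i + edge s x * cx + edge s y * cy.
Proof.
have pick u c : \sum_(t | edge s t) (u == t) * c = (edge s u * c)%N.
  rewrite big_mkcond (bigD1 u) //= eqxx mul1n big1 ?addn0; first by case: (edge s u); rewrite ?mul1n ?mul0n.
  by move=> t /negbTE nt; rewrite eq_sym nt mul0n; case: ifP.
rewrite !big_split /= !pick exchange_big [in RHS]big_mkcond /=; congr (_ + _ + _).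
by apply: eq_bigr => i _; rewrite pick; case: (edge s _); rewrite ?mul1n ?mul0n.
Qed.

Lemma weight_path i : i < n -> weight (a i) = w i.
Proof.
move=> iN; rewrite /weight (bigD1 (Ordinal iN)) //= eqxx mul1n big1.
  by rewrite (introF eqP (xN iN)) (introF eqP (yN iN)) !addn0.
move=> j nj; case: eqP => // /(path_inj pa (ltn_ord j) iN) E.
by case/eqP: nj; apply: val_inj.
Qed.

Lemma weight_off s : (forall i, i < n -> s <> a i) -> weight s = ((x == s) * cx + (y == s) * cy)%N.
Proof.
move=> sN; rewrite /weight big1 // => i _; rewrite (introF eqP) // => E.
exact: (sN _ (ltn_ord i)).
Qed.

Lemma sum_ge1 (P : pred nat) j : j < n -> P j -> w j <= \sum_(i < n | P i) w i.
Proof. by move=> jn Pj; rewrite (bigD1 (Ordinal jn)) //= leq_addr. Qed.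

Lemma sum_ge2 (P : pred nat) i j : i < j -> j < n -> P i -> P j ->
  w i + w j <= \sum_(r < n | P r) w r.
Proof.
move=> ij jn Pi Pj; have iN := ltn_trans ij jn.
rewrite (bigD1 (Ordinal iN)) //= leq_add2l (bigD1 (Ordinal jn)) ?leq_addr //=.
by rewrite Pj -val_eqE /= gtn_eqF.
Qed.

Lemma no_weights i0 : x \in S -> y \in S -> ((x == y) * cy)%N = 0 -> i0 < n -> 0 < w i0 ->
  (forall i, i < n -> 0 < w i -> 2 * w i <=
    (0 < i) * w i.-1 + (i.+1 < n) * w i.+1 + edge (a i) x * cx + edge (a i) y * cy) ->
  (0 < cx -> 2 * cx <= \sum_(i < n | edge x (a i)) w i + edge x y * cy) ->
  (0 < cy -> 2 * cy <= \sum_(i < n | edge y (a i)) w i + edge y x * cx) -> False.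
Proof.
move=> Sx Sy xy in0 w0 wP xP yP.
apply: (no_subharmonic laced (m := weight) (s0 := a i0)); first by rewrite weight_path.
move=> s ws; have [[i iN E]|sN] := pselect (exists2 i, i < n & s = a i).
  rewrite E in ws *; rewrite weight_path // in ws *.
  split; first exact: (path_gens pa).
  rewrite weight_neighbours; apply: leq_trans (wP i iN ws) _.
  rewrite !leq_add2r; have e1 : i.+1 < n -> edge (a i) (a i.+1) by apply: path_edge.
  have e2 : 0 < i -> edge (a i) (a i.-1).
    by move=> i0'; rewrite edge_sym -{2}(prednK i0'); apply: (path_edge pa); rewrite prednK.
  pose Q j := edge (a i) (a j).
  case: posnP => [Ei|i1]; case: leqP => // lt; rewrite ?mul0n ?mul1n ?addn0 //.
  - exact: (@sum_ge1 Q _ lt (e1 lt)).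
  - exact: (@sum_ge1 Q _ (leq_ltn_trans (leq_pred _) iN) (e2 i1)).
  - by apply: (@sum_ge2 Q _ _ _ lt (e2 i1) (e1 lt)); rewrite prednK.
have {}sN i : i < n -> s <> a i by move=> iN E; apply: sN; exists i.
move: ws; rewrite weight_off // weight_neighbours; have [Ex|nx] := eqVneq x s.
  subst s; rewrite (eq_sym y) xy addn0 mul1n => ws; split=> //.
  by rewrite edge_irr mul0n addn0; apply: xP.
have [Ey|ny] := eqVneq y s; last by [].
subst s; rewrite mul0n mul1n => ws; split=> //.
by rewrite edge_irr mul0n addn0; apply: yP.
Qed.

End Weights.


(** ** Excluded configurations *)

(** Constant weights on a cycle, the affine diagram A~. *)
Lemma no_two_neighbours a n x i j : path_in cox a n -> (forall r, r < n -> x <> a r) ->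
  i < j -> j < n -> edge x (a i) -> edge x (a j) -> False.
Proof.
move=> pa xN ij jn xi xj; have [Sx _] := edge_gens xi.
pose w r : nat := (i <= r) && (r <= j).
have wi : w i = 1%N by rewrite /w leqnn ltnW.
have wj : w j = 1%N by rewrite /w leqnn andbT ltnW.
apply: (@no_weights a n x x w 1%N 0 pa xN xN i Sx Sx) => //.
- by rewrite muln0.
- exact: ltn_trans jn.
- by rewrite wi.
- move=> r rn wr.
  have hi : (r == i) <= edge (a r) x by case: eqP => // ->; rewrite edge_sym xi.
  have hj : (r == j) <= edge (a r) x by case: eqP => // ->; rewrite edge_sym xj.
  move: wr hi hj; move: (edge (a r) x : nat); rewrite /w.
  by clear -ij jn rn; move=> e1; case: r rn => [|r] rn /=; lia.
move=> _; rewrite muln0 addn0.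
by have := @sum_ge2 n w (fun r => edge x (a r)) i j ij jn xi xj; rewrite wi wj.
Qed.

(** The affine diagram D~: weight 2 between the branching nodes, weight 1 on the four
    nodes around them. *)
Lemma no_two_branches a n b c x y : path_in cox a n ->
  (forall r, r < n -> x <> a r) -> (forall r, r < n -> y <> a r) -> x != y ->
  0 < b -> b <= c -> c.+1 < n -> edge x (a b) -> edge y (a c) -> False.
Proof.
move=> pa xN yN nxy b0 bc cn xb yc.
have [Sx _] := edge_gens xb; have [Sy _] := edge_gens yc.
pose w r := if (b <= r <= c) then 2 else ((b <= r.+1 <= c.+2) : nat).
have wb : w b = 2 by rewrite /w leqnn bc.
have wc : w c = 2 by rewrite /w leqnn bc.
apply: (@no_weights a n x y w 1%N 1%N pa xN yN b Sx Sy) => //.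
- by rewrite (negbTE nxy).
- exact: leq_ltn_trans bc (ltnW cn).
- by rewrite wb.
- move=> r rn wr.
  have hb : (r == b) <= edge (a r) x by case: eqP => // ->; rewrite edge_sym xb.
  have hc : (r == c) <= edge (a r) y by case: eqP => // ->; rewrite edge_sym yc.
  move: wr hb hc; move: (edge (a r) x : nat) (edge (a r) y : nat); rewrite /w.
  clear -b0 bc cn rn; move=> e1 e2; case: (ltnP r.+1 n) => lt; case: r rn lt => [|r] rn lt; rewrite ?mul1n ?mul0n ?muln1 /=;
    by repeat case: ifP; lia.
- move=> _; apply: leq_trans (leq_addr _ _); rewrite -[(2 * 1)%N]/2 -wb.
  by apply: (@sum_ge1 n w (fun r => edge x (a r))) => //; apply: leq_ltn_trans bc (ltnW cn).
move=> _; apply: leq_trans (leq_addr _ _); rewrite -[(2 * 1)%N]/2 -wc.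
by apply: (@sum_ge1 n w (fun r => edge y (a r))) => //; apply: ltnW.
Qed.

(** The affine diagram E6~: weight 3 at the branching node, decreasing along the three
    arms. *)
Lemma no_long_branch a n b x y : path_in cox a n ->
  (forall r, r < n -> x <> a r) -> (forall r, r < n -> y <> a r) -> x != y ->
  1 < b -> b.+2 < n -> edge x (a b) -> edge x y -> False.
Proof.
move=> pa xN yN nxy b1 bn xb xy; have [Sx Sy] := edge_gens xy.
pose w r := 3 - ((r - b) + (b - r)).
have wb : w b = 3 by rewrite /w subnn.
apply: (@no_weights a n x y w 2 1%N pa xN yN b Sx Sy) => //.
- by rewrite (negbTE nxy).
- by apply: ltn_trans bn.
- by rewrite wb.
- move=> r rn wr.
  have hb : (r == b) <= edge (a r) x by case: eqP => // ->; rewrite edge_sym xb.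
  move: wr hb; move: (edge (a r) x : nat) (edge (a r) y : nat); rewrite /w.
  by clear -b1 bn rn; move=> e1 e2; case: r rn => [|r] rn /=; lia.
- move=> _; rewrite xy; rewrite -[(2 * 2)%N]/(3 + 1)%N leq_add2r -wb.
  by apply: (@sum_ge1 n w (fun r => edge x (a r))) => //; apply: ltn_trans bn.
by move=> _; rewrite edge_sym xy leq_addl.
Qed.

(** The affine diagram E7~: weight 4 at the branching node, decreasing along the two long
    arms, and weight 2 on the short one. *)
Lemma no_long_arms a n b x : path_in cox a n ->
  (forall r, r < n -> x <> a r) -> 2 < b -> b.+3 < n -> edge x (a b) -> False.
Proof.
move=> pa xN b2 bn xb; have [Sx _] := edge_gens xb.
pose w r := 4 - ((r - b) + (b - r)).
have wb : w b = 4 by rewrite /w subnn.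
apply: (@no_weights a n x x w 2 0 pa xN xN b Sx Sx) => //.
- by rewrite muln0.
- by apply: leq_trans bn; apply: leqW; apply: leqW.
- by rewrite wb.
- move=> r rn wr.
  have hb : (r == b) <= edge (a r) x by case: eqP => // ->; rewrite edge_sym xb.
  move: wr hb; move: (edge (a r) x : nat); rewrite /w.
  by clear -b2 bn rn; move=> e1; case: r rn => [|r] rn /=; lia.
move=> _; rewrite muln0 addn0 -[(2 * 2)%N]/4 -wb.
apply: (@sum_ge1 n w (fun r => edge x (a r))) => //.
by apply: leq_trans bn; apply: leqW; apply: leqW.
Qed.


Definition fork a n b k := [/\ k \in S, forall i, i < n -> k <> a i, edge k (a b),
  forall i, i < n -> i != b -> k * a i = a i * k & S = k |: seg a 0 n].

Lemma path_size a n : path_in cox a n -> n <= #|gT|.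
Proof.
move=> pa; rewrite -[n]card_ord; apply: (@leq_card _ _ (fun i : 'I_n => a i)).
by move=> i j /(path_inj pa (ltn_ord i) (ltn_ord j))/val_inj.
Qed.

Lemma rev_new a n x : (forall r, r < n -> x <> a r) -> forall r, r < n -> x <> a (n - r.+1)%N.
Proof. by move=> xN r rn; apply: xN; rewrite ltn_subrL (leq_ltn_trans (leq0n r) rn). Qed.

Section Longest.

Variables (a : nat -> gT) (n : nat).
Hypothesis pa : path_in cox a n.
Hypothesis maxn : forall a' n', path_in cox a' n' -> n' <= n.

Lemma unique_neighbour x b c : (forall r, r < n -> x <> a r) -> b < n -> c < n ->
  edge x (a b) -> edge x (a c) -> b = c.
Proof.
move=> xN bn cn xb xc; case: (ltngtP b c) => // lt.
  by case: (no_two_neighbours pa xN lt cn xb xc).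
by case: (no_two_neighbours pa xN lt bn xc xb).
Qed.

End Longest.

(** Otherwise x would extend the path, having no other neighbour on it. *)
Lemma longest_start a n x b : path_in cox a n ->
  (forall a' n', path_in cox a' n' -> n' <= n) ->
  (forall r, r < n -> x <> a r) -> b < n -> edge x (a b) -> 0 < b.
Proof.
move=> pa maxn xN bn xb; rewrite lt0n; apply/negP=> /eqP b0; rewrite b0 in bn xb.
suff /maxn : path_in cox (extend x a) n.+1 by rewrite ltnn.
apply: path_extend => //; first by case: (edge_gens xb).
move=> i i0 iN; apply/negP=> xi.
by move: i0; rewrite -(unique_neighbour pa xN bn iN xb xi).
Qed.

Lemma longest_end a n x b : path_in cox a n ->
  (forall a' n', path_in cox a' n' -> n' <= n) ->
  (forall r, r < n -> x <> a r) -> b < n -> edge x (a b) -> b.+1 < n.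
Proof.
move=> pa maxn xN bn xb.
have := @longest_start _ n x (n - b.+1)%N (path_rev pa) maxn (rev_new xN).
have -> : (n - (n - b.+1).+1 = b)%N by clear -bn; lia.
by rewrite subn_gt0; apply => //; clear -bn; lia.
Qed.

(** Otherwise a_0 could be replaced by x and y, to give a longer path. *)
Lemma longest_arm a n x y b : path_in cox a n ->
  (forall a' n', path_in cox a' n' -> n' <= n) ->
  (forall r, r < n -> x <> a r) -> (forall r, r < n -> y <> a r) ->
  b < n -> edge x (a b) -> edge x y -> (forall r, r < n -> ~~ edge y (a r)) -> 1 < b.
Proof.
move=> pa maxn xN yN bn xb xy ya; have b0 := longest_start pa maxn xN bn xb.
rewrite ltn_neqAle b0 andbT; apply/negP=> /eqP b1; rewrite -b1 in bn xb.
have [Sx Sy] := edge_gens xy.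
case: n pa maxn xN yN bn ya => // n pa maxn xN yN bn ya.
have p1 := path_shift (i := 1) pa (leqnn n.+1).
have p2 : path_in cox (extend x (fun r => a (1 + r)%N)) n.+1.
  apply: path_extend => // [i iN|i i0 iN]; first exact: xN.
  apply/negP=> xi; have := unique_neighbour pa xN bn (_ : i.+1 < n.+1) xb xi.
  by move=> /(_ iN) [E]; move: i0; rewrite -E.
suff /maxn : path_in cox (extend y (extend x (fun r => a (1 + r)%N))) n.+2 by rewrite ltnn.
apply: path_extend => // [[|i] iN|_|[|i] // _ iN] /=.
- by move=> E; have := edge_irr cox x; rewrite -{2}E xy.
- exact: yN.
- by rewrite edge_sym.
exact: ya.
Qed.

Lemma longest_arm_end a n x y b : path_in cox a n ->
  (forall a' n', path_in cox a' n' -> n' <= n) ->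
  (forall r, r < n -> x <> a r) -> (forall r, r < n -> y <> a r) ->
  b < n -> edge x (a b) -> edge x y -> (forall r, r < n -> ~~ edge y (a r)) -> b.+2 < n.
Proof.
move=> pa maxn xN yN bn xb xy ya.
have := @longest_arm _ n x y (n - b.+1)%N (path_rev pa) maxn (rev_new xN) (rev_new yN).
have -> : (n - (n - b.+1).+1 = b)%N by clear -bn; lia.
move=> H; have {H} : 1 < n - b.+1.
  apply: H => //; first by clear -bn; lia.
  by move=> r rn; apply: ya; rewrite ltn_subrL (leq_ltn_trans (leq0n b) bn).
by clear -bn; lia.
Qed.

Lemma fork_rev a n b k : fork a n b k -> b < n ->
  fork (fun r => a (n - r.+1)%N) n (n - b.+1) k.
Proof.
case=> Sk kN kb kfar SE bn; split=> //.
- exact: rev_new.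
- by have -> : (n - (n - b.+1).+1 = b)%N by clear -bn; lia.
- move=> i iN ib; apply: kfar; first by clear -iN; lia.
  by apply: contra ib => /eqP <-; apply/eqP; clear -iN; lia.
by rewrite (seg_rev a 0 (leqnn n)) subnn subn0.
Qed.

(** Take a longest induced path. A vertex off it has at most one neighbour on it, because
    of A~, and this is not an end, by maximality. A second vertex would create D~ or E6~, and two
    long arms would create E7~; the path is reversed if its short arm comes first. *)
Lemma classification : irreducible cox ->
  (exists a n, [/\ path_in cox a n, 0 < n & S = seg a 0 n]) \/
  exists a n b k, [/\ path_in cox a n, fork a n b k, 0 < b & n = b.+2 \/ n = b.+3].
Proof.
move=> [/set0Pn[s0 Ss0] conn].
pose P n := `[< exists a, path_in cox a n >].
have exP : exists n, P n by exists 0; apply/asboolP; exists (fun=> s0); split.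
have ubP n : P n -> n <= #|gT| by case/asboolP=> a; apply: path_size.
case: (ex_maxnP exP ubP) => n /asboolP[a pa] maxP.
have maxn a' n' : path_in cox a' n' -> n' <= n.
  by move=> pa'; apply: maxP; apply/asboolP; exists a'.
have n0 : 0 < n.
  have p1 : path_in cox (fun=> s0) 1 by split=> // -[|i] [|j].
  exact: maxn p1.
have A0 : a 0 \in seg a 0 n by apply: seg_at.
have sP : seg a 0 n \subset S by apply: seg_gens pa _.
have [SP|nSP] := boolP (S \subset seg a 0 n).
  by left; exists a, n; split=> //; apply/eqP; rewrite eqEsubset SP.
right; have [z Sz nz] := subsetPn nSP.
have new u : u \notin seg a 0 n -> forall r, r < n -> u <> a r.
  by move=> un r rn E; case/negP: un; rewrite E seg_at.
have [s [x [/segP[b [_ bn ->]] /new xN]]] := connect_exit (conn _ _ (path_gens pa n0) Sz) A0 nz.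
rewrite edge_sym => xb; have [Sx _] := edge_gens xb.
have b0 := longest_start pa maxn xN bn xb; have b1 := longest_end pa maxn xN bn xb.
have SE : S = x |: seg a 0 n.
  apply/eqP; rewrite eqEsubset subUset sub1set Sx sP !andbT; apply: contraT => nS.
  have [z' Sz' nz'] := subsetPn nS.
  have A0' : a 0 \in x |: seg a 0 n by rewrite inE A0 orbT.
  have [s' [y [As yA sy]]] := connect_exit (conn _ _ (path_gens pa n0) Sz') A0' nz'.
  have [nyx /new yN] : y != x /\ y \notin seg a 0 n.
    by apply/andP; rewrite -negb_or -in_setU1.
  have nxy : x != y by rewrite eq_sym.
  have [ya|/existsPn ya] := boolP [exists r : 'I_n, edge y (a r)].
    have {ya}[c yc] := existsP ya; have cn := ltn_ord c.
    have c0 := longest_start pa maxn yN cn yc; have c1 := longest_end pa maxn yN cn yc.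
    by case: (leqP b c) => [bc|/ltnW cb];
      [case: (no_two_branches pa xN yN nxy b0 bc c1 xb yc)
      |case: (no_two_branches pa yN xN nyx c0 cb b1 yc xb)].
  have {}ya r : r < n -> ~~ edge y (a r) by move=> rn; apply: (ya (Ordinal rn)).
  case/setU1P: As => [Es|/segP[r [_ rn Er]]]; last first.
    by have := ya r rn; rewrite edge_sym -Er sy.
  rewrite Es in sy.
  have b2 := longest_arm pa maxn xN yN bn xb sy ya.
  have b3 := longest_arm_end pa maxn xN yN bn xb sy ya.
  by case: (no_long_branch pa xN yN nxy b2 b3 xb sy).
have F : fork a n b x.
  split=> // i iN ib; apply: nonedge_commute => //; first exact: (path_gens pa).
  by apply: contra ib => xi; rewrite (unique_neighbour pa xN bn iN xb xi).
have [short|long] := leqP n b.+3.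
  by exists a, n, b, x; split=> //; clear -short b1; lia.
have [b3|b3] := leqP b 2; last by case: (no_long_arms pa xN b3 long xb).
exists (fun r => a (n - r.+1)%N), n, (n - b.+1)%N, x.
split; [exact: path_rev | exact: fork_rev | | ]; clear -b0 b1 b3; lia.
Qed.

End Classification.

(** * Oppomorphisms of simply laced buildings *)

Section Assembly.

Variables (gT : finGroupType) (cox : coxeter_system gT) (Delta : building cox).
Local Notation S := (gens cox).
Local Notation "x * y" := (@mul gT x y) : group_scope.
Local Notation ldesc := (ldesc cox).
Local Notation rdesc := (rdesc cox).
Local Notation edge := (coxeter_edge cox).

Variables (th : chamber Delta -> chamber Delta) (p : {perm gT}).
Hypothesis pS : perm_on S p.
Hypothesis th_adj : forall C D s, s \in S ->
  wdist C D = s <-> wdist (th C) (th D) = p s.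
Hypothesis th_surj : forall D', exists D, th D = D'.
Hypothesis thickD : thick Delta.
Hypothesis twist_id : forall s, s \in S -> twist cox p s = s.
Hypothesis laced : simply_laced cox.

Local Notation displ := (displ th).

Implicit Types (s t x y z k : gT) (I J K L : {set gT}) (C D : chamber Delta).
Implicit Types (i j r n b m : nat) (a : nat -> gT).

Lemma path_displ_all a n C : path_in cox a n -> displ C \in <<seg a 1 n>> ->
  forall i, i < n -> exists C', displ C' \in <<[set a i]>>.
Proof.
move=> pa dC i iN; have [n1|n1] := leqP n 1.
  exists C; apply: genS_mem dC; apply/subsetP=> x /segP[r [r1 rn _]].
  by have := leq_trans (leq_ltn_trans r1 rn) n1.
have [x j|j _||C' dC'] :=
  path_displ pS th_adj th_surj thickD twist_id pa (sub0set S) n1 _ _ (C := C) _ iN.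
- by rewrite inE.
- by rewrite inE.
- by rewrite set0U.
by exists C'; rewrite set0U in dC'.
Qed.

Lemma path_displ_all_rev a n C : path_in cox a n -> displ C \in <<seg a 0 n.-1>> ->
  forall i, i < n -> exists C', displ C' \in <<[set a i]>>.
Proof.
move=> pa dC i iN.
have [||C' dC'] := @path_displ_all _ n C (path_rev pa) _ (n - i.+1)%N.
- by rewrite (seg_rev a 1 (leqnn n)) subnn subn1.
- by rewrite ltn_subrL (leq_ltn_trans (leq0n i) iN).
exists C'; move: dC'; have -> : (n - (n - i.+1).+1 = i)%N by clear -iN; lia.
by [].
Qed.

Lemma edge_displ s k C : edge k s -> displ C \in <<[set s]>> ->
  exists C', displ C' \in <<[set k]>>.
Proof.
move=> ks dC; have [Sk Ss] := edge_gens ks.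
have ps : path_in cox (fun=> s) 1 by split=> // -[|i] [|j].
have nks r : r < 1 -> k <> s by move=> _ E; move: ks; rewrite E edge_irr.
have p2 : path_in cox (extend k (fun=> s)) 2 by apply: path_extend => // -[|i].
have [||||C' dC'] := slide pS th_adj thickD twist_id p2 (sub0set S) _ _ (C := C).
- by move=> x i; rewrite inE.
- by move=> i _; rewrite inE.
- by [].
- by rewrite set0U.
by exists C'; rewrite set0U in dC'.
Qed.

(** An arm of length two beside the branch: minimal displacements are products of
    alternate nodes of the path, and these can be slid across the branching node. *)
Lemma fork_arm2_displ a b k C : path_in cox a b.+3 -> fork cox a b.+3 b k -> 0 < b ->
  displ C \in <<seg a 0 b.+3>> -> exists C', displ C' \in <<seg a 0 b.+2>>.
Proof.
move=> pa [Sk kN kb kfar SE] b0 dC.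
have sJ : seg a 0 b.+2 \subset S by apply: seg_gens pa _.
have sP : seg a 0 b.+3 \subset S by apply: seg_gens pa _.
have [D CD minD] := displ_minimal pS th_adj th_surj thickD C sJ.
have dD : displ D \in <<seg a 0 b.+3>>.
  apply: (displ_res pS th_adj twist_id sP dC); apply: genS_mem CD; exact: seg_sub.
have comm j : j < b.+2 -> ldesc (displ D) (a j) || rdesc (displ D) (a j) ->
    a j * displ D = displ D * a j.
  move=> lt dj; have Sj : a j \in S by apply: (path_gens pa); apply: ltnW.
  by have := minD (a j) (seg_at _ (leq0n j) lt); rewrite (twist_id Sj) => /(_ dj)[].
have [|h|[z [Hz Eez Eze]]] := path_end_split pa (ltn0Sn _) dD; [exact: comm | by exists D |].
rewrite subSS subn1 /= in Hz; rewrite /= in Eez Eze.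
set u := displ D in comm Eez Eze dD; set e := a b.+2 in Eez Eze.
have Se : e \in S by apply: (path_gens pa).
have ze : e ^ z = e by rewrite conjE -Eez Eze mulKg.
have ne j : j < b.+1 -> (a j == e :> gT) = false.
  move=> lt; apply/eqP=> /(path_inj pa _ (ltnSn _)) E.
  by have := leqW (leqW lt); move=> /E Ej; move: lt; rewrite Ej ltnNge leqW.
have commz j : j < b -> ldesc z (a j) || rdesc z (a j) -> a j * z = z * a j.
  move=> lt dz; have je : a j * e = e * a j.
    by apply: (path_far pa) => //; rewrite !ltnS ltnW.
  have : a j * u = u * a j.
    apply: comm; first exact: (leq_trans lt (leqW (leqnSn _))).
    have nz : (a j ^ z == e :> gT) = false.
      apply/negP=> /eqP; rewrite -ze => /conjg_inj E.
      by have := ne j (leqW lt); rewrite E eqxx.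
    rewrite {1}Eze (ldesc_mulr _ _ Se) nz addbF Eez (rdesc_mull _ _ Se) ze.
    by rewrite (eq_sym e) (ne j (leqW lt)) addbF.
  by rewrite Eez mulA je -!mulA => /mulgI.
have pb : path_in cox a b.+1 by apply: path_prefix pa _; apply: leqW.
have [|hz|[z2 [Hz2 Ez2 _]]] := path_end_split pb (ltn0Sn _) Hz; first exact: commz.
  rewrite /= in hz.
  have p2 : path_in cox (fun r => a (b.+1 + r)%N) 2.
    by apply: (path_shift (i := b.+1) pa); rewrite addn2.
  have [||||C' dC'] := slide pS th_adj thickD twist_id p2
    (seg_gens 0 pa (leqW (leqW (leqnSn b)))) _ _ (C := D).
  - move=> x i /segP[r [_ rb ->]] i2; apply: (path_far pa); clear -rb i2; lia.
  - move=> i i2; apply/segP=> -[r [_ rb]].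
    by have lt : b.+1 + i < b.+3 by [clear -i2; lia];
      move=> /(path_inj pa lt) H; have := H (ltn_trans rb (leqW (leqnSn _))); clear -rb; lia.
  - by [].
  - rewrite addn1 -/(displ D) -/u Eze; apply: groupM.
      by apply: genS_mem hz; apply: subsetUl.
    by rewrite mem_gen // !inE eqxx orbT.
  exists C'; apply: genS_mem dC'; rewrite subUset sub1set addn0 seg_at // andbT.
  by apply: seg_sub => //; apply: leqW.
rewrite /= in Ez2; have {}Hz2 : z2 \in <<seg a 0 b.-1>>.
  by move: Hz2; rewrite subSS subn1.
have p3 : path_in cox (fun r => a (b + r)%N) 3.
  by apply: (path_shift (i := b) pa); rewrite addn3.
have p4 : path_in cox (extend k (fun r => a (b + r)%N)) 4.
  apply: (path_extend laced p3 Sk) => [i i3|_|i i0 i3].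
  - by apply: kN; clear -i3; lia.
  - by rewrite addn0.
  apply/negP=> /edge_noncommuting; rewrite kfar ?eqxx //; first by clear -i3; lia.
  by apply/eqP; clear -i0; lia.
have sI : seg a 0 b.-1 \subset S by apply: seg_gens pa _; clear; lia.
have [x i /segP[r [_ rb ->]]|i i4|| C' dC'] := path_displ pS th_adj th_surj thickD twist_id
  p4 sI isT _ _ (C := D) _ (isT : 1 < 4).
- case: i => [|i] i4 /=.
    by apply/esym/kfar; [clear -rb; lia | apply/eqP; clear -rb; lia].
  by apply: (path_far pa); clear -rb i4; lia.
- apply/segP=> -[r [_ rb]]; case: i i4 => [|i] i4 /=.
    by apply: kN; clear -rb; lia.
  have lt : b + i < b.+3 by clear -i4; lia.
  by move=> /(path_inj pa lt) H; have /H : r < b.+3 by [clear -rb; lia]; clear -rb; lia.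
- rewrite -/(displ D) -/u Eze Ez2; apply: groupM.
    apply: groupM; last by apply: genS_mem Hz2; apply: subsetUl.
    rewrite mem_gen // inE; apply/orP; right; apply/segP; exists 1%N.
    by rewrite /= addn0.
  rewrite mem_gen // inE; apply/orP; right; apply/segP; exists 3.
  by rewrite /= addn2.
exists C'; apply: genS_mem dC'; rewrite subUset sub1set /= addn0 seg_at ?leqnSn // andbT.
by apply: seg_sub => //; clear; lia.
Qed.

(** In each case of the classification the hypothesis, applied to a_0 or to the node off the
    path, leads to a displacement that avoids an end of the path; path_displ then reaches all
    nodes of the path, and edge_displ the last node. *)
Lemma displ_generators : irreducible cox -> (forall s, s \in S -> exists C, displ C \in <<S :\ s>>) ->
  forall s, s \in S -> exists C, displ C \in <<[set s]>>.
Proof.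
move=> irr typS; case: (classification laced irr) => [[a [n [pa n0 SE]]]|].
  have [C dC] := typS _ (path_gens pa n0).
  have dC' : displ C \in <<seg a 1 n>>.
    apply: genS_mem dC; apply/subsetP=> x /setD1P[nx]; rewrite SE => /segP[[|r] [_ rn Er]].
      by rewrite Er eqxx in nx.
    by rewrite Er seg_at.
  by move=> s; rewrite SE => /segP[r [_ rn ->]]; apply: path_displ_all dC' _ rn.
case=> a [n [b [k [pa F b0 bn]]]]; have [Sk kN kb kfar SE] := F.
have n0 : 0 < n by case: bn => ->.
have lt_bn : b < n by case: bn => ->; [apply: leqnSn | apply: leqW].
have [Cv dv] : exists C, displ C \in <<seg a 0 n>>.
  have [C dC] := typS k Sk; exists C; apply: genS_mem dC.
  by apply/subsetP=> x /setD1P[nx]; rewrite SE => /setU1P[Ex|//]; rewrite Ex eqxx in nx.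
suff all i : i < n -> exists C, displ C \in <<[set a i]>>.
  move=> s; rewrite SE => /setU1P[->|/segP[r [_ rn ->]]]; last exact: all.
  by have [C dC] := all b lt_bn; apply: edge_displ kb dC.
move=> iN; case: bn => En; subst n.
  have [Cp dp] : exists C, displ C \in <<hub a b k>>.
    have [C dC] := typS _ (path_gens pa n0); exists C; apply: genS_mem dC.
    apply/subsetP=> x /setD1P[nx]; rewrite SE => /setU1P[->|/segP[[|r] [_ rn Er]]].
    - by rewrite !inE eqxx.
    - by rewrite Er eqxx in nx.
    by rewrite Er inE seg_at ?orbT.
  have [C [dC|dC]] := fork_displ pS th_adj th_surj thickD twist_id pa Sk kN kfar
    (edge_braid laced kb) SE dv dp.
    exact: path_displ_all dC _ iN.
  exact: (path_displ_all_rev (n := b.+2) pa dC iN).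
have [C dC] := fork_arm2_displ pa F b0 dv.
exact: (path_displ_all_rev (n := b.+3) pa dC iN).
Qed.

End Assembly.

Section Oppomorphism.

Variables (gT : finGroupType) (cox : coxeter_system gT) (Delta : building cox).
Variable theta : automorphism Delta.
Local Notation S := (gens cox).

(** A proper subset J omits some s, and the parabolic subgroup of S minus J contains a
    displacement in that of s alone. *)
Lemma opp_strong : irreducible cox -> thick Delta -> exceptional_domestic theta ->
  oppomorphism theta -> simply_laced cox -> strongly_exceptional_domestic theta.
Proof.
move=> irr thickD [dom typS] opp laced; split=> // J prJ EJ.
have [pS _ th_adj] := type_permP theta.
have sJ := proper_sub prJ.
have twist_id s : s \in S -> twist cox (type_perm theta) s = s.
  by move=> Ss; rewrite /twist opp // -conjgM longestK conjg1.
have [s Ss nJs] : exists2 s, s \in S & s \notin J by case/properP: prJ.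
have [|C dC] := displ_generators pS th_adj (@chamber_map_surj _ _ _ theta) thickD twist_id
  laced irr _ Ss.
  move=> t St; have := St; rewrite -{1}typS => /bigcupP[K /andP[sK /asboolP OK] Kt].
  have [_ [C dC]] := (Opp_has_typeP theta sK).1 OK; exists C.
  by apply: genS_mem dC; apply: setDS; rewrite sub1set.
apply/(Opp_has_typeP theta sJ); split=> //; exists C; apply: genS_mem dC.
by rewrite sub1set inE nJs.
Qed.

End Oppomorphism.

Theorem corollary2p20 (gT : finGroupType) (cox : coxeter_system gT)
    (Delta : building cox) (theta : automorphism Delta) :
  irreducible cox -> thick Delta -> exceptional_domestic theta ->
  (oppomorphism theta -> simply_laced cox ->
     strongly_exceptional_domestic theta) /\
  (~ oppomorphism theta -> ~ strongly_exceptional_domestic theta).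
Proof.
move=> irr thickD exc; split; first exact: opp_strong.
exact: not_opp_not_strong.
Qed.
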